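(* In the setting described in the context (random walk $\mathbf S_n$ on $\mathbb Z^d$ attracted to a stable law), assume the balanced case: $\alpha_i= \alpha$ and $a_n^{(i)}= a_n$ for all $1\le i\le d$. Assume moreover that there are a positive exponent $\gamma$ and a slowly varying function $\varphi$ such that for all $\mathbf x\in\mathbb Z^d\setminus\{\mathbf 0\}$ $$\mathbf P(\mathbf X_1=\mathbf x)\le\varphi(\|\mathbf x\|)\,\|\mathbf x\|^{-(d+\gamma)},$$ where $\|\cdot\|$ is the $L^1$ norm. Let $\hat{\mathbf S}_n:=\mathbf S_n-\lfloor\mathbf b_n\rfloor$ (componentwise integer part). Then there are constants $c_3,C_3>0$ such that for every $n\ge1$ and every $\mathbf x\in\mathbb Z^d$ with $\|\mathbf x\|\ge a_n$, $$\mathbf P\big(\hat{\mathbf S}_n=\mathbf x\big)\le C_3\,n\,\varphi(\|\mathbf x\|)\,\|\mathbf x\|^{-(d+\gamma)}+\frac{C_3}{(a_n)^d}\,e^{-c_3(\|\mathbf x\|/a_n)^2}\,\mathbf 1_{\{\alpha=2\}}.$$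
   Context: Setting. Let $d\ge 1$, let $(\mathbf X_j)_{j\ge1}$ be i.i.d. $\mathbb Z^d$-valued random vectors, $\mathbf X_j=(X_j^{(1)},\dots,X_j^{(d)})$, $\mathbf S_0=\mathbf 0$ and $\mathbf S_n=\sum_{j=1}^n\mathbf X_j=(S_n^{(1)},\dots,S_n^{(d)})$. The walk is aperiodic: the support of $\mathbf X_1$ is not contained in a translate of a proper subgroup of $\mathbb Z^d$. There is $\boldsymbol\alpha=(\alpha_1,\dots,\alpha_d)\in(0,2]^d$ such that $$\Big(\frac{S_n^{(1)}-b_n^{(1)}}{a_n^{(1)}},\dots,\frac{S_n^{(d)}-b_n^{(d)}}{a_n^{(d)}}\Big)\Rightarrow\mathbf Z\quad\text{in distribution},$$ where $\mathbf Z$ is a multivariate stable law with non-degenerate density $g_{\boldsymbol\alpha}$ on $\mathbb R^d$, and the sequences are as follows. If $\alpha_i\in(0,2)$, there are a slowly varying function $L_i$ and $p_i,q_i\ge0$, $p_i+q_i=1$, with $\mathbf P(X_1^{(i)}>x)\sim p_iL_i(x)x^{-\alpha_i}$ and $\mathbf P(X_1^{(i)}\le -x)\sim q_iL_i(x)x^{-\alpha_i}$ as $x\to+\infty$ (read as $o(L_i(x)x^{-\alpha_i})$ when $p_i=0$, resp. $q_i=0$). If $\alpha_i=2$, $\sigma_i(x):=\mathbf E[(X_1^{(i)})^2\mathbf 1_{\{|X_1^{(i)}|\le x\}}]$ is slowly varying. Scaling sequences: $a_n^{(i)}>0$ satisfies $L_i(a_n^{(i)})(a_n^{(i)})^{-\alpha_i}\sim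 1/n$ if $\alpha_i\in(0,2)$ and $\sigma_i(a_n^{(i)})(a_n^{(i)})^{-2}\sim1/n$ if $\alpha_i=2$. (In the balanced case, these sequences are the same for all $i$, up to the usual constant rescaling of the limit law.) Recentering: $\mathbf b_n=(b_n^{(1)},\dots,b_n^{(d)})$ with $b_n^{(i)}=0$ if $\alpha_i\in(0,1)$; $b_n^{(i)}=n\mu_i$ if $\alpha_i>1$, where $\mu_i=\mathbf E[X_1^{(i)}]$; $b_n^{(i)}=n\mu_i(a_n^{(i)})$ if $\alpha_i=1$, where $\mu_i(x)=\mathbf E[X_1^{(i)}\mathbf 1_{\{|X_1^{(i)}|\le x\}}]$. Standing tail domination assumption: there are slowly varying functions $\varphi_i$ and exponents $\gamma_i\ge\alpha_i$ with $\mathbf P(X_1^{(i)}\le -x)+\mathbf P(X_1^{(i)}>x)\le\varphi_i(x)x^{-\gamma_i}$ for all $x\in\mathbb N$ and $1\le i\le d$. These are chosen so that: if $\mathbf E[(X_1^{(i)})^2]=+\infty$ then $\gamma_i=\alpha_i$, with $\varphi_i$ a constant multiple of $L_i$ when $\alpha_i<2$ and $\varphi_i=O(\sigma_i)$ when $\alpha_i=2$; if $\mathbf E[(X_1^{(i)})^2]<+\infty$ then $\sum_{n\ge1}\varphi_i(n)n^{1-\gamma_i}<+\infty$. All regularly varying quantities are regarded as positive (where relevant) functions of positive real numbers. *)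

(* Defs.v *)
From HB Require Import structures.
From mathcomp Require Import all_boot all_order all_algebra.
From mathcomp Require Import all_classical all_reals all_analysis.
Set Implicit Arguments.
Unset Strict Implicit.
Unset Printing Implicit Defensive.
Import Order.TTheory GRing.Theory Num.Theory.
Import numFieldNormedType.Exports.
Local Open Scope classical_set_scope.
Local Open Scope ring_scope.

(* Measurability is part of the notion, as in Karamata's theory. Positivity is
   only required near +oo: a truncated second moment vanishes near 0. *)
Definition slowly_varying (R : realType) (f : R -> R) : Prop :=
  [/\ measurable_fun (`]0, +oo[%classic : set R) f,
      \forall x \near +oo, 0 < f x &
      forall lam : R, 0 < lam -> f (lam * x) / f x @[x --> +oo] --> (1 : R)].

Definition pos_slowly_varying (R : realType) (f : R -> R) : Prop :=
  slowly_varying f /\ forall x, 0 < x -> 0 < f x.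

Section Lattice.
Variable d : nat.
Implicit Types x y : 'rV[int]_d.

(* The library norm on row vectors is the sup norm. *)
Definition l1norm (R : realType) x : R := (\sum_(i < d) `|x 0 i|)%:~R.

End Lattice.

Section Walk.
Context {R : realType} {d : nat} {disp : measure_display}
  {Om : measurableType disp}.
Variable P : probability Om R.

Definition Pr (A : set Om) : R := fine (P A).

(* Steps are numbered from 0. Z^d carries its discrete
   sigma-algebra, in which every set is measurable. *)
Definition iid (X : nat -> Om -> 'rV[int]_d) : Prop :=
  [/\ forall j A, measurable (X j @^-1` A),
      forall j A, P (X j @^-1` A) = P (X 0%N @^-1` A) &
      forall (J : seq nat) (A : nat -> set 'rV[int]_d), uniq J ->
        P [set w | forall j, j \in J -> A j (X j w)] =
        (\prod_(j <- J) P (X j @^-1` A j))%E].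

Definition support (Y : Om -> 'rV[int]_d) : set 'rV[int]_d :=
  [set x | (0 < P [set w | Y w = x])%E].

Definition aperiodic (Y : Om -> 'rV[int]_d) : Prop :=
  forall (H : {pred 'rV[int]_d}) (x0 : 'rV[int]_d), zmod_closed H ->
    support Y `<=` [set x | x - x0 \in H] -> forall x, x \in H.

Definition walk (X : nat -> Om -> 'rV[int]_d) (n : nat) (w : Om) :
  'rV[int]_d := \sum_(j < n) X j w.

Definition coord (Y : Om -> 'rV[int]_d) (i : 'I_d) (w : Om) : R :=
  (Y w 0 i)%:~R.

Definition mean (xi : Om -> R) : R := fine 'E_P[xi].

Definition trunc_mean (xi : Om -> R) (x : R) : R :=
  fine 'E_P[fun w => (if `|xi w| <= x then xi w else 0)%R].

Definition trunc_moment2 (xi : Om -> R) (x : R) : R :=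
  fine 'E_P[fun w => (if `|xi w| <= x then xi w ^+ 2 else 0)%R].

Definition moment2 (xi : Om -> R) : \bar R := 'E_P[fun w => (xi w ^+ 2)%R].

Definition right_tail (xi : Om -> R) (x : R) : R := Pr [set w | x < xi w].

Definition left_tail (xi : Om -> R) (x : R) : R := Pr [set w | xi w <= - x].

(* Stating the asymptotics by ratios gives the little-o reading when [p] or
   [q] vanishes. *)
Definition regular_tails (xi : Om -> R) (alpha : R) (L : R -> R) (p q : R) :
    Prop :=
  if alpha < 2 then
    [/\ pos_slowly_varying L, 0 <= p, 0 <= q, p + q = 1 &
        (right_tail xi x / (L x * x `^ (- alpha)) @[x --> +oo] --> p) /\
        (left_tail xi x / (L x * x `^ (- alpha)) @[x --> +oo] --> q)]
  else slowly_varying (trunc_moment2 xi).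

Definition scaling (xi : Om -> R) (alpha : R) (L : R -> R) (a : nat -> R) :
    Prop :=
  let l := if alpha < 2 then L else trunc_moment2 xi in
  (forall n, (0 < n)%N -> 0 < a n) /\
  n%:R * (l (a n) * a n `^ (- alpha)) @[n --> \oo] --> (1 : R).

Definition centering (xi : Om -> R) (alpha : R) (a : nat -> R) (n : nat) : R :=
  if alpha < 1 then 0
  else if alpha == 1 then n%:R * trunc_mean xi (a n)
  else n%:R * mean xi.

Definition tail_domination (xi : Om -> R) (alpha : R) (L : R -> R)
    (phi : R -> R) (gamma : R) : Prop :=
  [/\ pos_slowly_varying phi,
      alpha <= gamma,
      forall x : nat, (0 < x)%N ->
        left_tail xi x%:R + right_tail xi x%:R <= phi x%:R * x%:R `^ (- gamma),
      moment2 xi = +oo%E -> gamma = alpha /\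
        (if alpha < 2 then
           exists2 c : R, 0 < c & forall x, 0 < x -> phi x = c * L x
         else
           exists C : R, \forall x \near +oo, phi x <= C * trunc_moment2 xi x) &
      (moment2 xi < +oo)%E ->
        cvgn (series (fun n : nat => phi n.+1%:R * n.+1%:R `^ (1 - gamma)))].

End Walk.

Section StableLaw.
Context {R : realType} {d : nat}.

(* R^d with its Borel sigma-algebra. *)
Definition borel_space := g_sigma_algebraType (@open 'rV[R]_d).

Definition dilation (alpha : 'I_d -> R) (s : R) (z : 'rV[R]_d) : 'rV[R]_d :=
  \row_i (s `^ (alpha i)^-1 * z 0 i).

(* For independent copies Z1, Z2 of Z, s^(1/alpha) Z1 + t^(1/alpha) Z2 has the
   law of (s + t)^(1/alpha) Z + D, the powers acting coordinatewise. *)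
Definition stable_law (alpha : 'I_d -> R) (nu : probability borel_space R) :
    Prop :=
  forall s t : R, 0 < s -> 0 < t -> exists D : 'rV[R]_d,
  forall A : set borel_space, measurable A ->
    (nu \x nu)%E [set z : borel_space * borel_space |
       A (dilation alpha s z.1 + dilation alpha t z.2)] =
    nu [set z : borel_space | A (dilation alpha (s + t) z + D)].

End StableLaw.
Arguments borel_space : clear implicits.

(* Integral of a nonnegative Borel function against Lebesgue measure on R^d,
   as an iterated integral (Tonelli). *)
Fixpoint lebesgue_int (R : realType) (d : nat) :
    ('rV[R]_d -> \bar R) -> \bar R :=
  match d with
  | 0 => fun f => f 0
  | k.+1 => fun f =>
      (\int[lebesgue_measure]_t
         lebesgue_int (fun z : 'rV[R]_k => f (row_mx (t%:M : 'rV[R]_1) z)))%E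
  end.

Definition has_density (R : realType) (d : nat)
    (nu : probability (borel_space R d) R) (g : 'rV[R]_d -> R) : Prop :=
  [/\ measurable_fun [set: borel_space R d] (g : borel_space R d -> R),
      forall z, 0 <= g z &
      forall A : set (borel_space R d), measurable A ->
        nu A = lebesgue_int (fun z => (\1_A z * g z)%:E)].

Definition cvg_in_law (R : realType) (d : nat) (disp : measure_display)
    (Om : measurableType disp) (P : probability Om R)
    (Y : nat -> Om -> 'rV[R]_d) (nu : probability (borel_space R d) R) : Prop :=
  forall f : 'rV[R]_d -> R, continuous f ->
    (exists M : R, forall z, `|f z| <= M) ->
    'E_P[fun w => f (Y n w)]%E @[n --> \oo] --> (\int[nu]_z (f z)%:E)%E.

Section Setting.
Context {R : realType} {d : nat} {disp : measure_display}
  {Om : measurableType disp}.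
Variables (P : probability Om R) (X : nat -> Om -> 'rV[int]_d).
Variables (alpha : 'I_d -> R) (a : 'I_d -> nat -> R).

Definition drift (i : 'I_d) (n : nat) : R :=
  centering P (coord (X 0%N) i) (alpha i) (a i) n.

Definition normalized_walk (n : nat) (w : Om) : 'rV[R]_d :=
  \row_i (((walk X n w 0 i)%:~R - drift i n) / a i n).

Definition centered_walk (n : nat) (w : Om) : 'rV[int]_d :=
  walk X n w - \row_i Num.floor (drift i n).

Record attracted_walk (L : 'I_d -> R -> R) (p q : 'I_d -> R)
    (phi : 'I_d -> R -> R) (gamma : 'I_d -> R)
    (nu : probability (borel_space R d) R) (g : 'rV[R]_d -> R) : Prop :=
  AttractedWalk {
    attracted_iid : iid P X;
    attracted_aperiodic : aperiodic P (X 0%N);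
    attracted_index : forall i, 0 < alpha i <= 2;
    attracted_tails : forall i,
      regular_tails P (coord (X 0%N) i) (alpha i) (L i) (p i) (q i);
    attracted_scaling : forall i,
      scaling P (coord (X 0%N) i) (alpha i) (L i) (a i);
    attracted_stable : stable_law alpha nu;
    attracted_density : has_density nu g;
    attracted_cvg : cvg_in_law P normalized_walk nu;
    attracted_domination : forall i,
      tail_domination P (coord (X 0%N) i) (alpha i) (L i) (phi i) (gamma i)
  }.

(* The sequence [a i] is normalized exactly by the tails of coordinate i, so
   a common sequence is only required up to constant factors, which rescale
   the coordinates of the limit law; [kappa = 1] gives equal sequences. *)
Definition balanced (al : R) (an : nat -> R) : Prop :=
  (forall i, alpha i = al) /\
  forall i, exists2 kappa : R, 0 < kappa &
    forall n, (0 < n)%N -> a i n = kappa * an n.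

End Setting.

(* Main.v *)
(** A walk that reaches x either makes a step of norm larger than |x|/K, which
    costs n sup_{|z| > |x|/K} P(X = z), of the announced order by Potter's bounds
    for phi; or it gets there by small steps only. In the second case one of the
    two halves of the path covers half of the distance along some coordinate. That
    event is estimated by exponential tilting, and the other half of the path by
    the local bound sup_z P(S_m = z) <= C / a_m^d, which comes from the Fejer
    kernel and from |E exp(i t.X)|^2 <= 1 - c/k for |t| a_k >= 1: the limit law has
    a density, so the modulus of its characteristic function is < 1 away from 0,
    uniformly on compact annuli.

    The truncated moments are controlled at the scale a_n by Karamata's estimates.
    The tilt log(y / a_n) / y, with y = |x|/K, bounds the small-step part by
    C a_n^-d (|x| / a_n)^(-cK). For alpha < 2 the hypothesis on P(X = z) forces
    P(|X| >= y) <= C phi(y) y^-gamma, so that the jump term absorbs this once K is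
    large. For alpha = 2 it does so unless delta = n phi(|x|) |x|^-gamma is below
    a_n / |x|; then the tilt min(eta |x| / a_n^2, log(1/delta) / (2y)) leaves
    C a_n^-d (exp(-c (|x| / a_n)^2) + delta^(d+1)). *)

From HB Require Import structures.
Require Import Defs.
From mathcomp Require Import all_boot all_order all_algebra.
From mathcomp Require Import all_classical all_reals all_analysis.
From mathcomp Require Import measurable_realfun.
From mathcomp Require Import ring lra zify.
Set Implicit Arguments.
Unset Strict Implicit.
Unset Printing Implicit Defensive.
Import Order.TTheory GRing.Theory Num.Theory.
Import numFieldNormedType.Exports.
Local Open Scope classical_set_scope.
Local Open Scope ring_scope.

(** * Slow variation *)

Section SlowVariation.
Context {R : realType}.
Implicit Types (f g : R -> R).

(** The factor a_n^-d and the exponential gain have to come from disjoint groups of steps: once the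
    tilted half of the path is fixed, the endpoint leaves a single value for the other half, so that
    the local bound applies to it. For alpha = 2 the obstacle is a possibly infinite variance. If
    all steps up to y entered the quadratic term, the truncated second moment at scale y would
    replace the one at scale a_n, and their ratio may be an unbounded slowly varying factor, which
    ruins the Gaussian exponent. With tilt s the quadratic expansion is therefore used only for
    coordinates up to 1/s. A larger step of norm at most y gets weight at most e^(s y), and its
    probability is bounded point by point by the hypothesis on P(X = z); n times the total is of
    order delta e^(s y), up to a power of s y, and stays bounded as long as s y <= log(1/delta) / 2.
    The other entry of the minimum optimizes, up to constants, the exponent - s |x| + C (s a_n)^2.
    Paths are summed over finite lists of lattice points, which makes conditioning a finite
    identity; boxes exhaust Z^d afterwards. *)

Lemma lebesgue_measure_shift (v : R) (A : set R) : measurable A ->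
  lebesgue_measure ((fun x => x + v) @^-1` A) = lebesgue_measure A.
Proof.
move=> mA.
have mS : measurable_fun [set: measurableTypeR R]
    ((fun x : R => x + v) : measurableTypeR R -> measurableTypeR R).
  exact: measurable_funD.
pose S : {mfun measurableTypeR R >-> measurableTypeR R} :=
  HB.pack (fun x : R => x + v) (isMeasurableFun.Build _ _ _ _ _ mS).
rewrite -[LHS]/(pushforward (@lebesgue_measure R) S A).
rewrite -(@lebesgue_measure_unique R (pushforward (@lebesgue_measure R) S))//.
move=> X [[a b]] /= ab <-; rewrite /pushforward /=.
have -> : (fun x : R => x + v) @^-1` `]a, b] = `]a - v, b - v]%classic.
  by apply/seteqP; split => x /=; rewrite !in_itv /=; lra.
rewrite !lebesgue_measure_itv/= !lte_fin ltrD2r; case: ifPn => // _.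
by rewrite -!EFinD; congr (_%:E); lra.
Qed.

(** An Egorov argument: the sets [E n] of increments that are good from index [n] on increase to
    [0, 2], so their measures tend to 2 and eventually exceed 3/2. *)
Lemma large_uniform_set g (w : nat -> R) : measurable_fun [set: R] g ->
  (forall v, g (u + v) - g u @[u --> +oo] --> 0) -> w @ \oo --> +oo ->
  exists n : nat, forall m, (n <= m)%N -> exists A : set R,
  [/\ measurable A, A `<=` `[0, 2], ((3 / 2)%:E < lebesgue_measure A)%E &
      forall v, A v -> `|g (w m + v) - g (w m)| <= 1 / 2].
Proof.
move=> mg hg wo.
pose B k : set R := [set v | `|g (w k + v) - g (w k)| <= 1 / 2].
pose E n : set R := `[0, 2]%classic `&` \bigcap_(k in [set k | (n <= k)%N]) B k.
have mB k : measurable (B k).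
  have mh : measurable_fun [set: R] (fun v => `|g (w k + v) - g (w k)|).
    apply: measurableT_comp => //; apply: measurable_funB => //.
    by apply: measurableT_comp => //; exact: measurable_funD.
  have := mh measurableT `]-oo, (1 / 2)]%classic (measurable_itv _).
  by rewrite setTI; congr measurable; apply/seteqP; split => x /=;
    rewrite in_itv.
have mE n : measurable (E n).
  apply: measurableI => //; apply: bigcap_measurable => //.
  by exists n => /=.
have UE : \bigcup_n E n = `[0, 2]%classic.
  apply/seteqP; split => [v [n _ []]//|v v02].
  have [N _ hN] : \forall k \near \oo, B k v.
    move/cvgrPdist_le : (hg v) => /(_ (1 / 2)); rewrite divr_gt0//.
    move=> /(_ isT) H; have {}H : \forall k \near \oo,
      `|0 - (g (w k + v) - g (w k))| <= 1 / 2 := wo _ H.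
    by apply: filterS H => k; rewrite /B /= sub0r normrN.
  by exists N => //; split => // k /= Nk; exact: hN.
have ndE : nondecreasing_seq E.
  move=> m n mn; apply/subsetPset => v [v02 hv]; split => // k /= nk.
  by apply: hv => /=; exact: leq_trans nk.
have m02 : lebesgue_measure (`[0, 2]%classic : set R) = (2 : R)%:E.
  by rewrite lebesgue_measure_itv /= lte_fin ltr0n /= sube0.
have /fine_cvgP[Efin Ecvg] : (lebesgue_measure \o E) @ \oo --> (2 : R)%:E.
  rewrite -m02 -UE; apply: nondecreasing_cvg_mu => //.
  by rewrite UE; exact: measurable_itv.
have [N _ hN] := filterI Efin (cvgr_gt _ Ecvg (3 / 2) (ltac:(lra))).
exists N => m Nm; exists (E m); split => //.
- by move=> v [].
- by have [/fineK fN gN] := hN _ Nm; rewrite /= in fN gN; rewrite -fN lte_fin.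
- by move=> v [_ hv]; exact: (hv m (leqnn m)).
Qed.

(* For u, u + v far out, the increments from u and from u + v are small on sets of
   measure > 3/2 inside [0, 2] and [v, v + 2]: these have to meet. *)
Lemma additive_increment_bounded g : measurable_fun [set: R] g ->
  (forall v, g (u + v) - g u @[u --> +oo] --> 0) ->
  exists u0, forall u v, u0 <= u -> 0 <= v <= 1 -> `|g (u + v) - g u| <= 1.
Proof.
move=> mg hg; apply/not_existsP => H.
have {}H (n : nat) : exists uv : R * R,
    [/\ n%:R <= uv.1, 0 <= uv.2 <= 1 & 1 < `|g (uv.1 + uv.2) - g uv.1| ].
  have /existsNP[u /existsNP[v]] := H n%:R.
  move=> /not_implyP[nu /not_implyP[v01 /negP]]; rewrite -ltNge => huv.
  by exists (u, v).
have [uv huv] := choice H.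
have uoo : (fun n => (uv n).1) @ \oo --> +oo.
  apply: (@ger_cvgy _ _ _ _ (fun n => n%:R)); last exact: cvgr_idn.
  by apply: nearW => n; have [] := huv n.
have uvoo : (fun n => (uv n).1 + (uv n).2) @ \oo --> +oo.
  apply: (@ger_cvgy _ _ _ _ (fun n => n%:R)); last exact: cvgr_idn.
  by apply: nearW => n; have [? /andP[? ?] _] := huv n; rewrite ler_wpDr.
have [n1 h1] := large_uniform_set mg hg uoo.
have [n2 h2] := large_uniform_set mg hg uvoo.
set m := maxn n1 n2.
have [A [mA A02 muA hA]] := h1 m (leq_maxl _ _).
have [B [mB B02 muB hB]] := h2 m (leq_maxr _ _).
have [un /andP[v0 v1] gt1] := huv m.
set u := (uv m).1 in hA hB gt1 *; set v := (uv m).2 in v0 v1 hB gt1 *.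
pose B' := (fun x => x - v) @^-1` B.
have mB' : measurable B'.
  rewrite -[B']setTI; apply: measurable_funB => //.
(* At a common point [x] both increments end at [g (u + x)], so [g u] and [g (u + v)] would differ
   by at most 1/2 + 1/2. *)
have AB0 : A `&` B' = set0.
  apply/seteqP; split => // x [Ax B'x].
  have := hA _ Ax; have := hB _ B'x.
  have -> : u + v + (x - v) = u + x by ring.
  by move: gt1; rewrite !ler_norml ltr_normr => /orP[]; lra.
have h3 : (lebesgue_measure (A `|` B') <= (3%:R : R)%:E)%E.
  have -> : (3%:R : R)%:E = lebesgue_measure (`[0, 3]%classic : set R).
    by rewrite lebesgue_measure_itv /= lte_fin ltr0n /= sube0.
  apply: le_measure; rewrite ?inE//; first exact: measurableU.
  move=> x [/A02|/B02] /=; rewrite !in_itv/=; lra.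
move: h3.
have -> : lebesgue_measure (A `|` B') =
    (lebesgue_measure A + lebesgue_measure B)%E.
  by rewrite -(lebesgue_measure_shift (- v) mB); exact: measureU.
apply/negP; rewrite -ltNge.
have -> : (3%:R : R)%:E = ((3 / 2 : R)%:E + (3 / 2 : R)%:E)%E.
  by rewrite -EFinD; congr (_%:E); lra.
exact: lteD.
Qed.

Lemma expR_cvgy : @expR R x @[x --> +oo] --> +oo.
Proof.
apply: (@ger_cvgy _ _ _ _ id) => //; apply: nearW => x.
by apply: le_trans (expR_ge1Dx x); rewrite lerDr.
Qed.

(** In logarithmic coordinates slow variation says that the increments of ln f(e^u) tend to 0. Their
    boundedness by 1 over windows of length 1 becomes a factor [expR 1] for ratios up to
    [expR 1]. *)
Lemma slowly_varying_bounded_ratio (f : R -> R) : slowly_varying f ->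
  exists2 x0, 0 < x0 & forall x lam, x0 <= x -> 1 <= lam <= expR 1 ->
    [/\ 0 < f x, f (lam * x) <= expR 1 * f x & f x <= expR 1 * f (lam * x)].
Proof.
move=> [mf [M [_ f0]] hf].
pose g u := ln (f (expR u)).
have mg : measurable_fun [set: R] g.
  apply: measurableT_comp; first exact: measurable_ln.
  apply: (measurable_comp _ _ mf) => //.
  by move=> _ [x _ <-] /=; rewrite in_itv/= andbT expR_gt0.
have [u0 hu0] : exists u0, forall u v, u0 <= u -> 0 <= v <= 1 ->
    `|g (u + v) - g u| <= 1.
  apply: additive_increment_bounded => // v.
  have H : ln (f (expR v * expR u) / f (expR u)) @[u --> +oo] --> 0.
    rewrite -(@ln1 R).
    apply: (cvg_comp (fun u => f (expR v * expR u) / f (expR u)) (@ln R)); last first.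
      by apply: continuous_ln; rewrite ltr01.
    apply: (cvg_comp (@expR R) (fun x => f (expR v * x) / f x)).
      exact: expR_cvgy.
    by apply: hf; exact: expR_gt0.
  apply: cvg_trans H; apply: near_eq_cvg.
  near=> u; have uM : M - v < u.
    by near: u; apply: nbhs_pinfty_gt; rewrite num_real.
  have uM' : M < u by near: u; apply: nbhs_pinfty_gt; rewrite num_real.
  rewrite /g [u + v]addrC expRD ln_div//; apply: f0.
    by rewrite -expRD; apply: lt_le_trans (expR_ge1Dx _); lra.
  by apply: lt_le_trans (expR_ge1Dx _); lra.
exists (Num.max (expR u0) (Num.max 1 (M + 1))).
  by rewrite !lt_max ltr01 orbT.
move=> x lam; rewrite !ge_max => /and3P[xu x1 xM] /andP[lam1 lame].
have x_gt0 : 0 < x by lra.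
have lam0 : 0 < lam by lra.
have fx : 0 < f x by apply: f0; lra.
have flx : 0 < f (lam * x) by apply: f0; nra.
have u0x : u0 <= ln x by rewrite -[u0]expRK ler_ln ?posrE ?expR_gt0.
have lnl : 0 <= ln lam <= 1.
  by rewrite ln_ge0//= -[leRHS]expRK ler_ln ?posrE ?expR_gt0.
have := hu0 _ _ u0x lnl.
rewrite /g expRD !lnK ?posrE// [x * lam]mulrC ler_norml -ln_div ?posrE//.
move=> /andP[h1 h2]; split => //.
- rewrite -ler_pdivrMr// -[leLHS]lnK ?posrE ?divr_gt0//.
  by rewrite ler_expR.
- rewrite -ler_pdivrMr// -[leLHS]lnK ?posrE ?divr_gt0//.
  by rewrite ler_expR; move: h1; rewrite !ln_div ?posrE//; lra.
Unshelve. all: by end_near.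
Qed.

Lemma powR_div (x y r : R) : 0 <= x -> 0 <= y ->
  (x / y) `^ r = x `^ r / y `^ r.
Proof.
move=> x0 y0; rewrite powRM ?invr_ge0//; congr (_ * _).
by rewrite -[y^-1]powR_inv1// powRAC powR_inv1 ?powR_ge0.
Qed.

Lemma powR_ge1 (x r : R) : 1 <= x -> 0 <= r -> 1 <= x `^ r.
Proof. by move=> x1 r0; rewrite -(powRr0 x) ler_powR. Qed.

Lemma ratio_near f (lam eps : R) : slowly_varying f -> 0 < lam -> 1 < eps ->
  \forall x \near +oo, f (lam * x) <= eps * f x /\ f x <= eps * f (lam * x).
Proof.
move=> sf lam0 eps1; have [_ f0 hf] := sf.
have flam0 : \forall x \near +oo, 0 < f (lam * x).
  have [M [Mr hM]] := f0; exists (M / lam); split; first exact: num_real.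
  by move=> x; rewrite ltr_pdivrMr// mulrC => /hM.
have h1 := cvgr_le _ (hf _ lam0) eps eps1.
have h2 : \forall x \near +oo, eps^-1 <= f (lam * x) / f x.
  by apply: (cvgr_ge _ (hf _ lam0)); rewrite invf_lt1//; lra.
near=> x.
have fx : 0 < f x by near: x.
split.
  by rewrite -ler_pdivrMr//; near: x; exact: h1.
rewrite -ler_pdivrMl; last by lra.
by rewrite -ler_pdivlMr//; near: x; exact: h2.
Unshelve. all: by end_near. Qed.

(** Moving from [x] to [y] by factors e, each full step changes [f] by at most e^eps, by slow
    variation at the single ratio e; the last, incomplete step costs the uniform constant e. The
    product is e (y / x)^eps. *)
Lemma potter f (eps : R) : slowly_varying f -> 0 < eps ->
  exists x0 C : R, [/\ 0 < x0, 0 < C & forall x y, x0 <= x -> x <= y ->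
    [/\ 0 < f x, f y <= C * (y / x) `^ eps * f x &
        f x <= C * (y / x) `^ eps * f y]].
Proof.
move=> sf eps0; have [x1 x1_gt0 h1] := slowly_varying_bounded_ratio sf.
set e := expR 1 in h1.
have e0 : 0 < e := expR_gt0 _.
have e1 : 1 < e by rewrite /e expR_gt1.
have ee : 1 < e `^ eps by rewrite -expRM mul1r expR_gt1.
have [x2 [_ h2]] := ratio_near sf e0 ee.
set x0 := Num.max x1 (x2 + 1).
have x0_gt0 : 0 < x0 by rewrite lt_max x1_gt0.
exists x0, e; split => //.
have key n x y : x0 <= x -> x <= y -> y <= e ^+ n.+1 * x ->
  [/\ 0 < f x, f y <= e * (y / x) `^ eps * f x &
      f x <= e * (y / x) `^ eps * f y].
  rewrite /x0 ge_max => /andP[x1x x2x] xy.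
  have x_gt0 : 0 < x by lra.
  elim: n y xy => [|n IH] y xy yx.
    have yx1 : 1 <= y / x by rewrite ler_pdivlMr// mul1r.
    have := h1 x (y / x) x1x; rewrite divfK ?gt_eqF//.
    rewrite yx1 /= ler_pdivrMr// -[e]expr1 yx => /(_ isT) [fx fy fxy].
    have yp : 1 <= (y / x) `^ eps.
      by rewrite powR_ge1// ltW.
    have fy0 : 0 < f y by rewrite expr1 in fxy; nra.
    split => //.
      apply: le_trans fy _; rewrite expr1 ler_pM2r// ler_peMr//; lra.
    apply: le_trans fxy _; rewrite expr1 ler_pM2r// ler_peMr//; lra.
  have [/IH|ey] := leP y (e ^+ n.+1 * x); first exact.
  have xye : x <= y / e.
    rewrite ler_pdivlMr//; apply: le_trans (ltW ey); rewrite mulrC ler_pM2r//.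
    by rewrite exprS ler_pMr// exprn_ege1// ltW.
  have [|fx h3 h4] := IH (y / e) xye.
    by rewrite ler_pdivrMr// mulrAC -exprSr.
  have [|h5 h6] := h2 (y / e); first by lra.
  rewrite mulrCA divff ?gt_eqF// mulr1 in h5 h6.
  have -> : (y / x) `^ eps = e `^ eps * (y / e / x) `^ eps.
    rewrite -powRM ?divr_ge0//; [|lra..]; congr powR.
    by field; rewrite !gt_eqF.
  set Q := (y / e / x) `^ eps in h3 h4 *; set ep := e `^ eps in ee h5 h6 *.
  split => //.
    apply: le_trans h5 _; have -> : e * (ep * Q) * f x = ep * (e * Q * f x).
      by ring.
    by rewrite ler_pM2l//; lra.
  apply: le_trans h4 _; have -> : e * (ep * Q) * f y = e * Q * (ep * f y).
    by ring.
  by rewrite ler_wpM2l// mulr_ge0 ?powR_ge0// ltW.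
move=> x y x0x xy.
have x_gt0 : 0 < x by lra.
apply: (key (Num.truncn (y / x))) => //.
rewrite -ler_pdivrMr//; apply: le_trans (ltW (truncnS_gt _)) _.
rewrite /e -expRM_natl -[leLHS]mulr1; apply: le_trans (expR_ge1Dx _).
by rewrite lerDr.
Qed.

Lemma potter_regular f (a eps : R) : slowly_varying f -> 0 < eps ->
  let V := fun x => f x * x `^ (- a) in
  exists x0 C : R, [/\ 0 < x0, 0 < C & forall x y, x0 <= x -> x <= y ->
    [/\ 0 < V x, V y <= C * (y / x) `^ (eps - a) * V x &
        V x <= C * (y / x) `^ (eps + a) * V y]].
Proof.
move=> sf eps0 V; have [x0 [C [x00 C0 h]]] := potter sf eps0.
exists x0, C; split => // x y x0x xy; have [fx h1 h2] := h x y x0x xy.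
have x_gt0 : 0 < x by lra.
have y_gt0 : 0 < y by lra.
have yx_neq0 : y / x != 0 by rewrite gt_eqF// divr_gt0.
rewrite /V /=; split; first by rewrite mulr_gt0// powR_gt0.
  rewrite powRD ?yx_neq0 ?implybT//.
  rewrite (powR_div (- a) (ltW y_gt0) (ltW x_gt0)).
  have -> : C * ((y / x) `^ eps * (y `^ (- a) / x `^ (- a))) * (f x * x `^ (- a))
    = (C * (y / x) `^ eps * f x) * y `^ (- a).
    by field; rewrite gt_eqF// powR_gt0.
  by apply: ler_wpM2r => //; exact: powR_ge0.
rewrite (_ : eps + a = eps - (- a)); last by rewrite opprK.
rewrite powRB ?yx_neq0 ?implybT//.
rewrite (powR_div (- a) (ltW y_gt0) (ltW x_gt0)).
have -> : C * ((y / x) `^ eps / (y `^ (- a) / x `^ (- a))) *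
   (f y * y `^ (- a)) = (C * (y / x) `^ eps * f y) * x `^ (- a).
  by field; rewrite !gt_eqF// powR_gt0.
by apply: ler_wpM2r => //; exact: powR_ge0.
Qed.

End SlowVariation.

(** * Sums over paths *)

Section PathSums.
Context {R : realType} {V : zmodType}.
Implicit Types (s : seq V) (f : V -> R) (h : V -> R).

(* For f the law of a step, the expectation of h(S_n) on the event that all
   steps lie in the finite list s. *)
Fixpoint path_sum s f (n : nat) h : R :=
  if n is m.+1 then \sum_(z <- s) f z * path_sum s f m (fun u => h (z + u))
  else h 0.

Let eq_subrE (u x z : V) : (u == x - z) = (z + u == x).
Proof. by rewrite eq_sym subr_eq eq_sym addrC. Qed.

Lemma eq_path_sum s f n h1 h2 : h1 =1 h2 ->
  path_sum s f n h1 = path_sum s f n h2.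
Proof. by move=> /funext ->. Qed.

Lemma path_sumD s f n h1 h2 :
  path_sum s f n (fun u => h1 u + h2 u) = path_sum s f n h1 + path_sum s f n h2.
Proof.
elim: n h1 h2 => [//|n IH] h1 h2 /=; rewrite -big_split /=.
by apply: eq_bigr => z _; rewrite IH mulrDr.
Qed.

Lemma path_sumZ s f n c h :
  path_sum s f n (fun u => c * h u) = c * path_sum s f n h.
Proof.
elim: n h => [//|n IH] h /=; rewrite mulr_sumr.
by apply: eq_bigr => z _; rewrite IH mulrCA.
Qed.

Lemma path_sum_sum s f n (I : Type) (r : seq I) (h : I -> V -> R) :
  path_sum s f n (fun u => \sum_(i <- r) h i u) =
  \sum_(i <- r) path_sum s f n (h i).
Proof.
elim: r => [|i r IH].
  rewrite big_nil (eq_path_sum _ _ _ (h2 := fun u => 0 * 0)).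
    by rewrite path_sumZ mul0r.
  by move=> u; rewrite big_nil mul0r.
rewrite big_cons -IH -path_sumD.
by apply: eq_path_sum => u; rewrite big_cons.
Qed.

Lemma path_sum_add s f m n h : path_sum s f (m + n) h =
  path_sum s f m (fun u => path_sum s f n (fun v => h (u + v))).
Proof.
elim: m h => [|m IH] h /=.
  by rewrite add0n; apply: eq_path_sum => u; rewrite add0r.
apply: eq_bigr => z _; rewrite IH; congr (_ * _).
apply: eq_path_sum => u; apply: eq_path_sum => v; by rewrite addrA.
Qed.

Lemma path_sum_exchange s f m n (F : V -> V -> R) :
  path_sum s f m (fun u => path_sum s f n (F u)) =
  path_sum s f n (fun v => path_sum s f m (F ^~ v)).
Proof.
elim: m F => [//|m IH] F /=.
rewrite path_sum_sum; apply: eq_bigr => z _.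
by rewrite path_sumZ -IH.
Qed.

Section Nonnegative.
Variables (s : seq V) (f : V -> R).
Hypothesis f0 : forall z, 0 <= f z.

Lemma ler_path_sum n h1 h2 : (forall u, h1 u <= h2 u) ->
  path_sum s f n h1 <= path_sum s f n h2.
Proof.
elim: n h1 h2 => [|n IH] h1 h2 h12 /=; first exact: h12.
apply: ler_sum => z _; apply: ler_wpM2l => //; apply: IH => u; exact: h12.
Qed.

Lemma path_sum_ge0 n h : (forall u, 0 <= h u) -> 0 <= path_sum s f n h.
Proof.
elim: n h => [|n IH] h h0 /=; first exact: h0.
by apply: sumr_ge0 => z _; rewrite mulr_ge0// IH.
Qed.

Lemma path_sum_le_cst n h c : 0 <= c -> \sum_(z <- s) f z <= 1 ->
  (forall u, h u <= c) -> path_sum s f n h <= c.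
Proof.
move=> c0 f1; elim: n h => [|n IH] h hc /=; first exact: hc.
apply: le_trans (_ : \sum_(z <- s) f z * c <= _).
  by apply: ler_sum => z _; apply: ler_wpM2l => //; apply: IH => u; exact: hc.
by rewrite -mulr_suml ler_piMl.
Qed.

(* Given the first half, the second one is a single point, and conversely. *)
Lemma path_sum_split m n (w : V) (A B : pred V) (Qm Qn : R) :
  (forall u v, u + v = w -> A u || B v) ->
  (forall v, path_sum s f m (fun u => (u == v)%:R) <= Qm) ->
  (forall v, path_sum s f n (fun u => (u == v)%:R) <= Qn) ->
  path_sum s f (m + n) (fun u => (u == w)%:R) <=
  Qn * path_sum s f m (fun u => (A u)%:R) +
  Qm * path_sum s f n (fun u => (B u)%:R).
Proof.
move=> AB hm hn; rewrite path_sum_add.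
apply: le_trans (_ : path_sum s f m (fun u => path_sum s f n (fun v =>
    (A u)%:R * (v == w - u)%:R + (B v)%:R * (u == w - v)%:R)) <= _).
  apply: ler_path_sum => u; apply: ler_path_sum => v.
  rewrite !eq_subrE [v + u]addrC.
  have [/AB /orP[]->|_] := eqVneq (u + v) w; rewrite !(mulr0, mulr1, addr0)//=.
    by rewrite lerDl ler0n.
  by rewrite lerDr ler0n.
under [path_sum _ _ m _]eq_path_sum do rewrite path_sumD.
rewrite path_sumD; apply: lerD.
  rewrite -path_sumZ; apply: ler_path_sum => u.
  by rewrite path_sumZ mulrC ler_wpM2r// hn.
rewrite path_sum_exchange -path_sumZ; apply: ler_path_sum => v.
by rewrite path_sumZ mulrC ler_wpM2r// hm.
Qed.

(** Union bound over the position of the first step violating [P]: once the other steps are fixed,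
    the endpoint [x] leaves a single value for it, of weight at most [B]. *)
Lemma path_sum_big_jump n (P : pred V) (B : R) (x : V) : uniq s ->
  \sum_(z <- s) f z <= 1 -> 0 <= B -> (forall z, ~~ P z -> f z <= B) ->
  path_sum s f n (fun u => (u == x)%:R) <=
  path_sum s (fun z => f z * (P z)%:R) n (fun u => (u == x)%:R) + n%:R * B.
Proof.
move=> us f1 B0 fB; elim: n x => [|n IH] x /=; first by rewrite mul0r addr0.
have E g z : path_sum s g n (fun u => (z + u == x)%:R) =
             path_sum s g n (fun u => (u == x - z)%:R).
  by apply: eq_path_sum => u; rewrite eq_subrE.
apply: le_trans (_ : \sum_(z <- s) (f z * (P z)%:R *
     path_sum s (fun z => f z * (P z)%:R) n (fun u => (z + u == x)%:R) +
   (f z * (n%:R * B) + B * path_sum s f n (fun u => (u == x - z)%:R))) <= _).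
  apply: ler_sum => z _; rewrite !E.
  have p0 g y : (forall z, 0 <= g z) ->
      0 <= path_sum s g n (fun u => (u == y)%:R).
    move=> g0; elim: n {IH E} y => [|n IH] y /=; first exact: ler0n.
    apply: sumr_ge0 => t _; rewrite mulr_ge0//.
    rewrite (eq_path_sum _ _ _ (h2 := fun u => (u == y - t)%:R)) ?IH// => u.
    by rewrite eq_subrE.
  have [Pz|/fB fz] := boolP (P z).
    rewrite mulr1 addrA -mulrDr ler_wpDr//; last exact: ler_wpM2l.
    by rewrite mulr_ge0// p0.
  rewrite mulr0 mul0r add0r ler_wpDl//; first by rewrite !mulr_ge0.
  by rewrite ler_wpM2r// p0.
rewrite big_split /= lerD2l big_split /= -mulr_suml -mulr_sumr.
rewrite -natr1 [(_ + 1) * _]mulrDl mul1r; apply: lerD.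
  by rewrite ler_piMl// mulr_ge0.
rewrite ler_piMr// -path_sum_sum; apply: path_sum_le_cst => // u.
have E2 z : (u == x - z) = (z == x - u).
  by rewrite !eq_subrE addrC.
under eq_bigr do rewrite E2.
have [xu|xu] := boolP (x - u \in s).
  rewrite (bigD1_seq (x - u))//= eqxx big1 ?addr0// => i /negPf ->.
  by [].
rewrite big_seq big1// => z zs; case: eqP => // zE.
by rewrite -zE zs in xu.
Qed.

Lemma path_sum_chernoff n (L : V -> R) (A : pred V) (a : R) :
  L 0 = 0 -> {morph L : u v / u + v} -> (forall u, A u -> a <= L u) ->
  path_sum s f n (fun u => (A u)%:R) <=
  expR (- a) * (\sum_(z <- s) f z * expR (L z)) ^+ n.
Proof.
move=> L0 LD hA.
have -> : (\sum_(z <- s) f z * expR (L z)) ^+ n =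
    path_sum s f n (fun u => expR (L u)).
  elim: n => [|n IH] /=; first by rewrite L0 expR0.
  rewrite exprS IH mulr_suml; apply: eq_bigr => z _.
  rewrite -mulrA -path_sumZ; congr (_ * _); apply: eq_path_sum => u.
  by rewrite LD expRD.
rewrite -path_sumZ; apply: ler_path_sum => u; rewrite -expRD.
have [/hA aL|_] := boolP (A u); last exact: expR_ge0.
by rewrite -[leLHS]expR0 ler_expR addrC subr_ge0.
Qed.

End Nonnegative.

(** Multiplicativity of the squared modulus of E exp(i L(S_n)), written in real and imaginary parts
    through the addition formulas. *)
Lemma path_sum_fourier s f n (L : V -> R) :
  L 0 = 0 -> {morph L : u v / u + v} ->
  path_sum s f n (fun u => cos (L u)) ^+ 2 +
  path_sum s f n (fun u => sin (L u)) ^+ 2 =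
  ((\sum_(z <- s) f z * cos (L z)) ^+ 2 +
   (\sum_(z <- s) f z * sin (L z)) ^+ 2) ^+ n.
Proof.
move=> L0 LD; elim: n => [|n IH].
  by rewrite /= L0 cos0 sin0 expr1n expr0n/= addr0.
rewrite [RHS]exprS -IH /=.
set c := path_sum _ _ _ _; set t := path_sum _ _ _ _.
have -> : \sum_(z <- s) f z * path_sum s f n (fun u => cos (L (z + u))) =
  (\sum_(z <- s) f z * cos (L z)) * c - (\sum_(z <- s) f z * sin (L z)) * t.
  rewrite !mulr_suml -sumrB; apply: eq_bigr => z _.
  rewrite -!mulrA -mulrBr; congr (_ * _).
  rewrite -!path_sumZ -mulN1r -path_sumZ -path_sumD.
  by apply: eq_path_sum => u; rewrite LD cosD mulN1r.
have -> : \sum_(z <- s) f z * path_sum s f n (fun u => sin (L (z + u))) =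
  (\sum_(z <- s) f z * sin (L z)) * c + (\sum_(z <- s) f z * cos (L z)) * t.
  rewrite !mulr_suml -big_split; apply: eq_bigr => z _ /=.
  rewrite -!mulrA -mulrDr; congr (_ * _).
  rewrite -!path_sumZ -path_sumD.
  by apply: eq_path_sum => u; rewrite LD sinD.
by ring.
Qed.

End PathSums.

(** * Expectations and the law of the walk *)

Section Box.
Context {d : nat}.

Definition box (K : nat) : seq 'rV[int]_d :=
  [seq \row_i ((f i : nat)%:Z - K%:Z) | f : {ffun 'I_d -> 'I_(K.*2.+1)}].

Lemma mem_box K (x : 'rV[int]_d) :
  (x \in box K) = [forall i, `|x 0 i| <= K%:Z].
Proof.
apply/idP/forallP => [xK i|xK].
  have /mapP[f _ ->] := xK; rewrite mxE.
  by case: (f i) => k /= hk; clear -hk; lia.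
apply/mapP; exists [ffun i => inord (absz (x 0 i + K%:Z))]; first by rewrite mem_enum.
apply/rowP => i; rewrite mxE ffunE.
by move: (x 0 i) (xK i) => y hy; rewrite inordK; lia.
Qed.

Lemma box_uniq K : uniq (box K).
Proof.
rewrite map_inj_uniq ?enum_uniq// => f g fg; apply/ffunP => i.
have := congr1 (fun M : 'rV[int]_d => M 0 i) fg; rewrite !mxE => h.
by apply: val_inj => /=; lia.
Qed.

Lemma size_box K : size (box K) = (K.*2.+1 ^ d)%N.
Proof. by rewrite size_map -cardE card_ffun !card_ord. Qed.

End Box.
Arguments box : clear implicits.

Section Walk.
Context {R : realType} {d : nat} {disp : measure_display}
  {Om : measurableType disp}.
Variable P : probability Om R.
Implicit Types (Y Z : Om -> R).

Definition Ex Y : R := \int[P]_w Y w.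

(** On bounded variables the real-valued [Ex] is linear and monotone without integrability
    conditions; functions of lattice variables are measurable because the sigma-algebra of Z^d is
    discrete. *)
Definition bounded_rv Y :=
  measurable_fun [set: Om] Y /\ exists M, forall w, `|Y w| <= M.

Lemma bounded_rv_integrable Y : bounded_rv Y ->
  P.-integrable [set: Om] (EFin \o Y).
Proof.
move=> [mY [M YM]]; apply: measurable_bounded_integrable => //.
  by rewrite (le_lt_trans (probability_le1 _ _))// ltry.
exists M; split; first exact: num_real.
by move=> x /ltW Mx w _; exact: le_trans Mx.
Qed.

Lemma bounded_rv_cst c : bounded_rv (fun=> c).
Proof. by split; [exact: measurable_cst|exists `|c|]. Qed.

Lemma bounded_rvD Y Z : bounded_rv Y -> bounded_rv Z ->
  bounded_rv (fun w => Y w + Z w).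
Proof.
move=> [mY [M YM]] [mZ [N ZN]]; split; first exact: measurable_funD.
by exists (M + N) => w; rewrite (le_trans (ler_normD _ _))// lerD.
Qed.

Lemma bounded_rvM Y Z : bounded_rv Y -> bounded_rv Z ->
  bounded_rv (fun w => Y w * Z w).
Proof.
move=> [mY [M YM]] [mZ [N ZN]]; split; first exact: measurable_funM.
by exists (M * N) => w; rewrite normrM ler_pM.
Qed.

Lemma bounded_rvZ c Y : bounded_rv Y -> bounded_rv (fun w => c * Y w).
Proof. by move=> bY; apply: bounded_rvM => //; exact: bounded_rv_cst. Qed.

Lemma bounded_rvB Y Z : bounded_rv Y -> bounded_rv Z ->
  bounded_rv (fun w => Y w - Z w).
Proof.
move=> bY /(bounded_rvZ (-1)) /(bounded_rvD bY).
by under eq_fun do rewrite mulN1r.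
Qed.

Lemma bounded_rv_sum (I : Type) (r : seq I) (F : I -> Om -> R) :
  (forall i, bounded_rv (F i)) -> bounded_rv (fun w => \sum_(i <- r) F i w).
Proof.
move=> hF; elim: r => [|i r IH].
  by under eq_fun do rewrite big_nil; exact: bounded_rv_cst.
by under eq_fun do rewrite big_cons; exact: bounded_rvD.
Qed.

Lemma bounded_rv_prod (I : Type) (r : seq I) (F : I -> Om -> R) :
  (forall i, bounded_rv (F i)) -> bounded_rv (fun w => \prod_(i <- r) F i w).
Proof.
move=> hF; elim: r => [|i r IH].
  by under eq_fun do rewrite big_nil; exact: bounded_rv_cst.
by under eq_fun do rewrite big_cons; exact: bounded_rvM.
Qed.

Lemma bounded_rv_indic (b : Om -> bool) : measurable [set w | b w] ->
  bounded_rv (fun w => (b w)%:R).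
Proof.
move=> mb; split; last by exists 1 => w; rewrite normr_nat; case: (b w).
have -> : (fun w => (b w)%:R) = \1_[set w | b w] :> (Om -> R).
  by apply/funext => w; rewrite indicE mem_setE.
exact: measurable_indic.
Qed.

Lemma Ex_cst c : Ex (fun=> c) = c.
Proof. by rewrite /Ex Rintegral_cst//= (_ : _ setT = 1%E) ?mulr1//; exact: probability_setT. Qed.

Lemma ExD Y Z : bounded_rv Y -> bounded_rv Z ->
  Ex (fun w => Y w + Z w) = Ex Y + Ex Z.
Proof. by move=> bY bZ; rewrite /Ex RintegralD//; exact: bounded_rv_integrable. Qed.

Lemma ExB Y Z : bounded_rv Y -> bounded_rv Z ->
  Ex (fun w => Y w - Z w) = Ex Y - Ex Z.
Proof. by move=> bY bZ; rewrite /Ex RintegralB//; exact: bounded_rv_integrable. Qed.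

Lemma ExZ c Y : bounded_rv Y -> Ex (fun w => c * Y w) = c * Ex Y.
Proof. by move=> bY; rewrite /Ex RintegralZl//; exact: bounded_rv_integrable. Qed.

Lemma Ex_sum (I : Type) (r : seq I) (F : I -> Om -> R) :
  (forall i, bounded_rv (F i)) ->
  Ex (fun w => \sum_(i <- r) F i w) = \sum_(i <- r) Ex (F i).
Proof.
move=> hF; elim: r => [|i r IH].
  by under eq_fun do rewrite big_nil; rewrite big_nil Ex_cst.
under eq_fun do rewrite big_cons.
by rewrite ExD// ?IH ?big_cons//; exact: bounded_rv_sum.
Qed.

Lemma ler_Ex Y Z : bounded_rv Y -> bounded_rv Z -> (forall w, Y w <= Z w) ->
  Ex Y <= Ex Z.
Proof. by move=> bY bZ YZ; apply: le_Rintegral => //; exact: bounded_rv_integrable. Qed.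

Lemma Ex_ge0 Y : (forall w, 0 <= Y w) -> 0 <= Ex Y.
Proof. by move=> Y0; apply: Rintegral_ge0. Qed.

Lemma ler_norm_Ex Y : bounded_rv Y -> `|Ex Y| <= Ex (fun w => `|Y w|).
Proof. by move=> bY; apply: le_normr_Rintegral => //; exact: bounded_rv_integrable. Qed.

Lemma bounded_rv_norm Y : bounded_rv Y -> bounded_rv (fun w => `|Y w|).
Proof.
move=> [mY [M YM]]; split; first exact: measurableT_comp.
by exists M => w; rewrite normr_id.
Qed.

Lemma Ex_indic (b : Om -> bool) : measurable [set w | b w] ->
  Ex (fun w => (b w)%:R) = Pr P [set w | b w].
Proof.
move=> mb; have -> : (fun w => (b w)%:R) = \1_[set w | b w] :> (Om -> R).
  by apply/funext => w; rewrite indicE mem_setE.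
by rewrite /Ex /Rintegral integral_indic// setIT.
Qed.

Lemma Ex_expectation Y : Ex Y = fine 'E_P[Y].
Proof. by rewrite unlock. Qed.

Definition discrete_rv (S : Om -> 'rV[int]_d) :=
  forall A : set 'rV[int]_d, measurable (S @^-1` A).

Lemma discrete_rvD S T : discrete_rv S -> discrete_rv T ->
  discrete_rv (fun w => S w + T w).
Proof.
move=> mS mT A.
have -> : (fun w => S w + T w) @^-1` A =
    \bigcup_z (S @^-1` [set z] `&` T @^-1` [set t | A (z + t)]).
  apply/seteqP; split => [w /= Aw|w [z _ [/= -> //]]].
  by exists (S w).
by apply: countable_bigcupT_measurable => // z; exact: measurableI.
Qed.

Lemma discrete_rv_sum (I : Type) (r : seq I) (S : I -> Om -> 'rV[int]_d) :
  (forall i, discrete_rv (S i)) -> discrete_rv (fun w => \sum_(i <- r) S i w).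
Proof.
move=> mS; elim: r => [|i r IH].
  under eq_fun do rewrite big_nil; move=> A.
  have [A0|A0] := pselect (A 0).
    by rewrite (_ : _ @^-1` _ = setT)//; apply/seteqP; split.
  by rewrite (_ : _ @^-1` _ = set0)//; apply/seteqP; split.
by under eq_fun do rewrite big_cons; exact: discrete_rvD.
Qed.

Lemma discrete_rv_bounded S (h : 'rV[int]_d -> R) : discrete_rv S ->
  (exists M, forall z, `|h z| <= M) -> bounded_rv (fun w => h (S w)).
Proof.
move=> mS [M hM]; split; last by exists M.
move=> _ B mB; rewrite setTI.
exact: (mS (h @^-1` B)).
Qed.

Section IID.
Variable X : nat -> Om -> 'rV[int]_d.
Hypothesis X_iid : iid P X.

Let p (z : 'rV[int]_d) : R := Pr P [set w | X 0%N w = z].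

Let mX j : discrete_rv (X j). Proof. by have [mX _ _] := X_iid; exact: mX. Qed.

Lemma discrete_walk n : discrete_rv (walk X n).
Proof. exact: discrete_rv_sum. Qed.

Lemma pmf_ge0 z : 0 <= p z. Proof. exact: fine_ge0. Qed.

Let pE j z : Pr P [set w | X j w = z] = p z.
Proof. by have [_ dX _] := X_iid; congr fine; exact: (dX j [set z]). Qed.

Let bounded_in (j : nat) (B : set 'rV[int]_d) :
  bounded_rv (fun w => (`[< B (X j w) >])%:R : R).
Proof.
apply: (discrete_rv_bounded (h := fun z => (`[< B z >])%:R)) => //.
by exists 1 => z; rewrite normr_nat; case: `[< _ >].
Qed.

(** The events [A j] on the first [m] steps make the induction work: fixing the value of step [m] to
    [z] turns it into one more such event, {z}, and shifts [h] by [z]. Independence is invoked only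
    when no free step is left. *)
Lemma Ex_path_sum (s : seq 'rV[int]_d) (n m : nat)
    (A : nat -> set 'rV[int]_d) (h : 'rV[int]_d -> R) : uniq s ->
  (exists M, forall z, `|h z| <= M) ->
  Ex (fun w => \prod_(j <- iota 0 m) (`[< A j (X j w) >])%:R *
    (\prod_(j <- iota m n) (X j w \in s)%:R *
     h (\sum_(j <- iota m n) X j w))) =
  (\prod_(j <- iota 0 m) Pr P (X j @^-1` A j)) * path_sum s p n h.
Proof.
move=> us; elim: n m A h => [|n IH] m A h hM.
  have [_ _ indep] := X_iid.
  under eq_fun do rewrite !big_nil mul1r mulrC; rewrite ExZ; last first.
    exact: bounded_rv_prod.
  rewrite mulrC; congr (_ * _).
  rewrite (_ : (fun w => _) = (fun w =>
    (`[< forall j, j \in iota 0 m -> A j (X j w) >])%:R)); last first.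
    apply/funext => w; have [H|H] := pselect (forall j, j \in iota 0 m -> A j (X j w)).
      rewrite (asboolT H) big_seq big1// => j jm.
      by rewrite asboolT//; exact: H.
    rewrite (asboolF H); move/existsNP : H => [j /not_implyP[jm nA]].
    by rewrite (big_rem j)//= (asboolF nA) mul0r.
  have E : [set w | `[< forall j, j \in iota 0 m -> A j (X j w) >]] =
           [set w | forall j, j \in iota 0 m -> A j (X j w)].
    by apply/seteqP; split => w /= /asboolP.
  rewrite Ex_indic E.
    rewrite /Pr indep ?iota_uniq//.
    have -> // : forall r : seq nat, (\prod_(j <- r) P (X j @^-1` A j) =
        (\prod_(j <- r) Pr P (X j @^-1` A j))%:E)%E.
    elim=> [|j r IHr]; first by rewrite !big_nil.
    by rewrite !big_cons EFinM IHr fineK//; apply: fin_num_measure; exact: mX.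
  have -> : [set w | forall j, j \in iota 0 m -> A j (X j w)] =
    \bigcap_(j in [set` iota 0 m]) (X j @^-1` A j) by [].
  by apply: fin_bigcap_measurable => // j _; exact: mX.
have iS : iota 0 m.+1 = iota 0 m ++ [:: m] by rewrite -addn1 iotaD.
have mulA : \prod_(j <- iota 0 m) Pr P (X j @^-1` A j) *
   path_sum s p n.+1 h = \sum_(z <- s) (\prod_(j <- iota 0 m.+1)
   Pr P (X j @^-1` (if j == m then [set z] else A j))) *
   path_sum s p n (fun u => h (z + u)).
  rewrite [path_sum _ _ n.+1 _]/= mulr_sumr; apply: eq_bigr => z _.
  rewrite iS big_cat big_seq1 /= eqxx -mulrA.
  congr (_ * _); last by rewrite -(pE m).
  by apply: eq_big_seq => j; rewrite mem_iota add0n => /ltn_eqF ->.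
rewrite {}mulA.
have hM' z : exists M, forall u, `|h (z + u)| <= M.
  by have [M H] := hM; exists M => u; exact: H.
under [RHS]eq_bigr => z _ do
  rewrite -(IH m.+1 (fun j => if j == m then [set z] else A j) _ (hM' z)).
rewrite -Ex_sum; last first.
  move=> z; apply: bounded_rvM; first by apply: bounded_rv_prod => j.
  apply: bounded_rvM.
    apply: bounded_rv_prod => j; apply: bounded_rv_indic.
    exact: (mX j [set` s]).
  apply: (discrete_rv_bounded (h := fun u => h (z + u))) => //.
  exact: discrete_rv_sum.
congr Ex; apply/funext => w.
rewrite [iota m n.+1]/= !big_cons.
set Pi := \prod_(j <- iota m.+1 n) _; set Su := \sum_(j <- iota m.+1 n) _.
(* Decomposition according to the value of step [m]; at most one [z] contributes. *)
transitivity (\sum_(z <- s) (\prod_(j <- iota 0 m) (`[< A j (X j w) >])%:R *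
    Pi) * ((X m w == z)%:R * h (z + Su))).
  rewrite -mulr_sumr -!mulrA [_ * (Pi * _)]mulrCA; congr (_ * (_ * _)).
  have [xs|xs] := boolP (X m w \in s).
    rewrite (bigD1_seq (X m w))//= eqxx big1 ?addr0// => z.
    by rewrite eq_sym => /negPf ->; rewrite mul0r.
  rewrite mul0r big_seq big1// => z zs; case: eqP => [E|_]; last by rewrite mul0r.
  by rewrite E zs in xs.
apply: eq_bigr => z _.
rewrite iS big_cat big_seq1 /= eqxx.
have -> : `[< [set z] (X m w) >] = (X m w == z) by apply/asboolP/eqP.
rewrite -!mulrA; congr (_ * _); last by rewrite mulrCA.
apply: eq_big_seq => j; rewrite mem_iota add0n => /ltn_eqF jm.
by rewrite jm.
Qed.

Lemma Ex_path_sum_walk (s : seq 'rV[int]_d) (n : nat) (h : 'rV[int]_d -> R) :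
  uniq s -> (exists M, forall z, `|h z| <= M) ->
  Ex (fun w => \prod_(j <- iota 0 n) (X j w \in s)%:R * h (walk X n w)) =
  path_sum s p n h.
Proof.
move=> us hM; have := Ex_path_sum n 0 (fun=> setT) us hM.
rewrite big_nil mul1r => <-; congr Ex; apply/funext => w.
by rewrite big_nil mul1r /walk -(big_mkord xpredT (fun j => X j w))
  /index_iota subn0.
Qed.

Let bounded_path (s : seq 'rV[int]_d) n :
  bounded_rv (fun w => \prod_(j <- iota 0 n) (X j w \in s)%:R : R).
Proof.
apply: bounded_rv_prod => j; apply: bounded_rv_indic; exact: (mX j [set` s]).
Qed.

Lemma bounded_rv_walk n (h : 'rV[int]_d -> R) :
  (exists M, forall z, `|h z| <= M) -> bounded_rv (fun w => h (walk X n w)).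
Proof. exact/discrete_rv_bounded/discrete_walk. Qed.

Lemma bounded_rv_step (h : 'rV[int]_d -> R) :
  (exists M, forall z, `|h z| <= M) -> bounded_rv (fun w => h (X 0%N w)).
Proof. exact/discrete_rv_bounded/mX. Qed.

Lemma sum_pmf (s : seq 'rV[int]_d) (g : 'rV[int]_d -> R) : uniq s ->
  (exists M, forall z, `|g z| <= M) ->
  \sum_(z <- s) p z * g z = Ex (fun w => (X 0%N w \in s)%:R * g (X 0%N w)).
Proof.
move=> us hM; transitivity (path_sum s p 1 g).
  by apply: eq_bigr => z _ /=; rewrite addr0.
rewrite -Ex_path_sum_walk//; congr Ex; apply/funext => w.
by rewrite big_seq1 /walk big_ord1.
Qed.

Lemma sum_pmf_le (s : seq 'rV[int]_d) (g : 'rV[int]_d -> R) : uniq s ->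
  (forall z, 0 <= g z) -> (exists M, forall z, `|g z| <= M) ->
  \sum_(z <- s) p z * g z <= Ex (fun w => g (X 0%N w)).
Proof.
move=> us g0 hM; rewrite sum_pmf//; apply: ler_Ex.
- apply: bounded_rvM; last exact: bounded_rv_step.
  exact/bounded_rv_indic/(mX 0 [set` s]).
- exact: bounded_rv_step.
- by move=> w; case: (_ \in s); rewrite ?mul1r ?mul0r.
Qed.

Lemma sum_pmf_le1 (s : seq 'rV[int]_d) : uniq s -> \sum_(z <- s) p z <= 1.
Proof.
move=> us; rewrite -[leRHS](Ex_cst 1).
under eq_bigr do rewrite -[p _]mulr1.
apply: (sum_pmf_le (g := fun=> 1)) => //.
by exists 1 => z; rewrite normr1.
Qed.

Lemma sum_pmf_cvg : \sum_(z <- box d K) p z @[K --> \oo] --> (1 : R).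
Proof.
pose F K : set Om := X 0%N @^-1` [set` box d K].
have FE K : \sum_(z <- box d K) p z = fine (P (F K)).
  under eq_bigr do rewrite -[p _]mulr1.
  rewrite (sum_pmf (g := fun=> 1)) ?box_uniq//; last first.
    by exists 1 => z; rewrite normr1.
  under eq_fun do rewrite mulr1.
  by rewrite Ex_indic//; exact: (mX 0 [set` box d K]).
have UF : \bigcup_K F K = setT.
  apply/seteqP; split => // w _.
  exists (\max_(i < d) absz (X 0%N w 0%R i)) => //; rewrite /F /= mem_box.
  apply/forallP => i.
  have := @leq_bigmax _ (fun i : 'I_d => absz (X 0%N w 0%R i)) i.
  by move: (X _ _ _ _) (\max_(_ < _) _) => y m; lia.
have : P (F K) @[K --> \oo] --> (1 : R)%:E.
  rewrite -(@probability_setT _ _ _ P) -UF; apply: nondecreasing_cvg_mu.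
  - by move=> K; exact: mX.
  - by rewrite UF.
  - move=> K K' KK'; apply/subsetPset => w; rewrite /F /= !mem_box.
    by move=> /forallP H; apply/forallP => i; have := H i; lia.
move=> /fine_cvg; apply: cvg_trans; apply: near_eq_cvg; apply: nearW => K.
by rewrite FE.
Qed.

Let cvg_exprn k (u : nat -> R) (l : R) : u @ \oo --> l ->
  u K ^+ k @[K --> \oo] --> l ^+ k.
Proof.
move=> ul; elim: k => [|k IH].
  by under eq_fun do rewrite expr0; exact: cvg_cst.
by under eq_fun do rewrite exprS; rewrite exprS; apply: cvgM.
Qed.

(** As [h] is bounded by some M, the error is at most M times the probability that a step leaves the
    box, which is 1 minus the n-th power of the mass of the box. *)
Lemma path_sum_cvg n (h : 'rV[int]_d -> R) : (exists M, forall z, `|h z| <= M) ->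
  path_sum (box d K) p n h @[K --> \oo] --> Ex (fun w => h (walk X n w)).
Proof.
move=> hM; have [M HM] := hM; apply/cvgrPdist_le => e e0.
have M0 : 0 <= M by exact: le_trans (normr_ge0 _) (HM 0).
have mass s : path_sum s p n (fun=> 1) = (\sum_(z <- s) p z) ^+ n.
  elim: n => [//|n IH] /=; rewrite exprS mulr_suml.
  by apply: eq_bigr => z _; rewrite -IH.
have : M * (1 - (\sum_(z <- box d K) p z) ^+ n) @[K --> \oo] --> M * (1 - 1 ^+ n).
  apply: cvgM; first exact: cvg_cst.
  by apply: cvgB; [exact: cvg_cst|exact/cvg_exprn/sum_pmf_cvg].
rewrite expr1n subrr mulr0.
move=> /cvgr_le /(_ e e0) H0; apply: filterS H0 => K; apply: le_trans.
have us := @box_uniq d K.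
rewrite -(Ex_path_sum_walk n us hM) -ExB; last 2 first.
- exact: bounded_rv_walk.
- by apply: bounded_rvM => //; exact: bounded_rv_walk.
apply: le_trans (ler_norm_Ex _) _.
  apply: bounded_rvB; first exact: bounded_rv_walk.
  by apply: bounded_rvM => //; exact: bounded_rv_walk.
rewrite -mass -(Ex_path_sum_walk n us); last by exists 1 => z; rewrite normr1.
have -> : (fun w => \prod_(j <- iota 0 n) (X j w \in box d K)%:R * 1) =
    (fun w => \prod_(j <- iota 0 n) (X j w \in box d K)%:R) :> (Om -> R).
  by apply/funext => w; rewrite mulr1.
rewrite -[X in X - _](Ex_cst 1) -ExB//; last exact: bounded_rv_cst.
rewrite -ExZ; last by apply: bounded_rvB => //; exact: bounded_rv_cst.
apply: ler_Ex.
- apply: bounded_rv_norm; apply: bounded_rvB; first exact: bounded_rv_walk.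
  by apply: bounded_rvM => //; exact: bounded_rv_walk.
- by apply: bounded_rvZ; apply: bounded_rvB => //; exact: bounded_rv_cst.
- move=> w; rewrite -[X in `|X - _|]mul1r -mulrBl normrM mulrC.
  apply: ler_pM => //; rewrite ger0_norm// subr_ge0.
  elim: (iota 0 n) => [|j r IHr]; rewrite ?big_nil// big_cons.
  by case: (_ \in _); rewrite ?mul1r ?mul0r.
Qed.

Lemma Pr_walk_Ex n x :
  Ex (fun w => (walk X n w == x)%:R) = Pr P [set w | walk X n w = x].
Proof.
rewrite Ex_indic; last exact: (discrete_walk n [set z | z == x]).
by congr (Pr P _); apply/seteqP; split => w /= /eqP.
Qed.

Lemma path_sum_le_Pr (s : seq 'rV[int]_d) n x : uniq s ->
  path_sum s p n (fun u => (u == x)%:R) <= Pr P [set w | walk X n w = x].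
Proof.
have hb : exists M, forall z : 'rV[int]_d, `|(z == x)%:R : R| <= M.
  by exists 1 => z; rewrite normr_nat; case: (_ == _).
move=> us; rewrite -(Ex_path_sum_walk n us hb) -Pr_walk_Ex; apply: ler_Ex.
- by apply: bounded_rvM => //; exact: (bounded_rv_walk n hb).
- exact: (bounded_rv_walk n hb).
- move=> w; rewrite ler_piMl ?ler0n//.
  elim: (iota 0 n) => [|j r IHr]; rewrite ?big_nil// big_cons.
  by case: (_ \in _); rewrite ?mul1r ?mul0r.
Qed.

Lemma Pr_walk_le n x (B : R) :
  (forall K, path_sum (box d K) p n (fun u => (u == x)%:R) <= B) ->
  Pr P [set w | walk X n w = x] <= B.
Proof.
move=> H; rewrite -Pr_walk_Ex.
have hb : exists M, forall z : 'rV[int]_d, `|(z == x)%:R : R| <= M.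
  by exists 1 => z; rewrite normr_nat; case: (_ == _).
apply: (cvgr_to_le (path_sum_cvg (n := n) hb)).
by apply: nearW => K; exact: H.
Qed.

Lemma charfun_walk n (L : 'rV[int]_d -> R) :
  L 0 = 0 -> {morph L : u v / u + v} ->
  Ex (fun w => cos (L (walk X n w))) ^+ 2 +
  Ex (fun w => sin (L (walk X n w))) ^+ 2 =
  (Ex (fun w => cos (L (X 0%N w))) ^+ 2 +
   Ex (fun w => sin (L (X 0%N w))) ^+ 2) ^+ n.
Proof.
move=> L0 LD.
have bc : exists M, forall z, `|cos (L z)| <= M.
  by exists 1 => z; rewrite ler_norml cos_geN1 cos_le1.
have bs : exists M, forall z, `|sin (L z)| <= M.
  by exists 1 => z; rewrite ler_norml sin_geN1 sin_le1.
have h1 (h : 'rV[int]_d -> R) : (exists M, forall z, `|h z| <= M) ->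
    \sum_(z <- box d K) p z * h z @[K --> \oo] --> Ex (fun w => h (X 0%N w)).
  move=> hM; have := path_sum_cvg (n := 1) hM.
  under eq_fun do rewrite /=; under [X in _ --> Ex X]eq_fun do rewrite /walk big_ord1.
  apply: cvg_trans; apply: near_eq_cvg; apply: nearW => K.
  by apply: eq_bigr => z _; rewrite addr0.
pose c K := path_sum (box d K) p n (fun z => cos (L z)).
pose t K := path_sum (box d K) p n (fun z => sin (L z)).
have C1 : c K ^+ 2 + t K ^+ 2 @[K --> \oo] -->
    Ex (fun w => cos (L (walk X n w))) ^+ 2 +
    Ex (fun w => sin (L (walk X n w))) ^+ 2.
  apply: cvgD; apply: cvg_exprn; first exact: (path_sum_cvg (n := n) bc).
  exact: (path_sum_cvg (n := n) bs).
have C2 : c K ^+ 2 + t K ^+ 2 @[K --> \oo] -->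
  (Ex (fun w => cos (L (X 0%N w))) ^+ 2 +
   Ex (fun w => sin (L (X 0%N w))) ^+ 2) ^+ n.
  have -> : (fun K => c K ^+ 2 + t K ^+ 2) =
    (fun K => ((\sum_(z <- box d K) p z * cos (L z)) ^+ 2 +
      (\sum_(z <- box d K) p z * sin (L z)) ^+ 2) ^+ n).
    by apply/funext => K; rewrite path_sum_fourier.
  by apply: cvg_exprn; apply: cvgD; apply: cvg_exprn; exact: h1.
exact: (cvg_unique (@norm_hausdorff _ _) C1 C2).
Qed.

End IID.
End Walk.

(** * Truncated moments *)

Section Recursions.
Context {R : realType}.
Implicit Types (A g : R -> R).

(** Provides the ratio between consecutive scales for which the comparison function of the two
    recursions below contracts by 1/2. *)
Lemma scale_exists (C s : R) : 0 < s -> exists2 B : R, 1 < B & C * B `^ (- s) <= 1 / 2.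
Proof.
move=> s0; pose D := 2 * `|C| + 2; exists (D `^ s^-1).
  rewrite -(powRr0 D) /powR gt_eqF ?ltr_expR ?ltr_pM2r ?invr_gt0//; rewrite /D.
    by apply: ln_gt0; have := normr_ge0 C; lra.
  by have := normr_ge0 C; lra.
rewrite -powRrM mulrN mulVf ?gt_eqF// powR_inv1; last first.
  by rewrite /D; have := normr_ge0 C; lra.
rewrite ler_pdivrMr; last by rewrite /D; have := normr_ge0 C; lra.
by rewrite /D; have := ler_norm C; have := normr_ge0 C; lra.
Qed.

Lemma exprn_unbounded (B x : R) : 1 < B -> exists n : nat, x <= B ^+ n.
Proof.
move=> B1; have b0 : 0 < B - 1 by lra.
exists (Num.truncn (x / (B - 1))).+1.
have : x / (B - 1) < (Num.truncn (x / (B - 1))).+1%:R by exact: truncnS_gt.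
rewrite ltr_pdivrMr//; set m := _.+1 => h.
apply: le_trans (ltW h) _; elim: m {h} => [|m IH].
  by rewrite mul0r expr0.
rewrite -natr1 mulrDl mul1r exprS.
have : 1 <= B ^+ m by rewrite exprn_ege1// ltW.
nra.
Qed.

(** The increments along y, y/B, y/B^2, ..., down to the base window, form a geometric series
    dominated by its first term; hence the factor 2. *)
Lemma recursion_down A g (B x0 c : R) : 1 < B -> 0 < x0 -> 0 <= c ->
  (forall y : R, x0 <= y -> 0 <= g y) ->
  (forall y : R, x0 <= y <= B * x0 -> A y <= c * g y) ->
  (forall y : R, B * x0 <= y -> A y <= A (y / B) + c * g y) ->
  (forall y : R, B * x0 <= y -> g (y / B) <= g y / 2) ->
  forall y : R, x0 <= y -> A y <= 2 * c * g y.
Proof.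
move=> B1 x00 c0 g0 base step half y xy.
have B0 : 0 < B by lra.
have key n z : x0 <= z -> z <= B ^+ n * x0 -> A z <= 2 * c * g z.
  elim: n z => [|n IH] z xz zn.
    have := base z; rewrite xz expr0 mul1r in zn *.
    have -> : z <= B * x0 by nra.
    by move=> /(_ isT); have := mulr_ge0 c0 (g0 z xz); lra.
  have [zB|/ltW Bz] := leP z (B * x0).
    have := base z; rewrite xz zB => /(_ isT).
    by have := mulr_ge0 c0 (g0 z xz); lra.
  have h1 := step z Bz; have h2 := half z Bz.
  have h3 : A (z / B) <= 2 * c * g (z / B).
    apply: IH; first by rewrite ler_pdivlMr// mulrC.
    by rewrite ler_pdivrMr// mulrAC -exprSr.
  have h4 : 2 * c * g (z / B) <= 2 * c * (g z / 2).
    by rewrite ler_wpM2l// mulr_ge0.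
  lra.
have [n hn] := exprn_unbounded (y / x0) B1.
by apply: (key n) => //; rewrite -ler_pdivrMr.
Qed.

(** The same series along u, B u, B^2 u, ..., stopped beyond [v], where [A] is nonpositive. The
    bound does not depend on [v]. *)
Lemma recursion_up A g (B x0 c v : R) : 1 < B -> 0 < x0 -> 0 <= c ->
  (forall u : R, x0 <= u -> 0 <= g u) ->
  (forall u : R, x0 <= u -> v <= u -> A u <= 0) ->
  (forall u : R, x0 <= u -> A u <= A (B * u) + c * g u) ->
  (forall u : R, x0 <= u -> g (B * u) <= g u / 2) ->
  forall u : R, x0 <= u -> A u <= 2 * c * g u.
Proof.
move=> B1 x00 c0 g0 base step half u xu.
have [n hn] := exprn_unbounded (v / u) B1.
have {hn} : v <= B ^+ n * u by rewrite -ler_pdivrMr//; lra.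
elim: n u xu => [|n IH] u xu vu.
  apply: le_trans (base u xu _) _; first by rewrite expr0 mul1r in vu.
  by rewrite mulr_ge0 ?g0// mulr_ge0.
have xBu : x0 <= B * u by nra.
have h1 := step u xu; have h2 := half u xu.
have h3 : A (B * u) <= 2 * c * g (B * u).
  by apply: IH => //; rewrite mulrA -exprSr.
have h4 : 2 * c * g (B * u) <= 2 * c * (g u / 2).
  by rewrite ler_wpM2l// mulr_ge0.
lra.
Qed.

End Recursions.

(** * Karamata's estimates for truncated moments *)

Section Karamata.
Context {R : realType} {d : nat} {disp : measure_display}
  {Om : measurableType disp}.
Variables (P : probability Om R) (Y : Om -> 'rV[int]_d) (i : 'I_d).
Hypothesis mY : discrete_rv Y.

Let xi : Om -> R := Defs.coord Y i.

Definition abs_tail (u : R) : R := Pr P [set w | u <= `|xi w|].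

Definition trunc_abs_moment (k : nat) (y : R) : R :=
  Ex P (fun w => if `|xi w| <= y then `|xi w| ^+ k else 0).

Definition abs_mean_between (u v : R) : R :=
  Ex P (fun w => if u < `|xi w| <= v then `|xi w| else 0).

Lemma bounded_rv_coord (h : R -> R) : (exists M, forall x : R, `|h x| <= M) ->
  bounded_rv (fun w => h (xi w)).
Proof.
move=> [M hM]; apply: (discrete_rv_bounded (h := fun z => h (z 0 i)%:~R)) => //.
by exists M.
Qed.

Let bounded_trunc k (y : R) :
  bounded_rv (fun w => if `|xi w| <= y then `|xi w| ^+ k else 0).
Proof.
apply: (bounded_rv_coord (h := fun x => if `|x| <= y then `|x| ^+ k else 0)).
exists (`|y| ^+ k) => x; case: ifPn => xy; last by rewrite normr0 exprn_ge0.
by rewrite normrX normr_id lerXn2r ?nnegrE// (le_trans xy)// ler_norm.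
Qed.

Let bounded_between (u v : R) :
  bounded_rv (fun w => if u < `|xi w| <= v then `|xi w| else 0).
Proof.
apply: (bounded_rv_coord (h := fun x => if u < `|x| <= v then `|x| else 0)).
exists `|v| => x; case: ifPn => [/andP[_ xv]|_]; last by rewrite normr0.
by rewrite normr_id (le_trans xv)// ler_norm.
Qed.

Let bounded_tail (u : R) : bounded_rv (fun w => (u <= `|xi w|)%R%:R : R).
Proof.
apply: (bounded_rv_coord (h := fun x => (u <= `|x|)%R%:R)).
by exists 1 => x; rewrite normr_nat; case: (u <= `|x|)%R.
Qed.

Lemma abs_tail_Ex u : abs_tail u = Ex P (fun w => (u <= `|xi w|)%R%:R).
Proof.
rewrite Ex_indic//; exact: (mY [set z | u <= `|(z 0 i)%:~R : R|]).
Qed.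

Lemma abs_tail_ge0 u : 0 <= abs_tail u. Proof. exact: fine_ge0. Qed.

Lemma abs_tail_le1 u : abs_tail u <= 1.
Proof.
rewrite abs_tail_Ex -[leRHS](Ex_cst P); apply: ler_Ex => //.
  exact: bounded_rv_cst.
by move=> w; case: (u <= _)%R.
Qed.

Lemma trunc_abs_moment_mono k (y z : R) : y <= z ->
  trunc_abs_moment k y <= trunc_abs_moment k z.
Proof.
move=> yz; apply: ler_Ex => // w; case: ifPn => [xy|_].
  by rewrite (le_trans xy yz).
by case: ifP => // _; exact: exprn_ge0.
Qed.

Lemma trunc_abs_moment_ge0 k y : 0 <= trunc_abs_moment k y.
Proof. by apply: Ex_ge0 => w; case: ifP => // _; rewrite exprn_ge0. Qed.

Lemma trunc_abs_moment_le k y : 0 <= y -> trunc_abs_moment k y <= y ^+ k.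
Proof.
move=> y0; rewrite -[leRHS](Ex_cst P); apply: ler_Ex => //.
  exact: bounded_rv_cst.
move=> w; case: ifPn => [xy|_]; last by rewrite exprn_ge0.
by rewrite lerXn2r ?nnegrE.
Qed.

Lemma trunc_abs_moment_step k y z : 0 <= y ->
  trunc_abs_moment k y <= trunc_abs_moment k z + y ^+ k * abs_tail z.
Proof.
move=> y0; rewrite abs_tail_Ex -ExZ// -ExD//; last exact: bounded_rvZ.
apply: ler_Ex => //; first by apply: bounded_rvD => //; exact: bounded_rvZ.
move=> w; have k0 : 0 <= `|xi w| ^+ k by rewrite exprn_ge0.
have y0k : 0 <= y ^+ k by rewrite exprn_ge0.
have [xy|xy] := leP `|xi w| y; last first.
  by apply: addr_ge0; [case: ifP|rewrite mulr_ge0].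
have [xz|/ltW ->] := leP `|xi w| z; first by rewrite ler_wpDr// mulr_ge0.
by rewrite add0r mulr1 lerXn2r ?nnegrE.
Qed.

Lemma abs_mean_between_ge0 u v : 0 <= abs_mean_between u v.
Proof. by apply: Ex_ge0 => w; case: ifP. Qed.

Lemma abs_mean_between_le0 u v : v <= u -> abs_mean_between u v <= 0.
Proof.
move=> vu; rewrite -[leRHS](Ex_cst P); apply: ler_Ex => //.
  exact: bounded_rv_cst.
by move=> w; case: ifP => // /andP[ux xv]; lra.
Qed.

Lemma abs_mean_between_split u t v :
  abs_mean_between u v <= abs_mean_between t v + abs_mean_between u t.
Proof.
rewrite -ExD//; apply: ler_Ex => //; first exact: bounded_rvD.
move=> w; have := normr_ge0 (xi w).
case: ifPn => [/andP[ux xv]|_]; last by case: ifP; case: ifP; lra.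
by have [xt|tx] := leP `|xi w| t; rewrite ux xv /=; lra.
Qed.

Lemma abs_mean_between_tail u v : 0 <= v ->
  abs_mean_between u v <= v * abs_tail u.
Proof.
move=> v0; rewrite abs_tail_Ex -ExZ//; apply: ler_Ex => //.
  exact: bounded_rvZ.
move=> w; case: ifPn => [/andP[/ltW -> xv]|_]; first by rewrite mulr1.
by rewrite mulr_ge0.
Qed.

Lemma abs_mean_between_moment2 u v : 0 < u ->
  abs_mean_between u v <= trunc_abs_moment 2 v / u.
Proof.
move=> u0; rewrite mulrC -ExZ//; apply: ler_Ex => //.
  exact: bounded_rvZ.
move=> w; case: ifPn => [/andP[ux ->]|_].
  by rewrite ler_pdivlMl// expr2 ler_wpM2r// ltW.
by apply: mulr_ge0; [rewrite invr_ge0 ltW|case: ifP => // _; exact: exprn_ge0].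
Qed.

Lemma trunc_mean_sub_le u v : u <= v ->
  `|trunc_mean P xi v - trunc_mean P xi u| <= abs_mean_between u v.
Proof.
move=> uv; rewrite /trunc_mean -!Ex_expectation.
have bt y : bounded_rv (fun w => if `|xi w| <= y then xi w else 0).
  apply: (bounded_rv_coord (h := fun x => if `|x| <= y then x else 0)).
  exists `|y| => x; case: ifPn => xy; last by rewrite normr0.
  by rewrite (le_trans xy)// ler_norm.
rewrite -ExB//; apply: le_trans (ler_norm_Ex _ _) _; first exact: bounded_rvB.
apply: ler_Ex => //; first by apply: bounded_rv_norm; exact: bounded_rvB.
move=> w; case: (leP `|xi w| v) => xv; case: (leP `|xi w| u) => xu /=;
  by rewrite ?subrr ?subr0 ?normr0//; lra.
Qed.

Lemma trunc_mean_le y : `|trunc_mean P xi y| <= trunc_abs_moment 1 y.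
Proof.
rewrite /trunc_mean -Ex_expectation.
have bt : bounded_rv (fun w => if `|xi w| <= y then xi w else 0).
  apply: (bounded_rv_coord (h := fun x => if `|x| <= y then x else 0)).
  exists `|y| => x; case: ifPn => xy; last by rewrite normr0.
  by rewrite (le_trans xy)// ler_norm.
apply: le_trans (ler_norm_Ex _ bt) _; apply: ler_Ex => //.
  exact: bounded_rv_norm.
by move=> w; case: ifP; rewrite ?normr0.
Qed.

Lemma trunc_moment2E y : trunc_moment2 P xi y = trunc_abs_moment 2 y.
Proof.
rewrite /trunc_moment2 -Ex_expectation; congr Ex; apply/funext => w.
by case: ifP => // _; rewrite real_normK// num_real.
Qed.

End Karamata.

Section KaramataBounds.
Context {R : realType} {d : nat} {disp : measure_display}
  {Om : measurableType disp}.
Variables (P : probability Om R) (Y : Om -> 'rV[int]_d) (i : 'I_d).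
Hypothesis mY : discrete_rv Y.

Let xi : Om -> R := Defs.coord Y i.
Let G := abs_tail P Y i.
Let tam := trunc_abs_moment P Y i.
Let amb := abs_mean_between P Y i.

(** [mean] is meaningful only for an integrable variable. The bound uniform in [v] gives
    integrability by monotone convergence along integer levels, and dominated convergence then sends
    the upper truncation level to infinity. *)
Lemma mean_sub_le (u c : R) : (forall v : R, amb u v <= c) ->
  `|trunc_mean P xi u - mean P xi| <= c.
Proof.
move=> hc.
have mxi : measurable_fun [set: Om] xi.
  move=> _ B mB; rewrite setTI; exact: (mY [set z | B (z 0 i)%:~R]).
have c0 : 0 <= c by apply: le_trans (hc u); exact: abs_mean_between_ge0.
pose f (N : nat) w : R := if `|xi w| <= N%:R then `|xi w| else 0.
pose t (N : nat) w : R := if `|xi w| <= N%:R then xi w else 0.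
have bf N : bounded_rv (f N).
  apply: (bounded_rv_coord i mY (h := fun x => if `|x| <= N%:R then `|x| else 0)).
  by exists N%:R => x; case: ifP; rewrite ?normr_id ?normr0.
have bt N : bounded_rv (t N).
  apply: (bounded_rv_coord i mY (h := fun x => if `|x| <= N%:R then x else 0)).
  by exists N%:R => x; case: ifP; rewrite ?normr_id ?normr0.
have fN N : (\int[P]_w (f N w)%:E <= (`|u| + c)%:E)%E.
  have fi := bounded_rv_integrable P (bf N).
  rewrite -[leLHS]fineK; last exact: integrable_fin_num.
  rewrite lee_fin -/(Rintegral P setT (f N)) -/(Ex P (f N)).
  have b2 : bounded_rv (fun w => if u < `|xi w| <= N%:R then `|xi w| else 0).
    apply: (bounded_rv_coord i mY (h := fun x => if u < `|x| <= N%:R then `|x| else 0)).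
    exists N%:R => x; case: ifPn => [/andP[_ xv]|_]; last by rewrite normr0.
    by rewrite normr_id.
  apply: le_trans (_ : `|u| + amb u N%:R <= _); last by rewrite lerD2l.
  rewrite -[X in X + _](Ex_cst P) -ExD//; last exact: bounded_rv_cst.
  apply: ler_Ex => //; first by apply: bounded_rvD => //; exact: bounded_rv_cst.
  move=> w; rewrite /f; have [xN|_] := leP `|xi w| N%:R; last first.
    by apply: addr_ge0 => //; case: ifP.
  have [|xu] := ltP u `|xi w|; first by rewrite /= lerDr.
  by rewrite addr0 (le_trans xu)// ler_norm.
have cf w : (f N w)%:E @[N --> \oo] --> (`|xi w|)%:E.
  apply: cvg_near_cst; exists (Num.truncn `|xi w|).+1 => // N /= hN.
  rewrite /f ifT//; apply: ltW; apply: lt_le_trans (truncnS_gt _) _.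
  by rewrite ler_nat.
have intxi : P.-integrable setT (EFin \o xi).
  apply/integrableP; split; first exact/measurable_EFinP.
  apply: (@le_lt_trans _ _ (`|u| + c)%:E); last exact: ltry.
  under eq_integral do rewrite /=.
  have -> : (\int[P]_w `|(xi w)%:E| = \int[P]_w (limn (fun N => (f N w)%:E)))%E.
    by apply: eq_integral => w _; rewrite (cvg_lim _ (cf w)).
  rewrite monotone_convergence//.
  - apply: lime_le.
      apply: ereal_nondecreasing_is_cvgn => m n mn; apply: ge0_le_integral => //.
      + by move=> w _; rewrite lee_fin /f; case: ifP.
      + by apply/measurable_EFinP; have [] := bf m.
      + by apply/measurable_EFinP; have [] := bf n.
      + move=> w _; rewrite lee_fin /f; case: ifPn => [xm|_]; last by case: ifP.
        by rewrite (le_trans xm)// ler_nat.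
    by apply: nearW => N; exact: fN.
  - by move=> N; apply/measurable_EFinP; have [] := bf N.
  - by move=> N w _; rewrite lee_fin /f; case: ifP.
  - move=> w _ m n mn; rewrite lee_fin /f; case: ifPn => [xm|_]; last by case: ifP.
    by rewrite (le_trans xm)// ler_nat.
have ct w : (t N w)%:E @[N --> \oo] --> (xi w)%:E.
  apply: cvg_near_cst; exists (Num.truncn `|xi w|).+1 => // N /= hN.
  rewrite /t ifT//; apply: ltW; apply: lt_le_trans (truncnS_gt _) _.
  by rewrite ler_nat.
have [_ _ tcvg] := @dominated_convergence _ _ _ P setT measurableT
  (fun N w => (t N w)%:E) (fun w => (xi w)%:E) (fun w => (`|xi w|)%:E)
  (fun N => ltac:(by apply/measurable_EFinP; have [] := bt N))
  (ltac:(by apply/measurable_EFinP))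
  (ltac:(by apply: aeW => w _; exact: ct))
  (ltac:(by exact: integrable_norm))
  (ltac:(by apply: aeW => w N _; rewrite lee_fin /t; case: ifP; rewrite ?normr0)).
have {}tcvg : trunc_mean P xi N%:R @[N --> \oo] --> mean P xi.
  rewrite /mean -Ex_expectation /trunc_mean.
  have -> : (fun N : nat => fine 'E_P[fun w => if `|xi w| <= N%:R then xi w else 0])
      = (fun N => fine (\int[P]_w (t N w)%:E)).
    by apply/funext => N; rewrite unlock.
  apply: fine_cvg; rewrite fineK//; exact: integrable_fin_num.
have {}tcvg : `|trunc_mean P xi N%:R - trunc_mean P xi u| @[N --> \oo] -->
    `|mean P xi - trunc_mean P xi u|.
  by apply: cvg_norm; apply: cvgB => //; exact: cvg_cst.
rewrite distrC; apply: (cvgr_to_le tcvg).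
exists (Num.truncn `|u|).+1 => // N /= hN.
apply: le_trans (hc N%:R); apply: trunc_mean_sub_le => //.
apply: le_trans (ler_norm u) _; apply: ltW.
by apply: lt_le_trans (truncnS_gt _) _; rewrite ler_nat.
Qed.

Section Potter.
Variables (V : R -> R) (a e x0 C : R).
Hypotheses (x00 : 0 < x0) (C0 : 0 < C).
Hypothesis pot : forall x y : R, x0 <= x -> x <= y ->
  [/\ 0 < V x, V y <= C * (y / x) `^ (e - a) * V x &
      V x <= C * (y / x) `^ (e + a) * V y].

(** Lowering the truncation level from y to y/B costs at most y^k G(y/B), of order y^k V(y). Since a
    + e < k, the function y^k V(y) at least doubles from y/B to y when [B] is large, so
    [recursion_down] sums the scales. *)
Lemma karamata_down (k : nat) (c : R) : a + e < k%:R -> 0 <= a + e ->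
  0 <= c -> (forall u : R, x0 <= u -> G u <= c * V u) ->
  exists2 C', 0 <= C' & forall y : R, x0 <= y -> tam k y <= C' * (y ^+ k * V y).
Proof.
move=> ak ae0 c0 hG; have x0_gt0 := x00.
have [B B1 hB] := scale_exists C (ltac:(lra) : 0 < k%:R - (a + e)).
have B0 : 0 < B by lra.
have V0 x : x0 <= x -> 0 < V x by move=> xx; have [] := pot xx (lexx x).
pose D := C * B `^ (e + a).
have D0 : 0 < D by rewrite mulr_gt0// powR_gt0.
pose c1 := c * D + D / V x0.
have DV0 : 0 <= D / V x0.
  by apply: divr_ge0; apply: ltW => //; exact: V0.
have c10 : 0 <= c1 by apply: addr_ge0 => //; apply: mulr_ge0 => //; exact: ltW.
exists (2 * c1); first by rewrite mulr_ge0.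
have step y : B * x0 <= y -> V (y / B) <= D * V y.
  move=> By; have xy : x0 <= y / B by rewrite ler_pdivlMr// mulrC.
  have y0 : 0 < y by apply: lt_le_trans By; rewrite mulr_gt0.
  have [|_ _] := pot xy (_ : y / B <= y).
    by rewrite ler_pdivrMr// ler_peMr// ltW.
  by rewrite invf_div mulrCA divff ?gt_eqF// mulr1.
apply: (recursion_down B1 x00 c10).
- by move=> y xy; apply: mulr_ge0; [exact/exprn_ge0/(le_trans (ltW x00))|apply/ltW/V0].
- move=> y /andP[xy yB]; have y0 : 0 < y by lra.
  apply: le_trans (trunc_abs_moment_le _ _ mY _ (ltW y0)) _.
  rewrite mulrCA -[leLHS]mulr1; apply: ler_wpM2l; first exact/exprn_ge0/ltW.
  have [_ _ h] := pot (lexx x0) xy.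
  have : V x0 <= D * V y.
    apply: le_trans h _; rewrite ler_pM2r ?V0// ler_pM2l//.
    apply: ge0_ler_powR; rewrite ?nnegrE ?ler_pdivrMr//.
    - by rewrite addrC.
    - by apply: divr_ge0; exact: ltW.
    - exact: ltW.
  rewrite /c1 mulrDl => h1.
  have h2 : 1 <= D / V x0 * V y.
    by rewrite mulrAC ler_pdivlMr ?V0// mul1r.
  by have := mulr_ge0 (mulr_ge0 c0 (ltW D0)) (ltW (V0 _ xy)); lra.
- move=> y By; have xy : x0 <= y / B by rewrite ler_pdivlMr// mulrC.
  have y0 : 0 < y by apply: lt_le_trans By; rewrite mulr_gt0.
  apply: le_trans (trunc_abs_moment_step P i mY k (y / B) (ltW y0)) _.
  rewrite lerD2l mulrCA ler_pM2l ?exprn_gt0//.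
  apply: le_trans (hG _ xy) _.
  apply: le_trans (_ : c * (D * V y) <= _); first by rewrite ler_wpM2l ?step.
  rewrite mulrA; apply: ler_wpM2r; first by apply: ltW; apply: V0; nra.
  by rewrite lerDl.
- move=> y By.
  have y0 : 0 < y by apply: lt_le_trans By; rewrite mulr_gt0.
  have yk : 0 < y ^+ k by rewrite exprn_gt0.
  have Vy : 0 < V y by rewrite V0//; nra.
  apply: le_trans (_ : (y / B) ^+ k * (D * V y) <= _).
    apply: ler_wpM2l; last exact: step.
    by apply: exprn_ge0; apply: divr_ge0; exact: ltW.
  rewrite expr_div_n -(powR_mulrn k (ltW B0)).
  have -> : y ^+ k / B `^ k%:R * (D * V y) =
    (C * B `^ (- (k%:R - (a + e)))) * (y ^+ k * V y).
    rewrite opprB [a + e]addrC powRB; last by rewrite (gt_eqF B0) implybT.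
    by rewrite /D; field; rewrite gt_eqF// powR_gt0.
  rewrite [leRHS]mulrC; rewrite mul1r in hB.
  by apply: ler_wpM2r => //; apply: mulr_ge0; exact: ltW.
Qed.

(** Here u V(u) at most halves from u to B u, because its index stays below 0. The bound over one
    scale is left as a hypothesis: it comes from the tail when alpha < 2 and from the truncated
    second moment when alpha = 2. *)
Lemma karamata_up : 1 < a - e ->
  (forall B : R, 1 < B -> exists2 c, 0 <= c & forall u : R, x0 <= u ->
     amb u (B * u) <= c * (u * V u)) ->
  exists2 C', 0 <= C' & forall u v : R, x0 <= u -> amb u v <= C' * (u * V u).
Proof.
move=> ae hc; have x0_gt0 := x00.
have [B B1 hB] := scale_exists C (ltac:(lra) : 0 < a - e - 1).
have B0 : 0 < B by lra.
have V0 x : x0 <= x -> 0 < V x by move=> xx; have [] := pot xx (lexx x).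
have [c c0 hc'] := hc B B1.
exists (2 * c); first by rewrite mulr_ge0.
move=> u v; move: u; apply: (recursion_up (v := v) B1 x00 c0).
- by move=> u xu; apply: mulr_ge0; [exact: (le_trans (ltW x00))|apply/ltW/V0].
- by move=> u xu vu; exact: abs_mean_between_le0.
- move=> u xu; apply: le_trans (abs_mean_between_split P i mY _ (B * u) _) _.
  by rewrite lerD2l hc'.
- move=> u xu; have u0 : 0 < u by lra.
  have [|_ h _] := pot xu (_ : u <= B * u); first by rewrite ler_peMl// ltW.
  rewrite mulfK ?gt_eqF// in h.
  apply: le_trans (_ : B * u * (C * B `^ (e - a) * V u) <= _).
    by apply: ler_wpM2l => //; apply: mulr_ge0; exact: ltW.
  have -> : B * u * (C * B `^ (e - a) * V u) =
      (C * B `^ (- (a - e - 1))) * (u * V u).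
    rewrite (_ : - (a - e - 1) = 1 + (e - a)); last by ring.
    rewrite (@powRD _ B 1 (e - a)); last by rewrite (gt_eqF B0) implybT.
    by rewrite powRr1; [ring|exact: ltW].
  rewrite [leRHS]mulrC; rewrite mul1r in hB.
  by apply: ler_wpM2r => //; apply: mulr_ge0; apply: ltW => //; exact: V0.
Qed.

End Potter.
End KaramataBounds.

(** * Estimates at the scale of the walk *)

Section ScaledEstimates.
Context {R : realType} {d : nat} {disp : measure_display}
  {Om : measurableType disp}.
Variables (P : probability Om R) (Y : Om -> 'rV[int]_d) (i : 'I_d).
Hypothesis mY : discrete_rv Y.

Let xi : Om -> R := Defs.coord Y i.
Let G := abs_tail P Y i.
Let tam := trunc_abs_moment P Y i.
Let amb := abs_mean_between P Y i.

Variables (a : R) (L : R -> R) (p q : R) (b : nat -> R).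
Hypothesis a02 : 0 < a <= 2.
Hypothesis tails : regular_tails P xi a L p q.
Hypothesis scal : scaling P xi a L b.
Hypothesis b_unbounded : forall M : R, exists N : nat,
  forall n, (N <= n)%N -> M <= b n.

(* V in n V(a_n) -> 1. *)
Definition scale_fun (x : R) : R :=
  (if a < 2 then L else trunc_moment2 P xi) x * x `^ (- a).

Let V := scale_fun.

Definition potter_bounds (e x0 C : R) :=
  forall x y : R, x0 <= x -> x <= y ->
  [/\ 0 < V x, V y <= C * (y / x) `^ (e - a) * V x &
      V x <= C * (y / x) `^ (e + a) * V y].

Lemma potter_scale (e : R) : 0 < e ->
  exists x0 C : R, [/\ 0 < x0, 0 < C & potter_bounds e x0 C].
Proof.
move=> e0; apply: potter_regular => //.
by move: tails; rewrite /regular_tails; case: ifP => // _ [[]].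
Qed.

Lemma potter_bounds_ge (e x0 x1 C : R) : x0 <= x1 -> potter_bounds e x0 C ->
  potter_bounds e x1 C.
Proof. by move=> x01 H x y x1x; apply: H; exact: le_trans x1x. Qed.

Lemma scale_normalized (e x0 C : R) : 0 < C -> potter_bounds e x0 C ->
  exists n0 : nat, forall n, (n0 <= n)%N ->
  [/\ x0 <= b n, n%:R * V (b n) <= 2, 1 / 2 <= n%:R * V (b n),
      forall y : R, b n <= y -> n%:R * V y <= 2 * C * (y / b n) `^ (e - a) &
      forall y : R, b n <= y ->
        1 <= 2 * C * (y / b n) `^ (e + a) * (n%:R * V y)].
Proof.
move=> C0 pot; have [_ sc] := scal.
have {}sc : n%:R * V (b n) @[n --> \oo] --> (1 : R).
  by move: sc; rewrite /V /scale_fun; case: (a < 2).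
have h1 := cvgr_le _ sc _ (ltac:(lra) : (1 : R) < 2).
have h2 := cvgr_ge _ sc _ (ltac:(lra) : (1 : R) / 2 < 1).
have [N1 _ h3] := filterI h1 h2.
have [N2 hN2] := b_unbounded x0.
exists (maxn N1 N2) => n; rewrite geq_max => /andP[n1 n2].
have [le2 ge2] := h3 n n1; have xb := hN2 n n2.
split => // y by_; have [V0 u l] := pot _ _ xb by_.
  apply: le_trans (_ : n%:R * (C * (y / b n) `^ (e - a) * V (b n)) <= _).
    by rewrite ler_wpM2l.
  have -> : n%:R * (C * (y / b n) `^ (e - a) * V (b n)) =
    C * (y / b n) `^ (e - a) * (n%:R * V (b n)) by ring.
  rewrite (_ : 2 * C * _ = C * (y / b n) `^ (e - a) * 2); last by ring.
  by apply: ler_wpM2l => //; apply: mulr_ge0; [exact: ltW|exact: powR_ge0].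
have := ler_wpM2l (ler0n R n) l.
have -> : n%:R * (C * (y / b n) `^ (e + a) * V y) =
    C * (y / b n) `^ (e + a) * (n%:R * V y) by ring.
have -> : 2 * C * (y / b n) `^ (e + a) * (n%:R * V y) =
    2 * (C * (y / b n) `^ (e + a) * (n%:R * V y)) by ring.
by move: ge2 => /=; lra.
Qed.

Let mxi_set (Q : R -> bool) : measurable [set w | Q (xi w)].
Proof. exact: (mY [set z | Q (z 0 i)%:~R]). Qed.

(** The doubled level is due to the value x itself, which belongs neither to the strict right tail
    nor to the left one. *)
Lemma two_sided_tail (x : R) : 0 < x ->
  right_tail P xi x + left_tail P xi x <= G x /\
  G (2 * x) <= right_tail P xi x + left_tail P xi x.
Proof.
move=> x0.
have bi (Q : R -> bool) : bounded_rv (fun w => (Q (xi w))%:R : R).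
  by apply: bounded_rv_indic; exact: mxi_set.
rewrite /right_tail /left_tail /G !abs_tail_Ex//.
rewrite -(Ex_indic P (mxi_set (fun t => x < t))).
rewrite -(Ex_indic P (mxi_set (fun t => t <= - x))).
rewrite -ExD; [|exact: (bi (fun t => x < t))|exact: (bi (fun t => t <= - x))].
split; apply: ler_Ex.
- by apply: bounded_rvD; [exact: (bi (fun t => x < t))|exact: (bi (fun t => t <= - x))].
- exact: (bi (fun t => x <= `|t|)).
- move=> w; rewrite -/xi; case: (ltP x (xi w)) => h1; case: (leP (xi w) (- x)) => h2;
  rewrite ler_normr; case: (leP x (xi w)) => h3; case: (leP x (- xi w)) => h4 //=;
  rewrite ?addr0 ?add0r//; exfalso; lra.
- exact: (bi (fun t => 2 * x <= `|t|)).
- by apply: bounded_rvD; [exact: (bi (fun t => x < t))|exact: (bi (fun t => t <= - x))].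
- move=> w; rewrite -/xi; case: (ltP x (xi w)) => h1; case: (leP (xi w) (- x)) => h2;
  rewrite ler_normr; case: (leP (2 * x) (xi w)) => h3;
  case: (leP (2 * x) (- xi w)) => h4 //=;
  rewrite ?addr0 ?add0r ?lerDl//; exfalso; lra.
Qed.

Lemma tail_scale_lt2 (e x0 C : R) : a < 2 -> 0 < x0 -> 0 < C ->
  potter_bounds e x0 C -> exists x1 C1 : R, [/\ x0 <= x1, 0 <= C1 &
  forall u : R, x1 <= u -> G u <= C1 * V u /\ V u <= 2 * G u].
Proof.
move=> a2 x00 C0 pot.
move: tails; rewrite /regular_tails a2 => -[sL p0 q0 pq [hp hq]].
have hpq : (right_tail P xi x / (L x * x `^ (- a)) +
   left_tail P xi x / (L x * x `^ (- a))) @[x --> +oo] --> (1 : R).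
  by rewrite -pq; exact: cvgD.
have h1 := cvgr_le _ hpq _ (ltac:(lra) : (1 : R) < 2).
have h2 := cvgr_ge _ hpq _ (ltac:(lra) : (1 : R) / 2 < 1).
have [M [_ hM]] := filterI h1 h2.
have VE x : L x * x `^ (- a) = V x by rewrite /V /scale_fun a2.
exists (2 * Num.max x0 (M + 1)), (2 * (C * 2 `^ (e + a))).
have xm : x0 <= Num.max x0 (M + 1) by rewrite le_max lexx.
have Mm : M < Num.max x0 (M + 1) by rewrite lt_max orbC (_ : M < M + 1) ?ltrDl.
set m := Num.max _ _ in xm Mm *; clearbody m.
split; first by lra.
  by rewrite !mulr_ge0 ?powR_ge0// ltW.
move=> u mu.
have key x : m <= x -> 1 / 2 * V x <= right_tail P xi x + left_tail P xi x
    /\ right_tail P xi x + left_tail P xi x <= 2 * V x.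
  move=> mx; have [|Vx _ _] := pot x x _ (lexx x); first by lra.
  have [|/=] := hM x; first by lra.
  by rewrite !VE -mulrDl ler_pdivrMr// ler_pdivlMr.
split; last first.
  have [|h3 _] := key u; first by lra.
  have [|h4 _] := @two_sided_tail u; first by lra.
  lra.
have [|_ h3] := key (u / 2); first by lra.
have [|_ h4] := @two_sided_tail (u / 2); first by lra.
have u2 : 2 * (u / 2) = u by field.
rewrite u2 in h4.
have [|| _ _ h5] := pot (u / 2) u; [by lra|by lra|].
have u20 : u / (u / 2) = 2 by field; rewrite gt_eqF//; lra.
rewrite u20 in h5; lra.
Qed.

(** At index 2 the assumption concerns the truncated second moment and not the tail, so the first
    moment over one scale is bounded through |xi| <= xi^2 / u. *)
Lemma moment2_between_2 (e x0 C : R) : a = 2 -> 0 < x0 -> 0 < C ->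
  potter_bounds e x0 C -> forall B : R, 1 < B -> exists2 c : R, 0 <= c &
  forall u : R, x0 <= u -> amb u (B * u) <= c * (u * V u).
Proof.
move=> a2 x00 C0 pot B B1.
exists (C * B `^ (e - a) * B ^+ 2).
  by rewrite !mulr_ge0 ?powR_ge0 ?exprn_ge0//; lra.
move=> u xu; have u0 : 0 < u by lra.
have Bu0 : 0 < B * u by nra.
apply: le_trans (abs_mean_between_moment2 P i mY _ u0) _.
have [|Vu h _] := pot u (B * u) xu; first by nra.
rewrite mulfK ?gt_eqF// in h.
have -> : trunc_abs_moment P Y i 2 (B * u) = V (B * u) * (B * u) ^+ 2.
  rewrite /V /scale_fun a2 ltxx -trunc_moment2E//.
  rewrite powRN (powR_mulrn 2 (ltW Bu0)).
  by field; rewrite ?mulf_eq0 ?negb_or !gt_eqF//; lra.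
rewrite ler_pdivrMr//.
apply: le_trans (_ : C * B `^ (e - a) * V u * (B * u) ^+ 2 <= _).
  by rewrite ler_wpM2r// exprn_ge0// ltW.
by rewrite [leLHS](_ : _ = C * B `^ (e - a) * B ^+ 2 * (u * V u) * u)//; ring.
Qed.

Lemma between_bound (e x0 C : R) : 1 < a - e -> 0 < x0 -> 0 < C ->
  potter_bounds e x0 C -> exists x1 C1 : R, [/\ x0 <= x1, 0 <= C1 &
  forall u v : R, x1 <= u -> amb u v <= C1 * (u * V u)].
Proof.
move=> ae x00 C0 pot.
have [a2|a2] := ltP a 2; last first.
  have a2' : a = 2 by move: a02 => /andP[_]; lra.
  have [C1 C10 h] := @karamata_up R d disp Om P Y i mY V a e x0 C x00 pot ae (moment2_between_2 a2' x00 C0 pot).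
  by exists x0, C1.
have [x1 [C1 [x01 C10 hG]]] := tail_scale_lt2 a2 x00 C0 pot.
have x10 : 0 < x1 by lra.
have pot1 := potter_bounds_ge x01 pot.
have [|C2 C20 h] := @karamata_up R d disp Om P Y i mY V a e x1 C x10 pot1 ae; last by exists x1, C2.
move=> B B1; exists (B * C1); first by nra.
move=> u xu; have u0 : 0 < u by lra.
have Bu0 : 0 <= B * u by nra.
apply: le_trans (abs_mean_between_tail P i mY u Bu0) _.
have [h _] := hG u xu.
apply: le_trans (_ : B * u * (C1 * V u) <= _); first by rewrite ler_wpM2l.
by rewrite [leLHS](_ : _ = B * C1 * (u * V u))//; ring.
Qed.

Lemma moment2_bound (e x0 C : R) : 0 < e -> (a < 2 -> a + e < 2) ->
  0 < x0 -> 0 < C -> potter_bounds e x0 C ->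
  exists x1 C1 : R, [/\ x0 <= x1, 0 <= C1 &
  forall y : R, x1 <= y -> tam 2 y <= C1 * (y ^+ 2 * V y)].
Proof.
move=> e0 ae x00 C0 pot; have a0 : 0 < a by case/andP: a02.
have [a2|a2] := ltP a 2; last first.
  have a2' : a = 2 by move: a02 => /andP[_]; lra.
  exists x0, 1; split => // y xy; have y0 : 0 < y by lra.
  rewrite mul1r /V /scale_fun a2' ltxx trunc_moment2E//.
  rewrite powRN (powR_mulrn 2 (ltW y0)) mulrCA divff ?mulr1//.
  by rewrite gt_eqF// exprn_gt0.
have [x1 [C1 [x01 C10 hG]]] := tail_scale_lt2 a2 x00 C0 pot.
have x10 : 0 < x1 by lra.
have pot1 := potter_bounds_ge x01 pot.
have ae2 := ae a2.
have [||u xu|C2 C20 h] := @karamata_down R d disp Om P Y i mY V a e x1 C x10 C0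
  pot1 2 C1 _ _ C10; [by lra|by lra|by have [] := hG u xu|].
by exists x1, C2.
Qed.

Lemma moment2_scaled (e x0 C : R) : 0 < e -> (a < 2 -> a + e < 2) ->
  0 < x0 -> 0 < C -> potter_bounds e x0 C ->
  exists (C1 : R) (n0 : nat), 0 <= C1 /\ forall n, (n0 <= n)%N ->
  0 < b n /\ forall y : R, b n <= y ->
  n%:R * tam 2 y <= C1 * (y ^+ 2 * (y / b n) `^ (e - a)).
Proof.
move=> e0 ae x00 C0 pot.
have [x1 [C1 [x01 C10 h]]] := moment2_bound e0 ae x00 C0 pot.
have [n0 hn] := scale_normalized C0 (potter_bounds_ge x01 pot).
exists (C1 * (2 * C)), n0; split; first by rewrite !mulr_ge0// ltW.
move=> n /hn [xb _ _ hV _]; split; first by lra.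
move=> y by_; have y0 : 0 < y by lra.
apply: le_trans (_ : n%:R * (C1 * (y ^+ 2 * V y)) <= _).
  by apply: ler_wpM2l => //; apply: h; lra.
have -> : n%:R * (C1 * (y ^+ 2 * V y)) = C1 * y ^+ 2 * (n%:R * V y) by ring.
apply: le_trans (_ : C1 * y ^+ 2 * (2 * C * (y / b n) `^ (e - a)) <= _).
  apply: ler_wpM2l; last exact: hV.
  by apply: mulr_ge0 => //; exact: exprn_ge0 (ltW y0).
by rewrite [leLHS](_ : _ = C1 * (2 * C) * (y ^+ 2 * (y / b n) `^ (e - a)))//; ring.
Qed.

Lemma mean_scaled_lt1 : a < 1 -> exists (e C1 : R) (n0 : nat),
  [/\ 0 < e, 0 <= C1 & forall n, (n0 <= n)%N -> 0 < b n /\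
   forall y : R, b n <= y ->
   n%:R * tam 2 y <= C1 * (y ^+ 2 * (y / b n) `^ (- e)) /\
   `|n%:R * trunc_mean P xi y - centering P xi a b n| <=
     C1 * (y * (y / b n) `^ (- e))].
Proof.
move=> a1; have a0 : 0 < a by case/andP: a02.
(* The decay exponent in the conclusion is a - e > 0, and a + e < 1 is the condition of Karamata's
   bound for the first absolute moment. *)
pose e := Num.min (a / 2) ((1 - a) / 2).
have e0 : 0 < e by rewrite lt_min; apply/andP; split; lra.
have ea : e <= a / 2 by rewrite ge_min lexx.
have e1 : e <= (1 - a) / 2 by rewrite ge_min lexx orbT.
clearbody e.
have [x0 [C [x00 C0 pot]]] := potter_scale e0.
have a2 : a < 2 by lra.
have [C2 [n2 [C20 h2]]] := moment2_scaled e0 (fun _ => ltac:(lra)) x00 C0 pot.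
have [x1 [C1 [x01 C10 hG]]] := tail_scale_lt2 a2 x00 C0 pot.
have x10 : 0 < x1 by lra.
have pot1 := potter_bounds_ge x01 pot.
have [||u xu|C3 C30 h3] := @karamata_down R d disp Om P Y i mY V a e x1 C x10 C0
  pot1 1 C1 _ _ C10; [by lra|by lra|by have [] := hG u xu|].
have [n0 hn] := scale_normalized C0 pot1.
exists (a - e), (C2 + C3 * (2 * C)), (maxn n0 n2); split.
- lra.
- by rewrite addr_ge0// !mulr_ge0// ltW.
move=> n; rewrite geq_max => /andP[nn0 nn2].
have [b0 h2n] := h2 n nn2; have [xb _ _ hV _] := hn n nn0.
split => // y by_; have y0 : 0 < y by lra.
have pw : 0 <= (y / b n) `^ (e - a) by exact: powR_ge0.
rewrite opprB; split.
  apply: le_trans (h2n y by_) _; apply: ler_wpM2r.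
    by apply: mulr_ge0 => //; exact: exprn_ge0 (ltW y0).
  by rewrite lerDl !mulr_ge0// ltW.
rewrite /centering a1 subr0 normrM ger0_norm//.
apply: le_trans (_ : n%:R * (C3 * (y ^+ 1 * V y)) <= _).
  apply: ler_wpM2l => //; apply: le_trans (trunc_mean_le P i mY y) _.
  by apply: h3; lra.
have -> : n%:R * (C3 * (y ^+ 1 * V y)) = C3 * y * (n%:R * V y) by ring.
apply: le_trans (_ : C3 * y * (2 * C * (y / b n) `^ (e - a)) <= _).
  by apply: ler_wpM2l; [exact: mulr_ge0 C30 (ltW y0)|exact: hV].
have -> : C3 * y * (2 * C * (y / b n) `^ (e - a)) =
   C3 * (2 * C) * (y * (y / b n) `^ (e - a)) by ring.
apply: ler_wpM2r; first by apply: mulr_ge0 => //; exact: ltW.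
by rewrite lerDr.
Qed.

Lemma mean_scaled_gt1 : 1 < a -> exists (e C1 : R) (n0 : nat),
  [/\ 0 < e, 0 <= C1 & forall n, (n0 <= n)%N -> 0 < b n /\
   forall y : R, b n <= y ->
   n%:R * tam 2 y <= C1 * (y ^+ 2 * (y / b n) `^ (- e)) /\
   `|n%:R * trunc_mean P xi y - centering P xi a b n| <=
     C1 * (y * (y / b n) `^ (- e))].
Proof.
move=> a1; have a2 : a <= 2 by case/andP: a02.
(* The part of the mean beyond [y] is summable over scales because a - e > 1. The second moment
   requires a + e < 2 only when a < 2: at index 2 it equals y^2 V(y) by definition. *)
pose e := if a < 2 then Num.min ((a - 1) / 2) ((2 - a) / 2) else 1 / 2.
have [e0 ea e2] : [/\ 0 < e, e <= (a - 1) / 2 & a < 2 -> a + e < 2].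
  rewrite /e; case: (ltP a 2) => [alt|age].
    have h1 : Num.min ((a - 1) / 2) ((2 - a) / 2) <= (a - 1) / 2.
      by rewrite ge_min lexx.
    have h2 : Num.min ((a - 1) / 2) ((2 - a) / 2) <= (2 - a) / 2.
      by rewrite ge_min lexx orbT.
    split; [|exact: h1|by move=> _; lra].
    by rewrite lt_min; apply/andP; split; lra.
  by split; [lra|lra|by move=> h; lra].
clearbody e.
have [x0 [C [x00 C0 pot]]] := potter_scale e0.
have [C2 [n2 [C20 h2]]] := moment2_scaled e0 e2 x00 C0 pot.
have [|x1 [C3 [x01 C30 h3]]] := between_bound _ x00 C0 pot; first by lra.
have pot1 := potter_bounds_ge x01 pot.
have [n0 hn] := scale_normalized C0 pot1.
exists (a - e), (C2 + C3 * (2 * C)), (maxn n0 n2); split.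
- lra.
- by rewrite addr_ge0// !mulr_ge0// ltW.
move=> n; rewrite geq_max => /andP[nn0 nn2].
have [b0 h2n] := h2 n nn2; have [xb _ _ hV _] := hn n nn0.
split => // y by_; have y0 : 0 < y by lra.
have pw : 0 <= (y / b n) `^ (e - a) by exact: powR_ge0.
rewrite opprB; split.
  apply: le_trans (h2n y by_) _; apply: ler_wpM2r.
    by apply: mulr_ge0 => //; exact: exprn_ge0 (ltW y0).
  by rewrite lerDl !mulr_ge0// ltW.
rewrite /centering ltNge (ltW a1) /= (gt_eqF a1) -mulrBr normrM ger0_norm//.
apply: le_trans (_ : n%:R * (C3 * (y * V y)) <= _).
  by apply: ler_wpM2l => //; apply: mean_sub_le => // v; apply: h3; lra.
have -> : n%:R * (C3 * (y * V y)) = C3 * y * (n%:R * V y) by ring.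
apply: le_trans (_ : C3 * y * (2 * C * (y / b n) `^ (e - a)) <= _).
  by apply: ler_wpM2l; [exact: mulr_ge0 C30 (ltW y0)|exact: hV].
have -> : C3 * y * (2 * C * (y / b n) `^ (e - a)) =
   C3 * (2 * C) * (y * (y / b n) `^ (e - a)) by ring.
apply: ler_wpM2r; first by apply: mulr_ge0 => //; exact: ltW.
by rewrite lerDr.
Qed.

(** At index 1 neither Karamata bound covers the first moment, but the centering is itself a
    truncated mean, and only the part between [b n] and [y] has to be estimated. It is compared with
    y (y / b n)^(-1/2), which exactly halves under y -> y/4; hence the ratio 4. *)
Lemma mean_scaled_eq1 : a = 1 -> exists (e C1 : R) (n0 : nat),
  [/\ 0 < e, 0 <= C1 & forall n, (n0 <= n)%N -> 0 < b n /\
   forall y : R, b n <= y ->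
   n%:R * tam 2 y <= C1 * (y ^+ 2 * (y / b n) `^ (- e)) /\
   `|n%:R * trunc_mean P xi y - centering P xi a b n| <=
     C1 * (y * (y / b n) `^ (- e))].
Proof.
move=> a1; pose e : R := 1 / 2.
have e0 : 0 < e by rewrite /e; lra.
have [x0 [C [x00 C0 pot]]] := potter_scale e0.
have a2 : a < 2 by rewrite a1; lra.
have [|C2 [n2 [C20 h2]]] := moment2_scaled e0 _ x00 C0 pot.
  by rewrite a1 /e; lra.
have [x1 [C1 [x01 C10 hG]]] := tail_scale_lt2 a2 x00 C0 pot.
have x10 : 0 < x1 by lra.
have pot1 := potter_bounds_ge x01 pot.
have [n0 hn] := scale_normalized C0 pot1.
have eE : e - a = - (1 / 2) by rewrite a1 /e; lra.
rewrite eE in h2 hn.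
pose c := 4 * (C1 * (2 * C)) * 2.
have c0 : 0 <= c by rewrite !mulr_ge0// ltW.
exists (1 / 2), (C2 + 2 * c), (maxn n0 n2); split.
- lra.
- by rewrite addr_ge0// mulr_ge0.
move=> n; rewrite geq_max => /andP[nn0 nn2].
have [b0 h2n] := h2 n nn2; have [xb _ _ hV _] := hn n nn0.
have nG u : b n <= u -> n%:R * G u <= C1 * (2 * C) * (u / b n) `^ (- (1 / 2)).
  move=> bu; have [|h _] := hG u; first by lra.
  apply: le_trans (_ : n%:R * (C1 * V u) <= _); first by rewrite ler_wpM2l.
  by rewrite mulrCA -mulrA; apply: ler_wpM2l => //; exact: hV.
have p4 : (4 : R) `^ (1 / 2) = 2.
  by rewrite mul1r powR12_sqrt// (_ : 4 = 2 ^+ 2 :> R) ?sqrtr_sqr ?ger0_norm//; ring.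
have quarter y : 0 < y ->
    (y / 4 / b n) `^ (- (1 / 2)) = 2 * (y / b n) `^ (- (1 / 2)).
  move=> y0; rewrite (_ : y / 4 / b n = (y / b n) / 4); last by field; rewrite gt_eqF.
  by rewrite powR_div ?divr_ge0// 1?ltW// [4 `^ _]powRN p4 invrK mulrC.
have key y : b n <= y -> n%:R * amb (b n) y <=
    2 * c * (y * (y / b n) `^ (- (1 / 2))).
  apply: (@recursion_down R (fun y => n%:R * amb (b n) y)
    (fun y => y * (y / b n) `^ (- (1 / 2))) 4) => //; first by lra.
  - by move=> u bu; apply: mulr_ge0; [lra|exact: powR_ge0].
  - move=> u /andP[bu u4]; have u0 : 0 < u by lra.
    apply: le_trans (_ : n%:R * (u * G (b n)) <= _).
      by apply: ler_wpM2l => //; exact: abs_mean_between_tail (ltW u0).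
    have h1 := nG _ (lexx (b n)).
    rewrite divff ?gt_eqF// powR1 mulr1 in h1.
    rewrite mulrCA [c * _]mulrCA ler_pM2l//.
    have : 1 / 2 <= (u / b n) `^ (- (1 / 2)).
      have t0 : 0 < (u / b n) `^ (1 / 2) by rewrite powR_gt0// divr_gt0.
      have : (u / b n) `^ (1 / 2) <= 2.
        rewrite -[leRHS]p4; apply: ge0_ler_powR.
        - by lra.
        - by rewrite nnegrE divr_ge0// ltW.
        - by rewrite nnegrE.
        - by rewrite ler_pdivrMr.
      by move=> t2; rewrite powRN -[leRHS]mul1r ler_pdivlMr//; lra.
    set t := _ `^ _; have C12 : 0 <= C1 * (2 * C) by rewrite !mulr_ge0// ltW.
    by move=> t2; apply: le_trans h1 _; rewrite /c; nra.
  - move=> u u4; have u0 : 0 < u by lra.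
    have bu : b n <= u / 4 by lra.
    apply: le_trans (_ : n%:R * (amb (u / 4) u + amb (b n) (u / 4)) <= _).
      apply: ler_wpM2l => //; exact: abs_mean_between_split.
    rewrite mulrDr addrC lerD2l.
    apply: le_trans (_ : n%:R * (u * G (u / 4)) <= _).
      by apply: ler_wpM2l => //; exact: abs_mean_between_tail (ltW u0).
    rewrite mulrCA [c * _]mulrCA ler_pM2l//.
    apply: le_trans (nG _ bu) _; rewrite quarter// /c.
    have t0 := powR_ge0 (u / b n) (- (1 / 2)).
    rewrite mulrA; apply: ler_wpM2r => //.
    have C12 : 0 <= C1 * (2 * C) by rewrite !mulr_ge0// ltW.
    lra.
  - move=> u u4; have u0 : 0 < u by lra.
    by rewrite quarter// le_eqVlt; apply/orP; left; apply/eqP; field.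
split => // y by_; have y0 : 0 < y by lra.
have pw : 0 <= (y / b n) `^ (- (1 / 2)) by exact: powR_ge0.
split.
  apply: le_trans (h2n y by_) _; apply: ler_wpM2r.
    by apply: mulr_ge0 => //; exact: exprn_ge0 (ltW y0).
  by rewrite lerDl mulr_ge0.
rewrite /centering a1 ltxx eqxx -mulrBr normrM ger0_norm//.
apply: le_trans (_ : n%:R * amb (b n) y <= _).
  by apply: ler_wpM2l => //; exact: trunc_mean_sub_le.
apply: le_trans (key y by_) _; apply: ler_wpM2r.
  by apply: mulr_ge0 => //; exact: ltW.
by rewrite lerDr.
Qed.

(** One form for all indices: at a level y >= a_n, the error of the centering and the second moment
    carry a negative power of y / a_n, which pays for the factor e^(s y) of a logarithmic tilt. *)
Theorem truncated_estimates : exists (e C1 : R) (n0 : nat),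
  [/\ 0 < e, 0 <= C1 & forall n, (n0 <= n)%N -> 0 < b n /\
   forall y : R, b n <= y ->
   n%:R * tam 2 y <= C1 * (y ^+ 2 * (y / b n) `^ (- e)) /\
   `|n%:R * trunc_mean P xi y - centering P xi a b n| <=
     C1 * (y * (y / b n) `^ (- e))].
Proof.
have [a1|a1|a1] := ltgtP a 1.
- exact: mean_scaled_lt1.
- exact: mean_scaled_gt1.
- exact: mean_scaled_eq1.
Qed.

(** The decay in [lam] lets a tail be absorbed by a tail at a lower level in [abs_tail_local]; the
    second bound says that n G(y) is not smaller than a power of a_n / y, which bounds the jump term
    from below. *)
Lemma tail_regularity : a < 2 -> exists (s Q C1 x1 : R) (n0 : nat),
  [/\ 0 < s, 0 <= C1, 0 < x1,
    forall lam y : R, 1 <= lam -> x1 <= y -> G (lam * y) <= C1 * lam `^ (- s) * G y &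
    forall n, (n0 <= n)%N -> forall y : R, b n <= y ->
      1 <= C1 * (y / b n) `^ Q * (n%:R * G y)].
Proof.
move=> a2; have a0 : 0 < a by case/andP: a02.
have e0 : 0 < a / 2 by lra.
have [x0 [C [x00 C0 pot]]] := potter_scale e0.
have [x1 [C1 [x01 C10 hG]]] := tail_scale_lt2 a2 x00 C0 pot.
have [n0 hn] := scale_normalized C0 (potter_bounds_ge x01 pot).
exists (a / 2), (a / 2 + a), (2 * (C1 * C) + 4 * C), x1, n0.
have C1C : 0 <= C1 * C by apply: mulr_ge0 => //; exact: ltW.
split.
- by [].
- lra.
- lra.
- move=> lam y lam1 xy; have y0 : 0 < y by lra.
  have yl : y <= lam * y by rewrite ler_peMl// ltW.
  have [|h _] := hG (lam * y); first by lra.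
  have [_ h'] := hG y xy.
  have [|Vy h2 _] := pot y (lam * y) _ yl; first by lra.
  rewrite mulfK ?gt_eqF// (_ : a / 2 - a = - (a / 2)) in h2; last by field.
  have l0 := powR_ge0 lam (- (a / 2)).
  apply: le_trans h _; apply: le_trans (ler_wpM2l C10 h2) _.
  apply: le_trans (_ : C1 * (C * lam `^ (- (a / 2)) * (2 * G y)) <= _).
    apply: ler_wpM2l => //; apply: ler_wpM2l => //.
    by apply: mulr_ge0 => //; exact: ltW.
  rewrite [leLHS](_ : _ = 2 * (C1 * C) * lam `^ (- (a / 2)) * G y); last by ring.
  apply: ler_wpM2r; first exact: abs_tail_ge0.
  by apply: ler_wpM2r => //; lra.
- move=> n /hn [xb _ _ _ hV] y by_.
  apply: le_trans (hV y by_) _.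
  have [|_ h] := hG y; first by lra.
  have t0 := powR_ge0 (y / b n) (a / 2 + a).
  apply: le_trans (_ : 2 * C * (y / b n) `^ (a / 2 + a) * (n%:R * (2 * G y)) <= _).
    apply: ler_wpM2l; first by rewrite !mulr_ge0// ltW.
    exact: ler_wpM2l.
  rewrite [leLHS](_ : _ = 4 * C * (y / b n) `^ (a / 2 + a) * (n%:R * G y)); last by ring.
  apply: ler_wpM2r; first by apply: mulr_ge0 => //; exact: abs_tail_ge0.
  by apply: ler_wpM2r => //; lra.
Qed.

End ScaledEstimates.

(** * Moments at every level for alpha = 2, and growth of the scaling sequence *)

Section GaussianRegime.
Context {R : realType} {d : nat} {disp : measure_display}
  {Om : measurableType disp}.
Variables (P : probability Om R) (Y : Om -> 'rV[int]_d) (i : 'I_d).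
Hypothesis mY : discrete_rv Y.

Let xi : Om -> R := Defs.coord Y i.
Let G := abs_tail P Y i.
Let tam := trunc_abs_moment P Y i.
Let amb := abs_mean_between P Y i.

Variables (a : R) (L : R -> R) (p q : R) (b : nat -> R).
Hypothesis a02 : 0 < a <= 2.
Hypothesis tails : regular_tails P xi a L p q.
Hypothesis scal : scaling P xi a L b.
Hypothesis b_unbounded : forall M : R, exists N : nat,
  forall n, (N <= n)%N -> M <= b n.

Let V := scale_fun P Y i a L.

Lemma gaussian_regime : a = 2 -> exists (C1 : R) (n0 : nat), 0 <= C1 /\
  forall n, (n0 <= n)%N -> forall u : R, 0 < u ->
  n%:R * (`|trunc_mean P xi u - mean P xi| / u + tam 2 u / u ^+ 2) <=
  C1 * ((b n / u) ^+ 2 + 1).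
Proof.
move=> a2; have e0 : 0 < (1 / 2 : R) by lra.
have [x0 [C [x00 C0 pot]]] := potter_scale tails e0.
have [|x1 [C1 [x01 C10 hb]]] := between_bound mY a02 tails _ x00 C0 pot.
  by rewrite a2; lra.
have pot1 := potter_bounds_ge x01 pot.
have [n0 hn] := scale_normalized scal b_unbounded C0 pot1.
have x10 : 0 < x1 by lra.
pose M1 := x1 + C1 * (x1 * V x1).
have Vx1 : 0 < V x1 by have [] := pot1 _ _ (lexx x1) (lexx x1).
have tE (u : R) : 0 < u -> tam 2 u / u ^+ 2 = V u.
  move=> u0; rewrite /V /scale_fun a2 ltxx trunc_moment2E// powRN.
  by rewrite (powR_mulrn 2 (ltW u0)).
have hm (u : R) : x1 <= u -> `|trunc_mean P xi u - mean P xi| / u <= C1 * V u.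
  move=> xu; have u0 : 0 < u by lra.
  rewrite ler_pdivrMr//; apply: mean_sub_le => // v.
  by rewrite -mulrA [_ * u]mulrC; exact: hb.
have M10 : 0 <= M1.
  by apply: addr_ge0; [lra|apply: mulr_ge0 => //; apply: mulr_ge0; exact: ltW].
pose W := V x1 * x1 ^+ 2.
have W0 : 0 < W by apply: mulr_gt0 => //; exact: exprn_gt0.
(* Turns n (M1 x1 + W) / u^2 into a multiple of (b n / u)^2 by way of n W <= 2 (b n)^2, where [W] is
   the second moment truncated at [x1]. *)
pose K2 := 2 * ((M1 * x1 + W) / W).
have K20 : 0 <= K2.
  apply: mulr_ge0 => //; apply: divr_ge0; last exact: ltW.
  by apply: addr_ge0; [apply: mulr_ge0; lra|exact: ltW].
exists ((C1 + 1) * (2 + 2 * C) + K2), n0; split.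
  by apply: addr_ge0 => //; apply: mulr_ge0; lra.
move=> n /hn [xb]; rewrite -/V => le2 _ hV _ u u0; rewrite tE//.
have b0 : 0 < b n by lra.
have bu0 : 0 <= (b n / u) ^+ 2 by exact: exprn_even_ge0.
have n0' : (0 : R) <= n%:R by [].
have [xu|ux] := leP x1 u.
  have VK : n%:R * V u <= (2 + 2 * C) * ((b n / u) ^+ 2 + 1).
    have Cb : 0 <= C * (b n / u) ^+ 2 by apply: mulr_ge0 => //; exact: ltW.
    have [bu|/ltW ub] := leP (b n) u.
      apply: le_trans (hV u bu) _.
      have : (u / b n) `^ (1 / 2 - a) <= 1.
        have ea : 1 / 2 - a <= 0 by rewrite a2; lra.
        rewrite -[leRHS](powRr0 (u / b n)); apply: ler_powR => //.
        by rewrite ler_pdivlMr// mul1r.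
      by move=> /(ler_wpM2l (ltW C0)); lra.
    have : n%:R * V u <= 2 * (b n / u) ^+ 2.
      rewrite -tE// expr_div_n mulrA ler_pdivrMr ?exprn_gt0//.
      have -> : 2 * (b n ^+ 2 / u ^+ 2) * u ^+ 2 = 2 * b n ^+ 2.
        by field; rewrite gt_eqF.
      apply: le_trans (_ : n%:R * tam 2 (b n) <= _).
        by apply: ler_wpM2l => //; exact: trunc_abs_moment_mono.
      move: le2; rewrite -tE// mulrA ler_pdivrMr ?exprn_gt0//.
    by lra.
  have h := hm u xu.
  have : n%:R * (`|trunc_mean P xi u - mean P xi| / u + V u) <=
      (C1 + 1) * (n%:R * V u).
    rewrite mulrCA; apply: ler_wpM2l => //; lra.
  have : (C1 + 1) * (n%:R * V u) <=
      (C1 + 1) * ((2 + 2 * C) * ((b n / u) ^+ 2 + 1)).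
    by apply: ler_wpM2l => //; lra.
  have : 0 <= K2 * ((b n / u) ^+ 2 + 1) by apply: mulr_ge0 => //; lra.
  rewrite [X in _ -> _ -> _ -> _ <= X]mulrDl -(mulrA (C1 + 1)); lra.
have ux' : u <= x1 by exact: ltW.
have hm1 : `|trunc_mean P xi u - mean P xi| <= M1.
  rewrite -(subrKA (trunc_mean P xi x1)) addrC.
  apply: le_trans (ler_normD _ _) _; rewrite addrC /M1; apply: lerD; last first.
    by have := hm x1 (lexx x1); rewrite ler_pdivrMr// -mulrA [_ * x1]mulrC.
  rewrite distrC; apply: le_trans (trunc_mean_sub_le P i mY ux') _.
  apply: le_trans (abs_mean_between_tail P i mY u (ltW x10)) _.
  rewrite -[leRHS]mulr1; apply: ler_wpM2l; [exact: ltW|exact: abs_tail_le1].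
have nW : n%:R * W <= 2 * b n ^+ 2.
  have -> : W = tam 2 x1 by rewrite /W -tE// divfK// gt_eqF// exprn_gt0.
  apply: le_trans (_ : n%:R * tam 2 (b n) <= _).
    by apply: ler_wpM2l => //; exact: trunc_abs_moment_mono.
  by move: le2; rewrite -tE// mulrA ler_pdivrMr ?exprn_gt0.
have u2 : 0 < u ^+ 2 by exact: exprn_gt0.
have h1 : `|trunc_mean P xi u - mean P xi| / u + V u <= (M1 * x1 + W) / u ^+ 2.
  rewrite ler_pdivlMr// mulrDl; apply: lerD.
    rewrite expr2 mulrA divfK ?gt_eqF//.
    by apply: ler_pM => //; exact: ltW.
  rewrite -tE// divfK ?gt_eqF//.
  have -> : W = tam 2 x1 by rewrite /W -tE// divfK// gt_eqF// exprn_gt0.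
  exact: trunc_abs_moment_mono.
apply: le_trans (ler_wpM2l n0' h1) _.
apply: le_trans (_ : K2 * (b n / u) ^+ 2 <= _).
  rewrite expr_div_n mulrA [leRHS]mulrA ler_pM2r ?invr_gt0//.
  have -> : K2 * b n ^+ 2 = (M1 * x1 + W) / W * (2 * b n ^+ 2).
    by rewrite /K2; ring.
  have -> : n%:R * (M1 * x1 + W) = (M1 * x1 + W) / W * (n%:R * W).
    by field; rewrite gt_eqF.
  apply: ler_wpM2l => //; apply: divr_ge0; last exact: ltW.
  by apply: addr_ge0; [apply: mulr_ge0; lra|exact: ltW].
have h2 : 0 <= (C1 + 1) * (2 + 2 * C) * ((b n / u) ^+ 2 + 1).
  by apply: mulr_ge0; [apply: mulr_ge0; lra|lra].
by rewrite mulrDl [K2 * (_ + 1)]mulrDr; lra.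
Qed.

(** For b n > b k, 1/2 <= n V(b n) = (n/k) k V(b n), and k V(b n) is at most a constant times (b n /
    b k)^(-alpha/2) by Potter's bounds; solving for the ratio gives the exponent 2/alpha. *)
Lemma scale_ratio : exists (kap C1 : R), [/\ 0 < kap, 0 < C1 &
  exists n0 : nat, forall k n : nat, (n0 <= k)%N -> (k <= n)%N ->
  b n <= C1 * (n%:R / k%:R) `^ kap * b k].
Proof.
have a0 : 0 < a by case/andP: a02.
have e0 : 0 < a / 2 by lra.
have [x0 [C [x00 C0 pot]]] := potter_scale tails e0.
have [n0 hn] := scale_normalized scal b_unbounded C0 pot.
pose s := a / 2; have s0 : 0 < s by [].
have sE : a / 2 - a = - s by rewrite /s; field.
have D1 : 1 <= 4 * C + 1 by lra.
exists s^-1, ((4 * C + 1) `^ s^-1); split.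
- by rewrite invr_gt0.
- by rewrite powR_gt0//; lra.
exists (maxn 1 n0) => k n; rewrite geq_max => /andP[k0 nk] kn.
have [xk lek _ hV _] := hn k nk.
have [xn _ gen _ _] := hn n (leq_trans nk kn).
have bk0 : 0 < b k by lra.
have k0' : 0 < k%:R :> R by rewrite ltr0n.
have nk1 : 1 <= n%:R / k%:R :> R by rewrite ler_pdivlMr// mul1r ler_nat.
rewrite -powRM; [|lra|lra].
have sV : 0 <= s^-1 by rewrite invr_ge0 ltW.
have [nb|bn] := leP (b n) (b k).
  apply: le_trans nb _; rewrite -[leLHS]mul1r; apply: ler_wpM2r; first exact: ltW.
  by apply: powR_ge1 => //; nra.
rewrite -ler_pdivrMr//.
have h := hV (b n) (ltW bn); rewrite sE in h.
have t0 : 0 < b n / b k by apply: divr_gt0; lra.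
have kV : k%:R * V (b n) * (n%:R / k%:R) = n%:R * V (b n).
  by field; rewrite gt_eqF.
have ts : 0 < (b n / b k) `^ s by exact: powR_gt0.
have key : (b n / b k) `^ s <= (4 * C + 1) * (n%:R / k%:R).
  have h2 : 1 / 2 <= 2 * C * (b n / b k) `^ (- s) * (n%:R / k%:R).
    by apply: le_trans gen _; rewrite -kV; apply: ler_wpM2r => //; lra.
  have h3 := ler_wpM2r (ltW ts) h2.
  have h4 : 2 * C * (b n / b k) `^ (- s) * (n%:R / k%:R) * (b n / b k) `^ s =
    2 * C * (n%:R / k%:R) by rewrite powRN; field; rewrite !gt_eqF.
  by rewrite h4 in h3; lra.
have -> : b n / b k = ((b n / b k) `^ s) `^ s^-1.
  by rewrite -powRrM divff ?gt_eqF// (powRr1 (ltW t0)).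
apply: ge0_ler_powR => //; rewrite nnegrE; first exact: ltW.
by apply: mulr_ge0; lra.
Qed.

End GaussianRegime.

(** * Characteristic functions *)

Section Trigonometry.
Context {R : realType}.
Implicit Types x y t : R.

Lemma MVT_lipschitz1 (f df : R -> R) x y :
  (forall t, is_derive t 1 f (df t)) -> (forall t, `|df t| <= 1) ->
  `|f x - f y| <= `|x - y|.
Proof.
move=> fdf df1.
wlog xy : x y / x <= y.
  move=> H; have [/H//|/ltW/H] := leP x y.
  by rewrite distrC [leRHS]distrC.
have fc : {within `[x, y], continuous f}.
  apply: derivable_within_continuous => t _; exact: ex_derive.
have [c _ cE] := MVT_segment xy (fun t _ => fdf t) fc.
by rewrite distrC cE [leRHS]distrC normrM ler_piMl.
Qed.

Lemma cos_lipschitz x y : `|cos x - cos y| <= `|x - y|.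
Proof.
apply: (MVT_lipschitz1 (df := fun t => - sin t)) => t.
by rewrite normrN sin_max.
Qed.

Lemma sin_lipschitz x y : `|sin x - sin y| <= `|x - y|.
Proof.
by apply: (MVT_lipschitz1 (df := fun t => cos t)) => t; exact: cos_max.
Qed.

Lemma cos_lt1 x : 0 < `|x| <= pi -> cos x < 1.
Proof.
move=> /andP[x0 xpi]; rewrite -cos_norm -[ltRHS](@cos0 R).
by rewrite ltr_cos// in_itv/= ?lexx ?pi_ge0// (ltW x0).
Qed.

Lemma cosD_int_2pi (k : int) x : cos (x + k%:~R * (pi *+ 2)) = cos x.
Proof.
case: k => n.
  by rewrite -pmulrn mulr_natl; exact: (periodicn (@cosD2pi R)).
rewrite NegzE mulrNz mulNr -pmulrn mulr_natl.
by rewrite -[LHS](periodicn (@cosD2pi R) n.+1) subrK.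
Qed.

Lemma cos_eq1 x : cos x = 1 -> exists k : int, x = k%:~R * (pi *+ 2).
Proof.
move=> cx; have pi0 : (0 : R) < pi by exact: pi_gt0.
have p0 : (0 : R) < pi *+ 2 by rewrite pmulrn_lgt0.
have p2 : pi *+ 2 = 2 * pi :> R by rewrite mulr_natl.
set k := Num.floor (x / (pi *+ 2)); exists k.
pose r := x - k%:~R * (pi *+ 2).
have cr : cos r = 1.
  by rewrite /r -mulNr -mulrNz cosD_int_2pi.
have r0 : 0 <= r by rewrite subr_ge0 -ler_pdivlMr// ge_floor.
have r2 : r < pi *+ 2.
  rewrite ltrBlDr -[X in X + _]mul1r -mulrDl -ltr_pdivrMr// addrC.
  by have := floorD1_gt (x / (pi *+ 2)); rewrite intrD.
suff : r = 0 by move=> /eqP; rewrite subr_eq0 => /eqP.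
have [rpi|pir] := leP r pi.
  have [//|rn0] := eqVneq r 0.
  have := @cos_lt1 r; rewrite normr_gt0 rn0 (ger0_norm r0) rpi cr ltxx.
  by move=> /(_ isT).
have := @cos_lt1 (r + (-1)%:~R * (pi *+ 2)).
rewrite cosD_int_2pi cr ltxx mulN1r normr_gt0 ltr0_norm; last by lra.
rewrite subr_eq0 lt_eqF// opprB => /(_ _) H.
by exfalso; apply: notF; apply: H; lra.
Qed.

End Trigonometry.

(** * Fourier bound for point probabilities, and aperiodicity *)

Section FourierBound.
Context {R : realType} {d : nat} {disp : measure_display}
  {Om : measurableType disp}.
Variable P : probability Om R.
Variable X : nat -> Om -> 'rV[int]_d.
Hypothesis X_iid : iid P X.

Definition dotz (t : 'rV[R]_d) (z : 'rV[int]_d) : R :=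
  \sum_i t 0 i * (z 0 i)%:~R.

Lemma dotz0 t : dotz t 0 = 0.
Proof. by rewrite /dotz big1// => i _; rewrite mxE mulr0. Qed.

Lemma dotzD t : {morph dotz t : u v / u + v}.
Proof.
move=> u v; rewrite /dotz -big_split; apply: eq_bigr => i _ /=.
by rewrite mxE intrD mulrDr.
Qed.

Lemma dotzN t u : dotz t (- u) = - dotz t u.
Proof.
by apply/eqP; rewrite -addr_eq0 -dotzD addNr dotz0.
Qed.

(* |E exp(i t.X)|^2, so that everything stays real. *)
Definition cf2 (t : 'rV[R]_d) : R :=
  Ex P (fun w => cos (dotz t (X 0%N w))) ^+ 2 +
  Ex P (fun w => sin (dotz t (X 0%N w))) ^+ 2.

Let mX j : discrete_rv (X j). Proof. by have [mX _ _] := X_iid; exact: mX. Qed.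

Lemma bounded_cos t n : bounded_rv (fun w => cos (dotz t (walk X n w))).
Proof.
apply: (bounded_rv_walk X_iid n (h := fun z => cos (dotz t z))).
by exists 1 => z; exact: cos_max.
Qed.

Lemma bounded_sin t n : bounded_rv (fun w => sin (dotz t (walk X n w))).
Proof.
apply: (bounded_rv_walk X_iid n (h := fun z => sin (dotz t z))).
by exists 1 => z; exact: sin_max.
Qed.

Lemma bounded_cos1 t : bounded_rv (fun w => cos (dotz t (X 0%N w))).
Proof.
apply: (bounded_rv_step X_iid (h := fun z => cos (dotz t z))).
by exists 1 => z; exact: cos_max.
Qed.

Lemma bounded_sin1 t : bounded_rv (fun w => sin (dotz t (X 0%N w))).
Proof.
apply: (bounded_rv_step X_iid (h := fun z => sin (dotz t z))).
by exists 1 => z; exact: sin_max.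
Qed.

Lemma cf2_ge0 t : 0 <= cf2 t.
Proof. by rewrite addr_ge0// sqr_ge0. Qed.

(** With phi = E exp(i t.X), the integrand is 1 - Re(conj(phi) exp(i t.X)). It is nonnegative when
    |phi| <= 1, and for |phi| = 1 a zero mean forces exp(i t.X) = phi on the support. *)
Lemma cf2_defect t : Ex P (fun w => 1 -
   (Ex P (fun w => cos (dotz t (X 0%N w))) * cos (dotz t (X 0%N w)) +
    Ex P (fun w => sin (dotz t (X 0%N w))) * sin (dotz t (X 0%N w)))) =
  1 - cf2 t.
Proof.
have bc := bounded_cos1 t; have bs := bounded_sin1 t.
rewrite ExB; last 2 first.
- exact: bounded_rv_cst.
- by apply: bounded_rvD; exact: bounded_rvZ.
rewrite Ex_cst ExD; [|exact: bounded_rvZ|exact: bounded_rvZ].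
by rewrite !ExZ// -!expr2.
Qed.

Lemma cauchy2 (c s x y : R) : c * x + s * y <= Num.sqrt (c ^+ 2 + s ^+ 2) *
  Num.sqrt (x ^+ 2 + y ^+ 2).
Proof.
have [h|/ltW h] := leP (c * x + s * y) 0.
  by apply: le_trans h _; rewrite mulr_ge0// sqrtr_ge0.
rewrite -sqrtrM ?addr_ge0 ?sqr_ge0// -[leLHS](ger0_norm h) -sqrtr_sqr.
apply: ler_wsqrtr; rewrite -subr_ge0.
by rewrite [leRHS](_ : _ = (c * y - s * x) ^+ 2) ?sqr_ge0//; ring.
Qed.

Lemma Ex_cos_shift t n z :
  Ex P (fun w => cos (dotz t (walk X n w - z))) <= Num.sqrt (cf2 t ^+ n).
Proof.
have -> : (fun w => cos (dotz t (walk X n w - z))) =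
   (fun w => cos (dotz t z) * cos (dotz t (walk X n w)) +
             sin (dotz t z) * sin (dotz t (walk X n w))).
  apply/funext => w; rewrite dotzD dotzN cosB; ring.
have bc := bounded_cos t n; have bs := bounded_sin t n.
rewrite ExD; [|exact: bounded_rvZ|exact: bounded_rvZ].
rewrite !ExZ//; apply: le_trans (cauchy2 _ _ _ _) _.
rewrite cos2Dsin2 sqrtr1 mul1r charfun_walk//; last exact: dotzD.
exact: dotz0.
Qed.

Definition grid (s : R) (M : nat) (k : {ffun 'I_d -> 'I_M}) : 'rV[R]_d :=
  \row_i (s * (k i)%:R).

(* The indicator of u = 0 is at most M^-2d |sum_k e^(i s k.u)|^2: a finite average
   replaces the Fourier inversion integral. *)
Lemma fejer_bound (s : R) (M n : nat) (z : 'rV[int]_d) : (0 < M)%N ->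
  Pr P [set w | walk X n w = z] <= (M%:R ^- d) ^+ 2 *
   \sum_(k : {ffun 'I_d -> 'I_M}) \sum_(l : {ffun 'I_d -> 'I_M})
      Num.sqrt (cf2 (grid s k - grid s l) ^+ n).
Proof.
move=> M0; have M0' : (0 : R) < M%:R by rewrite ltr0n.
have Md : (0 : R) < M%:R ^+ d by exact: exprn_gt0.
have dotzB k l u : dotz (grid s k - grid s l) u = dotz (grid s k) u - dotz (grid s l) u.
  by rewrite /dotz -sumrB; apply: eq_bigr => i _; rewrite !mxE mulrBl.
have sq u : \sum_(k : {ffun 'I_d -> 'I_M}) \sum_(l : {ffun 'I_d -> 'I_M})
   cos (dotz (grid s k - grid s l) u) =
   (\sum_(k : {ffun 'I_d -> 'I_M}) cos (dotz (grid s k) u)) ^+ 2 +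
   (\sum_(k : {ffun 'I_d -> 'I_M}) sin (dotz (grid s k) u)) ^+ 2.
  rewrite !expr2 !mulr_suml -big_split /=; apply: eq_bigr => k _.
  rewrite !mulr_sumr -big_split /=; apply: eq_bigr => l _.
  by rewrite dotzB cosB.
have bcz t : bounded_rv (fun w => cos (dotz t (walk X n w - z))).
  apply: (bounded_rv_walk X_iid n (h := fun u => cos (dotz t (u - z)))).
  by exists 1 => u; exact: cos_max.
rewrite -Pr_walk_Ex//.
apply: le_trans (_ : Ex P (fun w => (M%:R ^- d) ^+ 2 *
   \sum_(k : {ffun 'I_d -> 'I_M}) \sum_(l : {ffun 'I_d -> 'I_M})
   cos (dotz (grid s k - grid s l) (walk X n w - z))) <= _).
  apply: ler_Ex.
  - apply: (bounded_rv_walk X_iid n (h := fun u => (u == z)%:R)).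
    by exists 1 => u; rewrite normr_nat; case: (u == z).
  - apply: bounded_rvZ; apply: bounded_rv_sum => k.
    by apply: bounded_rv_sum => l; exact: bcz.
  - move=> w; rewrite sq; case: eqP => [->|_]; last first.
      by rewrite mulr_ge0 ?addr_ge0 ?sqr_ge0.
    rewrite subrr.
    have -> : \sum_(k : {ffun 'I_d -> 'I_M}) cos (dotz (grid s k) 0) = M%:R ^+ d.
      under eq_bigr do rewrite dotz0 cos0.
      by rewrite sumr_const card_ffun !card_ord natrX.
    apply: le_trans (_ : (M%:R ^- d) ^+ 2 * (M%:R ^+ d) ^+ 2 <= _).
      by rewrite -exprMn mulVf ?gt_eqF// expr1n.
    by apply: ler_wpM2l; rewrite ?sqr_ge0// lerDl sqr_ge0.
rewrite ExZ; last first.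
  by apply: bounded_rv_sum => k; apply: bounded_rv_sum => l; exact: bcz.
apply: ler_wpM2l; first exact: sqr_ge0.
rewrite Ex_sum; last by move=> k; apply: bounded_rv_sum => l; exact: bcz.
apply: ler_sum => k _; rewrite Ex_sum; last by move=> l; exact: bcz.
by apply: ler_sum => l _; exact: Ex_cos_shift.
Qed.

Lemma cf2_le1 t : cf2 t <= 1.
Proof.
have bc := bounded_cos1 t; have bs := bounded_sin1 t.
set c := Ex P (fun w => cos (dotz t (X 0%N w))).
set r := Ex P (fun w => sin (dotz t (X 0%N w))).
have cfE : cf2 t = c ^+ 2 + r ^+ 2 by [].
have : 1 - Num.sqrt (cf2 t) <= 1 - cf2 t.
  rewrite -cf2_defect -[leLHS](Ex_cst P); apply: ler_Ex.
  - exact: bounded_rv_cst.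
  - apply: bounded_rvB; first exact: bounded_rv_cst.
    by apply: bounded_rvD; exact: bounded_rvZ.
  - move=> w; rewrite lerD2l lerN2; apply: le_trans (cauchy2 _ _ _ _) _.
    by rewrite cos2Dsin2 sqrtr1 mulr1.
have := sqr_sqrtr (cf2_ge0 t); have := sqrtr_ge0 (cf2 t).
set q := Num.sqrt _ => q0 qE; rewrite -qE; nra.
Qed.

(** Modulus 1 would put the support in one coset of the subgroup [H] of those z with t.z in 2 pi Z.
    By aperiodicity [H] contains the basis vectors, so every coordinate of [t] is a multiple of 2
    pi, and the bound by pi leaves only t = 0. *)
Lemma cf2_lt1 (t : 'rV[R]_d) : aperiodic P (X 0%N) -> t != 0 ->
  (forall i, `|t 0 i| <= pi) -> cf2 t < 1.
Proof.
move=> aper tn0 tpi; rewrite lt_neqAle cf2_le1 andbT; apply/eqP => cf1.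
have bc := bounded_cos1 t; have bs := bounded_sin1 t.
have defect := cf2_defect t; rewrite cf1 subrr in defect.
set c := Ex P (fun w => cos (dotz t (X 0%N w))) in defect.
set r := Ex P (fun w => sin (dotz t (X 0%N w))) in defect.
have cr1 : c ^+ 2 + r ^+ 2 = 1 by exact: cf1.
pose g z := 1 - (c * cos (dotz t z) + r * sin (dotz t z)).
have g0 z : 0 <= g z.
  rewrite subr_ge0; apply: le_trans (cauchy2 _ _ _ _) _.
  by rewrite cos2Dsin2 cr1 sqrtr1 mulr1.
have supp x : Defs.support P (X 0%N) x -> cos (dotz t x) = c /\ sin (dotz t x) = r.
  move=> px.
  have px0 : 0 < Pr P [set w | X 0%N w = x].
    by rewrite /Pr fine_gt0// px /= ltey_eq fin_num_measure//; exact: (mX 0 [set x]).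
  have ub : Pr P [set w | X 0%N w = x] * g x <= 0.
    rewrite -[leRHS]defect.
    have -> : [set w | X 0%N w = x] = [set w | X 0%N w == x].
      by apply/seteqP; split => w /= /eqP.
    have m1 : measurable [set w | X 0%N w == x] by exact: (mX 0 [set z | z == x]).
    rewrite -Ex_indic// mulrC -ExZ; last exact: bounded_rv_indic.
    apply: ler_Ex.
    - by apply: bounded_rvZ; exact: bounded_rv_indic.
    - apply: bounded_rvB; first exact: bounded_rv_cst.
      by apply: bounded_rvD; exact: bounded_rvZ.
    - move=> w; case: eqP => [->|_]; rewrite ?mulr1 ?mulr0//; exact: g0.
  have gx : g x = 0.
    by apply/le_anti; rewrite g0 andbT -(pmulr_rle0 _ px0).
  have := cos2Dsin2 (dotz t x); move: gx cr1; rewrite /g.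
  move: (cos _) (sin _) => u v /eqP; rewrite subr_eq0 => /eqP h1 h2 h3.
  have h4 : (u - c) ^+ 2 + (v - r) ^+ 2 = 0.
    by rewrite [LHS](_ : _ = (u ^+ 2 + v ^+ 2) + (c ^+ 2 + r ^+ 2) -
      2 * (c * u + r * v)); [rewrite h2 h3 -h1; ring|ring].
  have := sqr_ge0 (u - c); have := sqr_ge0 (v - r) => h5 h6.
  have h7 : (u - c) ^+ 2 = 0 by lra.
  have h8 : (v - r) ^+ 2 = 0 by lra.
  move/eqP : h7; move/eqP : h8; rewrite !sqrf_eq0 !subr_eq0.
  by move=> /eqP -> /eqP ->.
pose H : {pred 'rV[int]_d} := [pred z | cos (dotz t z) == 1].
have Hz : zmod_closed H.
  split => [|u v]; rewrite !inE; first by rewrite dotz0 cos0.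
  move=> /eqP hu /eqP hv; rewrite dotzD dotzN cosB hu hv.
  by rewrite (cos1sin0 (x := dotz t u)) ?hu ?normr1// mul0r mulr1 addr0.
have Hall : forall x, x \in H.
  have [[x0 sx0]|nosupp] := pselect (exists x0, Defs.support P (X 0%N) x0).
    apply: (aper H x0) => // x /supp[hc hs] /=.
    have [hc0 hs0] := supp _ sx0.
    by rewrite inE /= dotzD dotzN cosB hc hs hc0 hs0 -!expr2 cr1.
  (* An empty support lies in every coset, so its non-emptiness does not have to be established. *)
  apply: (aper H 0) => // x sx; exfalso; apply: nosupp; by exists x.
move/negP : tn0; apply; apply/eqP/rowP => i; rewrite mxE.
have := Hall (\row_j (j == i)%:Z); rewrite inE /= /dotz (bigD1 i)//= mxE eqxx mulr1.
rewrite big1; last by move=> j /negPf ji; rewrite mxE ji mulr0.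
rewrite addr0 => /eqP ci; apply/eqP; have [//|ti] := eqVneq (t 0 i) 0.
have := @cos_lt1 R (t 0 i); rewrite normr_gt0 ti tpi ci ltxx.
by move=> /(_ isT).
Qed.

Hypothesis X_aperiodic : aperiodic P (X 0%N).

(** On a fixed grid the off-diagonal terms of the Fejer average decay geometrically, since
    differences of grid points are nonzero with coordinates within pi; the diagonal leaves M^-d.
    This serves to show that a_n is unbounded. *)
Lemma Pr_walk_vanishes (eps : R) : (0 < d)%N -> 0 < eps ->
  exists n0 : nat, forall n z, (n0 <= n)%N ->
  Pr P [set w | walk X n w = z] <= eps.
Proof.
move=> d0 eps0.
(* The diagonal contribution satisfies M^-d <= M^-1 < eps. *)
pose M := (Num.truncn (2 / eps)).+1.
have M0 : (0 < M)%N by [].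
have M0' : (0 : R) < M%:R by rewrite ltr0n.
have hM : 2 / eps < M%:R by exact: truncnS_gt.
have pi0 : (0 : R) < pi := pi_gt0 _.
pose s : R := pi / M%:R.
have s0 : 0 < s by rewrite divr_gt0.
pose F (k l : {ffun 'I_d -> 'I_M}) n := Num.sqrt (cf2 (grid s k - grid s l) ^+ n).
have Fcvg k l : F k l n @[n --> \oo] --> ((k == l)%:R : R).
  have sqrtX (x : R) n : 0 <= x -> Num.sqrt (x ^+ n) = Num.sqrt x ^+ n.
    by move=> x0; elim: n => [|n IH]; rewrite ?sqrtr1// !exprS sqrtrM// IH.
  have [->|kl] := eqVneq k l.
    rewrite /F subrr; apply: cvg_near_cst; apply: nearW => n.
    suff -> : cf2 0 = 1 by rewrite expr1n sqrtr1.
    have pz z : dotz 0 z = 0 by rewrite /dotz big1// => i _; rewrite mxE mul0r.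
    rewrite /cf2; under [X in Ex P X]eq_fun do rewrite pz cos0.
    under [X in _ + Ex P X ^+ 2]eq_fun do rewrite pz sin0.
    by rewrite !Ex_cst expr1n expr0n addr0.
  have lt1 : Num.sqrt (cf2 (grid s k - grid s l)) < 1.
    rewrite -[ltRHS]sqrtr1 ltr_sqrt// cf2_lt1//.
      apply/eqP => /rowP E; move/eqP : kl; apply; apply/ffunP => i.
      have := E i; rewrite !mxE -mulrBr => /eqP; rewrite mulf_eq0 (gt_eqF s0) /=.
      by rewrite subr_eq0 eqr_nat => /eqP ?; exact: val_inj.
    move=> i; rewrite !mxE -mulrBr normrM gtr0_norm// /s mulrAC ler_pdivrMr//.
    rewrite ler_pM2l// ler_norml.
    have := ltn_ord (k i); have := ltn_ord (l i).
    rewrite -!(ltr_nat R) => /ltW h1 /ltW h2.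
    have := ler0n R (k i); have := ler0n R (l i); lra.
  rewrite /F; under eq_fun do rewrite sqrtX ?cf2_ge0//.
  by apply: cvg_expr; rewrite ger0_norm// sqrtr_ge0.
have Scvg : (M%:R ^- d) ^+ 2 * (\sum_k \sum_l F k l n) @[n --> \oo] -->
    (M%:R ^- d) ^+ 2 *
    \sum_(k : {ffun 'I_d -> 'I_M}) \sum_(l : {ffun 'I_d -> 'I_M}) ((k == l)%:R : R).
  apply: cvgM; first exact: cvg_cst.
  apply: (cvg_big (@add_continuous R)) => k _.
  by apply: (cvg_big (@add_continuous R)) => l _; exact: Fcvg.
have lim_lt : (M%:R ^- d) ^+ 2 *
   (\sum_(k : {ffun 'I_d -> 'I_M}) \sum_(l : {ffun 'I_d -> 'I_M})
   ((k == l)%:R : R)) < eps.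
  under eq_bigr => k _.
    rewrite (bigD1 k)//= eqxx big1 ?addr0; last first.
      by move=> l; rewrite eq_sym => /negPf ->.
    over.
  rewrite sumr_const card_ffun !card_ord natrX expr2 -mulrA mulVf; last first.
    by rewrite gt_eqF// exprn_gt0.
  rewrite mulr1; apply: (@le_lt_trans _ _ (M%:R^-1)).
    rewrite lef_pV2 ?posrE ?exprn_gt0// ler_eXnr//.
    by rewrite ler1n.
  rewrite -[ltLHS]mul1r ltr_pdivrMr//.
  have : eps * (2 / eps) < eps * M%:R by rewrite ltr_pM2l.
  by rewrite mulrCA divff ?gt_eqF//; lra.
have [n0 _ hn0] := cvgr_le _ Scvg _ lim_lt.
exists n0 => n z nn0; apply: le_trans (fejer_bound s n z M0) _.
exact: hn0.
Qed.

End FourierBound.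

(** * Linear forms and laws with a density *)

Section VectorNorm.
Context {R : realType} {d : nat}.
Implicit Types (t z : 'rV[R]_d).

Definition dotr t z : R := \sum_i t 0 i * z 0 i.

Lemma coord_le_norm z i : `|z 0 i| <= `|z|.
Proof.
rewrite [leRHS]/Num.norm /= mx_normrE; apply/bigmax_geP; right.
by exists (ord0, i).
Qed.

Lemma norm_le_coord z (c : R) : 0 <= c -> (forall i, `|z 0 i| <= c) -> `|z| <= c.
Proof.
move=> c0 zc; rewrite /Num.norm /= mx_normrE; apply/bigmax_leP; split => //.
by move=> [i j] _ /=; rewrite ord1.
Qed.

Lemma dotr_le t z : `|dotr t z| <= d%:R * `|t| * `|z|.
Proof.
apply: le_trans (ler_norm_sum _ _ _) _.
apply: le_trans (_ : \sum_(i < d) `|t| * `|z| <= _).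
  by apply: ler_sum => i _; rewrite normrM ler_pM ?coord_le_norm.
by rewrite sumr_const card_ord -[leLHS]mulr_natl mulrA.
Qed.

Lemma dotrB s t z : dotr (s - t) z = dotr s z - dotr t z.
Proof. by rewrite /dotr -sumrB; apply: eq_bigr => i _; rewrite !mxE mulrBl. Qed.

Lemma dotrBr t y z : dotr t (y - z) = dotr t y - dotr t z.
Proof. by rewrite /dotr -sumrB; apply: eq_bigr => i _; rewrite !mxE mulrBr. Qed.

Lemma dotr_continuous t : continuous (dotr t).
Proof.
move=> z; apply/(@cvgrPdist_le _ _ _ _ (nbhs_filter z)) => e e0.
pose K := d%:R * `|t| + 1.
have K0 : 0 < K by apply: ltr_wpDl => //; exact: mulr_ge0.
near=> y; rewrite -dotrBr; apply: le_trans (dotr_le _ _) _.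
have zy : `|z - y| <= e / K.
  by near: y; apply: cvgr_dist_le; [exact: cvg_id|exact: divr_gt0].
apply: le_trans (_ : K * (e / K) <= _).
  by apply: ler_pM => //; rewrite /K lerDl.
by rewrite mulrC divfK// gt_eqF.
Unshelve. all: by end_near. Qed.

End VectorNorm.

(** Induction along the iterated integral. If [t] has a nonzero coordinate after the first, every
    inner integral is supported on a hyperplane of lower dimension; otherwise the equation fixes the
    first coordinate, and a point has Lebesgue measure 0. *)
Lemma lebesgue_int_hyperplane (R : realType) (d : nat) (t : 'rV[R]_d) (c : R)
    (f : 'rV[R]_d -> \bar R) : t != 0 ->
  (forall z, dotr t z != c -> f z = 0%E) -> lebesgue_int f = 0%E.
Proof.
elim: d t c f => [|k IH] t c f t0 f0.
  by exfalso; move/eqP : t0; apply; apply/rowP => -[].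
have dotE (x : R) (z : 'rV[R]_k) : dotr t (row_mx (x%:M : 'rV[R]_1) z) =
    t 0 ord0 * x + dotr (@rsubmx R 1 1 k t) z.
  rewrite /dotr big_ord_recl; congr (_ * _ + _).
    transitivity ((row_mx (x%:M : 'rV[R]_1) z) 0 (lshift k (ord0 : 'I_1))).
      by congr (fun_of_matrix _ _ _); exact: val_inj.
    by rewrite row_mxEl mxE eqxx mulr1n.
  apply: eq_bigr => i _; congr (_ * _).
    by rewrite mxE; congr (fun_of_matrix t _ _); exact: val_inj.
  transitivity ((row_mx (x%:M : 'rV[R]_1) z) 0 (rshift 1 i)).
    by congr (fun_of_matrix _ _ _); exact: val_inj.
  by rewrite row_mxEr.
have zero (h : 'rV[R]_k -> \bar R) : (forall z, h z = 0%E) -> lebesgue_int h = 0%E.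
  elim: {IH f f0 t t0 dotE} k h => [|k IHk] h h0 /=; first exact: h0.
  by under eq_integral do rewrite IHk//; rewrite integral0.
rewrite /=.
have [tr0|tr0] := eqVneq (@rsubmx R 1 1 k t) 0; last first.
  under eq_integral.
    move=> x _; rewrite (IH _ (c - t 0 ord0 * x) _ tr0); last first.
      move=> z hz; apply: f0; rewrite dotE; apply: contra hz => /eqP <-.
      by rewrite addrAC subrr add0r.
    over.
  by rewrite integral0.
have th0 : t 0 ord0 != 0.
  apply: contra t0 => /eqP t00; apply/eqP/rowP => i; rewrite mxE.
  case: (unliftP ord0 i) => [j ->|-> //].
  have := congr1 (fun M : 'rV[R]_k => M 0 j) tr0.
  by rewrite !mxE => <-; congr (fun_of_matrix t _ _); exact: val_inj.
pose x0 := c / t 0 ord0.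
have offx0 x : x != x0 ->
    lebesgue_int (fun z : 'rV[R]_k => f (row_mx (x%:M : 'rV[R]_1) z)) = 0%E.
  move=> xx0; apply: zero => z; apply: f0; rewrite dotE tr0.
  have -> : dotr (0 : 'rV[R]_k) z = 0.
    by rewrite /dotr big1// => i _; rewrite mxE mul0r.
  apply: contra xx0; rewrite addr0 => /eqP E; apply/eqP.
  by rewrite /x0 -E mulrC mulKf.
pose v := lebesgue_int (fun z : 'rV[R]_k => f (row_mx (x0%:M : 'rV[R]_1) z)).
transitivity (\int[@lebesgue_measure R]_(x in [set x0]) v)%E.
  rewrite [RHS]integral_mkcond; apply: eq_integral => x _; rewrite patchE.
  case: ifPn => [|/negP xx0]; first by rewrite inE /= => ->.
  by apply: offx0; apply/eqP => E; apply: xx0; rewrite inE /= E.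
apply: null_set_integral; last exact: lebesgue_measure_set1.
  exact: measurable_set1.
exact: measurable_cst.
Qed.

(** A modulus of continuity for characteristic functions: [Num.min (del * W w) 2] bounds the
    variation of cos(t.Z) and sin(t.Z) when t moves by a multiple of [del] and W = |Z|. The cap at 2
    replaces a finite mean. *)
Lemma small_truncated_mean (R : realType) (disp : measure_display)
    (Om : measurableType disp) (P : probability Om R) (W : Om -> R) (eps : R) :
  measurable_fun [set: Om] W -> (forall w, 0 <= W w) -> 0 < eps ->
  exists2 del : R, 0 < del & Ex P (fun w => Num.min (del * W w) 2) <= eps.
Proof.
move=> mW W0 eps0.
pose F (N : nat) : set Om := [set w | W w < N%:R].
have mF N : measurable (F N).
  have := mW measurableT `]-oo, N%:R[%classic (measurable_itv _).
  by rewrite setTI; congr measurable; apply/seteqP; split => w; rewrite /F /= in_itv.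
have UF : \bigcup_N F N = setT.
  apply/seteqP; split => // w _; exists (Num.truncn (W w)).+1 => //.
  by rewrite /F /= truncnS_gt.
have : P (F N) @[N --> \oo] --> (1 : R)%:E.
  rewrite -(@probability_setT _ _ _ P) -UF; apply: nondecreasing_cvg_mu => //.
    by rewrite UF.
  move=> m n mn; apply/subsetPset => w; rewrite /F /= => h.
  by apply: lt_le_trans h _; rewrite ler_nat.
move=> /fine_cvg /cvgr_ge /(_ (1 - eps / 4)).
have e1 : 1 - eps / 4 < 1 by lra.
move=> /(_ e1) [N _ /(_ N (leqnn N)) /= hN].
pose del := eps / (2 * N.+1%:R).
have N0 : (0 : R) < N.+1%:R by rewrite ltr0n.
have del0 : 0 < del by rewrite divr_gt0// mulr_gt0.
exists del => //.
have bf : bounded_rv (fun w => Num.min (del * W w) 2).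
  split.
    apply: measurable_minr; last exact: measurable_cst.
    by apply: measurable_funM; [exact: measurable_cst|exact: mW].
  exists 2 => w; rewrite ger0_norm ?ge_min ?lexx ?orbT//.
  by rewrite le_min mulr_ge0 ?(ltW del0)//=.
have bI : bounded_rv (fun w => (W w < N%:R)%R%:R : R).
  by apply: bounded_rv_indic; exact: mF.
have EI : Ex P (fun w => (W w < N%:R)%R%:R) = fine (P (F N)).
  by rewrite Ex_indic//; exact: mF.
apply: le_trans (_ : Ex P (fun w => (del * N%:R + 2) - 2 * (W w < N%:R)%R%:R) <= _).
  apply: ler_Ex => //.
    by apply: bounded_rvB; [exact: bounded_rv_cst|exact: bounded_rvZ].
  move=> w; have dN : 0 <= del * N%:R by rewrite mulr_ge0// ltW.
  have [wN|_] := ltP (W w) N%:R; rewrite ?mulr1 ?mulr0 ge_min.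
    by apply/orP; left; rewrite addrK ler_pM2l// ltW.
  by apply/orP; right; lra.
rewrite ExB; [|exact: bounded_rv_cst|exact: bounded_rvZ].
rewrite Ex_cst ExZ// EI.
have dE : del * N.+1%:R = eps / 2.
  by rewrite /del invfM mulrA divfK// gt_eqF.
have : del * N%:R <= del * N.+1%:R by rewrite ler_pM2l// ler_nat.
rewrite dE; lra.
Qed.

Lemma Ex_eq0_negligible (R : realType) (disp : measure_display)
    (Om : measurableType disp) (P : probability Om R) (g : Om -> R) :
  bounded_rv g -> (forall w, 0 <= g w) -> Ex P g = 0 ->
  P.-negligible [set w | g w != 0].
Proof.
move=> bg g0 Eg.
have mg : measurable_fun setT g by case: bg.
have m1 (m : nat) : measurable [set w | m.+1%:R^-1 <= g w].
  have := mg measurableT `[m.+1%:R^-1, +oo[%classic (measurable_itv _).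
  by rewrite setTI; congr measurable; apply/seteqP; split => w /=; rewrite in_itv/= andbT.
apply: (@negligibleS _ _ _ P (\bigcup_m [set w | m.+1%:R^-1 <= g w])).
  move=> w /= gw; have gw0 : 0 < g w by rewrite lt_neqAle eq_sym gw g0.
  exists (Num.truncn (g w)^-1) => //=.
  rewrite -[leRHS]invrK lef_pV2 ?posrE ?invr_gt0//; apply: ltW.
  exact: truncnS_gt.
apply: negligible_bigcup => m; apply/negligibleP => //.
have b1 : bounded_rv (fun w => (m.+1%:R^-1 <= g w)%R%:R : R).
  by apply: bounded_rv_indic; exact: m1.
have : Ex P (fun w => (m.+1%:R^-1 <= g w)%R%:R) <= Ex P (fun w => m.+1%:R * g w).
  apply: ler_Ex => //; first exact: bounded_rvZ.
  move=> w; case: (leP m.+1%:R^-1 (g w)) => [h|_]; last by rewrite mulr_ge0.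
  by rewrite -ler_pdivrMl ?ltr0n// mulr1.
rewrite ExZ// Eg mulr0 Ex_indic// /Pr => h.
have h0 : fine (P [set w | m.+1%:R^-1 <= g w]) = 0.
  by apply/le_anti; rewrite h fine_ge0.
by rewrite -(fineK (fin_num_measure P _ (m1 m))) h0.
Qed.

Section LimitLaw.
Context {R : realType} {d : nat}.
Variable nu : probability (borel_space R d) R.

Lemma measurable_continuous (f : 'rV[R]_d -> R) : continuous f ->
  measurable_fun [set: borel_space R d] (f : borel_space R d -> R).
Proof.
move=> /continuousP cf; apply: (measurability _ (RGenOpens.measurableE R)).
move=> _ [_ [x [y ->] <-]]; rewrite setTI; apply: sub_sigma_algebra.
exact/cf/interval_open.
Qed.

Lemma bounded_rv_continuous (f : 'rV[R]_d -> R) : continuous f ->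
  (exists M, forall z, `|f z| <= M) ->
  bounded_rv (f : borel_space R d -> R).
Proof. by move=> cf bf; split => //; exact: measurable_continuous. Qed.

Variable g : 'rV[R]_d -> R.
Hypothesis nu_density : has_density nu g.

Lemma density_hyperplane (t : 'rV[R]_d) (c : R) : t != 0 ->
  nu.-negligible [set z : borel_space R d | dotr t z = c].
Proof.
move=> t0.
have mH : measurable [set z : borel_space R d | dotr t z = c].
  have := measurable_continuous (@dotr_continuous R d t) measurableT (measurable_set1 c).
  by rewrite setTI.
apply/negligibleP => //; have [_ _ nuE] := nu_density.
apply: (eq_trans (nuE _ mH)).
apply: (lebesgue_int_hyperplane (c := c) t0) => z zc.
by rewrite indicE memNset ?mul0r//=; exact/eqP.
Qed.

Lemma bounded_rv_cos_dotr (t : 'rV[R]_d) :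
  bounded_rv ((fun z => cos (dotr t z)) : borel_space R d -> R).
Proof.
apply: bounded_rv_continuous; last by exists 1 => z; exact: cos_max.
by move=> z; apply: continuous_comp; [exact: dotr_continuous|exact: continuous_cos].
Qed.

Lemma bounded_rv_sin_dotr (t : 'rV[R]_d) :
  bounded_rv ((fun z => sin (dotr t z)) : borel_space R d -> R).
Proof.
apply: bounded_rv_continuous; last by exists 1 => z; exact: sin_max.
by move=> z; apply: continuous_comp; [exact: dotr_continuous|exact: continuous_sin].
Qed.

(** Modulus at least 1 forces exp(i t.z) to be almost surely constant, so that t.z lies almost
    surely in a translate of 2 pi Z. This is a countable union of hyperplanes, hence null, against
    total mass 1. *)
Lemma density_cf_lt1 (t : 'rV[R]_d) : t != 0 ->
  Ex nu (fun z => cos (dotr t z)) ^+ 2 + Ex nu (fun z => sin (dotr t z)) ^+ 2 < 1.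
Proof.
move=> t0.
have bc := bounded_rv_cos_dotr t; have bs := bounded_rv_sin_dotr t.
set c := Ex nu _; set s := Ex nu _; rewrite ltNge; apply/negP => ge1.
pose r := c ^+ 2 + s ^+ 2.
pose h (z : borel_space R d) : R := Num.sqrt r - (c * cos (dotr t z) + s * sin (dotr t z)).
have h0 z : 0 <= h z.
  rewrite subr_ge0; apply: le_trans (cauchy2 _ _ _ _) _.
  by rewrite cos2Dsin2 sqrtr1 mulr1.
have bh : bounded_rv h.
  apply: bounded_rvB; first exact: bounded_rv_cst.
  by apply: bounded_rvD; exact: bounded_rvZ.
have Eh : Ex nu h = Num.sqrt r - r.
  rewrite /h ExB; [|exact: bounded_rv_cst|by apply: bounded_rvD; exact: bounded_rvZ].
  rewrite Ex_cst ExD; [|exact: bounded_rvZ|exact: bounded_rvZ].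
  by rewrite !ExZ// -!expr2.
have r0 : 0 <= r by rewrite /r; lra.
have sq := sqr_sqrtr r0; have sq0 := sqrtr_ge0 r.
have Eh0 : 0 <= Num.sqrt r - r by rewrite -Eh; exact: Ex_ge0.
have r1 : r = 1.
  have r1' : 1 <= r by [].
  have : Num.sqrt r = 1 by nra.
  by move=> e; rewrite -sq e expr1n.
have Eh1 : Ex nu h = 0 by rewrite Eh r1 sqrtr1 subrr.
have neg := Ex_eq0_negligible bh h0 Eh1.
have negT : nu.-negligible [set: borel_space R d].
  have [[z0 hz0]|nz] := pselect (exists z, h z = 0); last first.
    apply: negligibleS neg => z _ /=; apply/eqP => hz; apply: nz; by exists z.
  (* The hyperplanes are enumerated through the code [n] of the integer; the default 0 only repeats
     one of them. *)
  pose F (n : nat) : set (borel_space R d) := [set z | dotr t z = dotr t z0 +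
    (odflt 0 (unpickle n : option int))%:~R * (pi *+ 2)].
  apply: (@negligibleS _ _ _ nu ([set z | h z != 0] `|` \bigcup_n F n)); last first.
    apply: negligibleU => //; apply: negligible_bigcup => n.
    exact: density_hyperplane.
  move=> z _; have [hz|hz] := eqVneq (h z) 0; [right|by left].
  have unit x : h x = 0 -> c * cos (dotr t x) + s * sin (dotr t x) = 1.
    by rewrite /h r1 sqrtr1 => /eqP; rewrite subr_eq0 => /eqP <-.
  have e1 := unit z hz; have e2 := unit z0 hz0.
  have : cos (dotr t z - dotr t z0) = 1.
    rewrite cosB; have q1 := cos2Dsin2 (dotr t z); have q2 := cos2Dsin2 (dotr t z0).
    have q3 : c ^+ 2 + s ^+ 2 = 1 by exact: r1.
    move: (cos (dotr t z)) (sin (dotr t z)) (cos (dotr t z0)) (sin (dotr t z0)) e1 e2 q1 q2.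
    move=> u v u' v' e1 e2 q1 q2.
    have sqz x y : x ^+ 2 + y ^+ 2 = 1 -> c * x + s * y = 1 -> x = c /\ y = s.
      move=> xy cxy; have h4 : (x - c) ^+ 2 + (y - s) ^+ 2 = 0.
        rewrite [LHS](_ : _ = (x ^+ 2 + y ^+ 2) + (c ^+ 2 + s ^+ 2) -
          2 * (c * x + s * y)); [rewrite xy q3 cxy; ring|ring].
      have := sqr_ge0 (x - c); have := sqr_ge0 (y - s) => h5 h6.
      have h7 : (x - c) ^+ 2 = 0 by lra.
      have h8 : (y - s) ^+ 2 = 0 by lra.
      move/eqP : h7; move/eqP : h8; rewrite !sqrf_eq0 !subr_eq0.
      by move=> /eqP -> /eqP ->.
    have [-> ->] := sqz u v q1 e1; have [-> ->] := sqz u' v' q2 e2.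
    by rewrite -!expr2.
  move=> /cos_eq1[k kE]; exists (pickle k) => //; rewrite /F /= pickleK /= -kE.
  by rewrite addrC subrK.
have : (1%E : \bar R) = 0%E :=
  eq_trans (esym (@probability_setT _ _ _ nu)) (measure_negligible measurableT negT).
by move=> /eqP; rewrite onee_eq0.
Qed.

End LimitLaw.

(** * Uniform gaps below modulus 1 *)

Section CharacteristicFunctionGap.
Context {R : realType} {d : nat} {disp : measure_display}
  {Om : measurableType disp}.
Variable P : probability Om R.

Definition vcf2 (W : Om -> 'rV[R]_d) (t : 'rV[R]_d) : R :=
  Ex P (fun w => cos (dotr t (W w))) ^+ 2 + Ex P (fun w => sin (dotr t (W w))) ^+ 2.

Lemma vcf2_lipschitz (W : Om -> 'rV[R]_d) (t0 t : 'rV[R]_d) (del : R) :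
  (forall h : 'rV[R]_d -> R, (exists M, forall z, `|h z| <= M) ->
     bounded_rv (fun w => h (W w))) ->
  0 <= del -> d%:R * `|t - t0| <= del ->
  vcf2 W t <= vcf2 W t0 + 4 * Ex P (fun w => Num.min (del * `|W w|) 2).
Proof.
move=> bW del0 tt.
have bm : bounded_rv (fun w => Num.min (del * `|W w|) 2).
  apply: (bW (fun z => Num.min (del * `|z|) 2)); exists 2 => z.
  by rewrite ger0_norm ?ge_min ?lexx ?orbT// le_min mulr_ge0// ler0n.
have key (f : R -> R) : (forall x y : R, `|f x - f y| <= `|x - y|) ->
    (forall x, `|f x| <= 1) ->
    Ex P (fun w => f (dotr t (W w))) ^+ 2 <= Ex P (fun w => f (dotr t0 (W w))) ^+ 2 +
      2 * Ex P (fun w => Num.min (del * `|W w|) 2).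
  move=> flip f1.
  have bf s : bounded_rv (fun w => f (dotr s (W w))).
    by apply: (bW (fun z => f (dotr s z))); exists 1 => z; exact: f1.
  have le1 s : `|Ex P (fun w => f (dotr s (W w)))| <= 1.
    apply: le_trans (ler_norm_Ex _ (bf s)) _; rewrite -[leRHS](Ex_cst P).
    by apply: ler_Ex => //; [exact: bounded_rv_norm|exact: bounded_rv_cst].
  have : `|Ex P (fun w => f (dotr t (W w))) - Ex P (fun w => f (dotr t0 (W w)))| <=
      Ex P (fun w => Num.min (del * `|W w|) 2).
    rewrite -ExB//; apply: le_trans (ler_norm_Ex _ _) _; first exact: bounded_rvB.
    apply: ler_Ex => //; first by apply: bounded_rv_norm; exact: bounded_rvB.
    move=> w; rewrite le_min; apply/andP; split.
      apply: le_trans (flip _ _) _; rewrite -dotrB.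
      by apply: le_trans (dotr_le _ _) _; exact: ler_wpM2r.
    by apply: le_trans (ler_normB _ _) _; have := f1 (dotr t (W w));
      have := f1 (dotr t0 (W w)); lra.
  have := le1 t; have := le1 t0; rewrite !ler_norml.
  set u := Ex P _; set v := Ex P _; set e := Ex P _.
  by move=> /andP[? ?] /andP[? ?] /andP[? ?]; nra.
have h1 := key _ (@cos_lipschitz R) (@cos_max R).
have h2 := key _ (@sin_lipschitz R) (@sin_max R).
rewrite /vcf2; lra.
Qed.

Variable X : nat -> Om -> 'rV[int]_d.
Hypothesis X_iid : iid P X.
Hypothesis X_aperiodic : aperiodic P (X 0%N).

Let mX j : discrete_rv (X j). Proof. by have [mX _ _] := X_iid; exact: mX. Qed.

(** The strict inequality of [cf2_lt1] at [t0] persists on a neighbourhood by [vcf2_lipschitz], and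
    compactness extracts one gap. The index [m] runs in a filter, as the compactness principle
    requires. *)
Lemma compact_gap (K : set 'rV[R]_d) : compact K ->
  (forall t, K t -> t != 0 /\ forall i, `|t 0 i| <= pi) ->
  exists m : nat, forall t, K t -> cf2 P X t <= 1 - m.+1%:R^-1.
Proof.
move=> cK hK.
pose W w : 'rV[R]_d := \row_i (X 0%N w 0 i)%:~R.
have WE t w : dotr t (W w) = dotz t (X 0%N w).
  by rewrite /dotr /dotz; apply: eq_bigr => i _; rewrite mxE.
have cfE t : cf2 P X t = vcf2 W t.
  by rewrite /cf2 /vcf2; congr (Ex P _ ^+ 2 + Ex P _ ^+ 2); apply/funext => w; rewrite WE.
have bW (h : 'rV[R]_d -> R) : (exists M, forall z, `|h z| <= M) ->
    bounded_rv (fun w => h (W w)).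
  move=> [M hM]; apply: (bounded_rv_step X_iid (h := fun z : 'rV[int]_d => h (\row_i (z 0 i)%:~R))).
  by exists M.
have /compact_near_coveringP near := cK.
have := near nat \oo (fun (m : nat) t => cf2 P X t <= 1 - m.+1%:R^-1) _.
move=> /(_ _) H.
have {}H : \forall m \near \oo, K `<=` [set t | cf2 P X t <= 1 - m.+1%:R^-1].
  apply: H => t0 Kt0.
  have [t00 t0pi] := hK _ Kt0.
  have lt1 : cf2 P X t0 < 1 by exact: cf2_lt1.
  (* Of the gap 8 eta at [t0], moving [t] consumes 4 eta. *)
  pose eta := (1 - cf2 P X t0) / 8.
  have eta0 : 0 < eta by rewrite divr_gt0// subr_gt0.
  have mW : measurable_fun setT (fun w => `|W w|).
    move=> _ B mB; rewrite setTI.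
    exact: (mX 0 [set z : 'rV[int]_d | B `|(\row_i (z 0 i)%:~R) : 'rV[R]_d|]).
  have [//|del del0 hdel] := small_truncated_mean P mW _ eta0.
  have near_t : \forall t \near t0, d%:R * `|t - t0| <= del.
    have : \forall t \near t0, `|t0 - t| <= del / (d%:R + 1).
      apply: (@cvgr_dist_le _ _ _ (nbhs t0) (nbhs_filter t0) id t0); first exact: cvg_id.
      by rewrite divr_gt0// ltr_wpDl.
    apply: filterS => t; rewrite distrC ler_pdivlMr ?ltr_wpDl// mulrC.
    by apply: le_trans; rewrite ler_wpM2r// lerDl.
  have near_m : \forall m \near \oo, (m.+1%:R^-1 : R) <= eta.
    exists (Num.truncn eta^-1) => // m /= hm.
    rewrite -[leRHS]invrK lef_pV2 ?posrE ?invr_gt0//; apply: ltW.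
    by apply: lt_le_trans (truncnS_gt _) _; rewrite ler_nat.
  exists (([set t | d%:R * `|t - t0| <= del]), [set m : nat | (m.+1%:R^-1 : R) <= eta]) => //.
  move=> [t m] /= [ht hm]; rewrite cfE.
  apply: le_trans (vcf2_lipschitz bW (ltW del0) ht) _.
  rewrite -cfE; have qq : cf2 P X t0 = 1 - 8 * eta by rewrite /eta; field.
  apply: le_trans (lerD (_ : _ <= 1 - 8 * eta) (ler_wpM2l _ hdel)) _ => //.
    by rewrite -qq.
  by move: hm eta0; set x : R := _^-1; lra.
have [N _ hN] := H; exists N => t Kt; exact: (hN N (leqnn N) t Kt).
Qed.

Variables (alpha : 'I_d -> R) (a : 'I_d -> nat -> R).
Variable nu : probability (borel_space R d) R.
Variable g : 'rV[R]_d -> R.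
Hypothesis nu_density : has_density nu g.
Hypothesis X_cvg : cvg_in_law P (normalized_walk P X alpha a) nu.

Let Y n w := normalized_walk P X alpha a n w.

Lemma bounded_rv_normalized n (h : 'rV[R]_d -> R) :
  (exists M, forall z, `|h z| <= M) -> bounded_rv (fun w => h (Y n w)).
Proof.
move=> [M hM]; apply: (bounded_rv_walk X_iid n
  (h := fun z => h (\row_i (((z 0 i)%:~R - drift P X alpha a i n) / a i n)))).
by exists M.
Qed.

Lemma Ex_cvg_in_law (f : 'rV[R]_d -> R) : continuous f ->
  (exists M, forall z, `|f z| <= M) ->
  Ex P (fun w => f (Y n w)) @[n --> \oo] --> Ex nu (f : borel_space R d -> R).
Proof.
move=> cf bf; have := X_cvg cf bf.
have fin : (\int[nu]_z (f z)%:E)%E \is a fin_num.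
  apply: integrable_fin_num => //.
  exact: bounded_rv_integrable (bounded_rv_continuous cf bf).
rewrite -(fineK fin) => /fine_cvg; apply: cvg_trans.
by apply: near_eq_cvg; apply: nearW => n /=; rewrite Ex_expectation.
Qed.

(** Tightness in the form used by [vcf2_lipschitz]. The test function is bounded and continuous, so
    its mean converges to the one under [nu], which is small for small [del]. *)
Lemma tightness (eps : R) : 0 < eps -> exists2 del : R, 0 < del &
  exists J : nat, forall j, (J <= j)%N ->
    Ex P (fun w => Num.min (del * `|Y j w|) 2) <= eps.
Proof.
move=> eps0.
have cn : continuous (fun z : 'rV[R]_d => `|z|) by exact: norm_continuous.
have e2 : 0 < eps / 2 by rewrite divr_gt0.
have [//|del del0 hdel] := small_truncated_mean nu (measurable_continuous cn) _ e2.
exists del => //.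
have cm : continuous (fun z : 'rV[R]_d => Num.min (del * `|z|) 2).
  move=> z; apply/(@cvgrPdist_le _ _ _ _ (nbhs_filter z)) => e e0.
  near=> y.
  have zy : `|z - y| <= e / del.
    by near: y; apply: cvgr_dist_le; [exact: cvg_id|exact: divr_gt0].
  have : del * `| `|z| - `|y| | <= e.
    rewrite -ler_pdivlMl// mulrC; apply: le_trans zy; exact: ler_dist_dist.
  rewrite -(gtr0_norm del0) -normrM mulrBr (gtr0_norm del0).
  move: (del * `|z|) (del * `|y|) => u v; rewrite !ler_norml => /andP[? ?].
  by rewrite /Num.min; case: ifPn; case: ifPn; rewrite -?leNgt; lra.
have bm : exists M, forall z : 'rV[R]_d, `|Num.min (del * `|z|) 2 : R| <= M.
  exists 2 => z; rewrite ger0_norm ?ge_min ?lexx ?orbT// le_min.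
  by rewrite mulr_ge0// ltW.
have lt : Ex nu (fun z : borel_space R d => Num.min (del * `|z : 'rV[R]_d|) 2) < eps.
  by apply: le_lt_trans hdel _; rewrite ltr_pdivrMr// ltr_pMr// ltr1n.
have [J _ hJ] := cvgr_le _ (Ex_cvg_in_law cm bm) _ lt.
by exists J => j Jj; exact: hJ.
Unshelve. all: by end_near. Qed.

Definition scaled_freq (t : 'rV[R]_d) (j : nat) : 'rV[R]_d :=
  \row_i (t 0 i / a i j).

(** The centering contributes only a phase, which the squared modulus does not see. *)
Lemma cf2_scaled t j : cf2 P X (scaled_freq t j) ^+ j = vcf2 (Y j) t.
Proof.
rewrite /cf2 -(charfun_walk X_iid j (dotz0 _) (dotzD _)) /vcf2.
pose b := \sum_i t 0 i * (drift P X alpha a i j / a i j).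
have dE w : dotr t (Y j w) = dotz (scaled_freq t j) (walk X j w) - b.
  rewrite /dotr /dotz /b -sumrB; apply: eq_bigr => i _; rewrite !mxE.
  by rewrite mulrBl mulrBr mulrAC mulrA.
have bc := bounded_cos X_iid (scaled_freq t j) j.
have bs := bounded_sin X_iid (scaled_freq t j) j.
set c := Ex P (fun w => cos (dotz _ _)); set s := Ex P (fun w => sin (dotz _ _)).
have -> : Ex P (fun w => cos (dotr t (Y j w))) = cos b * c + sin b * s.
  rewrite -!ExZ// -ExD; [|exact: bounded_rvZ|exact: bounded_rvZ].
  by congr Ex; apply/funext => w; rewrite dE cosB; ring.
have -> : Ex P (fun w => sin (dotr t (Y j w))) = cos b * s - sin b * c.
  rewrite -!ExZ// -ExB; [|exact: bounded_rvZ|exact: bounded_rvZ].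
  by congr Ex; apply/funext => w; rewrite dE sinB; ring.
have := cos2Dsin2 b; set u := cos b; set v := sin b => uv.
rewrite [RHS](_ : _ = (u ^+ 2 + v ^+ 2) * (c ^+ 2 + s ^+ 2)); first by rewrite uv mul1r.
by ring.
Qed.

(** Convergence in law gives the limit at each frequency, the density makes its modulus smaller than
    1, and tightness makes the estimate uniform in [t] near that frequency for all large [j]. The
    same [J] serves as threshold and as size of the gap. *)
Lemma uniform_gap (K : set 'rV[R]_d) : compact K -> (forall t, K t -> t != 0) ->
  exists J : nat, forall j t, (J <= j)%N -> K t ->
    cf2 P X (scaled_freq t j) ^+ j <= 1 - J.+1%:R^-1.
Proof.
move=> cK hK.
have /compact_near_coveringP near := cK.
have H := near nat \oo (fun (m : nat) t => forall j, (m <= j)%N ->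
  cf2 P X (scaled_freq t j) ^+ j <= 1 - m.+1%:R^-1) _.
have {}H : \forall m \near \oo, K `<=` [set t | forall j, (m <= j)%N ->
  cf2 P X (scaled_freq t j) ^+ j <= 1 - m.+1%:R^-1].
  apply: H => t0 Kt0.
  pose q := Ex nu (fun z => cos (dotr t0 z)) ^+ 2 + Ex nu (fun z => sin (dotr t0 z)) ^+ 2.
  have lt1 : q < 1 by apply: (density_cf_lt1 nu_density); exact: hK.
  (* Of the gap 8 eta, convergence at [t0] consumes eta and moving [t] consumes 4 eta; what is kept,
     1/(m+1), is at most eta. *)
  pose eta := (1 - q) / 8.
  have eta0 : 0 < eta by rewrite divr_gt0// subr_gt0.
  have [del del0 [J1 hJ1]] := tightness eta0.
  have qcvg : vcf2 (Y j) t0 @[j --> \oo] --> q.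
    apply: cvgD.
      rewrite expr2; under eq_fun do rewrite expr2.
      apply: cvgM; apply: (Ex_cvg_in_law (f := fun z => cos (dotr t0 z))).
      - by move=> z; apply: continuous_comp; [exact: dotr_continuous|exact: continuous_cos].
      - by exists 1 => z; exact: cos_max.
      - by move=> z; apply: continuous_comp; [exact: dotr_continuous|exact: continuous_cos].
      - by exists 1 => z; exact: cos_max.
    rewrite expr2; under eq_fun do rewrite expr2.
    apply: cvgM; apply: (Ex_cvg_in_law (f := fun z => sin (dotr t0 z))).
    - by move=> z; apply: continuous_comp; [exact: dotr_continuous|exact: continuous_sin].
    - by exists 1 => z; exact: sin_max.
    - by move=> z; apply: continuous_comp; [exact: dotr_continuous|exact: continuous_sin].
    - by exists 1 => z; exact: sin_max.
  have qe : q < q + eta by lra.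
  have [J2 _ hJ2] := cvgr_le _ qcvg _ qe.
  have near_t : \forall t \near t0, d%:R * `|t - t0| <= del.
    have : \forall t \near t0, `|t0 - t| <= del / (d%:R + 1).
      apply: (@cvgr_dist_le _ _ _ (nbhs t0) (nbhs_filter t0) id t0); first exact: cvg_id.
      by rewrite divr_gt0// ltr_wpDl.
    apply: filterS => t; rewrite distrC ler_pdivlMr ?ltr_wpDl// mulrC.
    by apply: le_trans; rewrite ler_wpM2r// lerDl.
  have near_m : \forall m \near \oo, (m.+1%:R^-1 : R) <= eta /\ (maxn J1 J2 <= m)%N.
    exists (maxn (maxn J1 J2) (Num.truncn eta^-1)) => // m /=.
    rewrite geq_max => /andP[hJ hm]; split => //.
    rewrite -[leRHS]invrK lef_pV2 ?posrE ?invr_gt0//; apply: ltW.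
    by apply: lt_le_trans (truncnS_gt _) _; rewrite ler_nat.
  exists (([set t | d%:R * `|t - t0| <= del]),
    [set m : nat | (m.+1%:R^-1 : R) <= eta /\ (maxn J1 J2 <= m)%N]) => //.
  move=> [t m] /= [ht [hm]]; rewrite geq_max => /andP[m1 m2] j mj.
  rewrite cf2_scaled.
  apply: le_trans (vcf2_lipschitz (@bounded_rv_normalized j) (ltW del0) ht) _.
  have h1 := hJ1 j (leq_trans m1 mj); have h2 := hJ2 j (leq_trans m2 mj).
  rewrite /= in h2; have qE : q = 1 - 8 * eta by rewrite /eta; field.
  apply: le_trans (lerD h2 (ler_wpM2l _ h1)) _ => //.
  by move: hm eta0; rewrite qE; set x : R := _^-1; lra.
have [N _ hN] := H; exists N => j t Nj Kt; exact: (hN N (leqnn N) t Kt).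
Qed.

Variables (an : nat -> R) (kap : 'I_d -> R).
Hypothesis d_gt0 : (0 < d)%N.
Hypothesis kap_gt0 : forall i, 0 < kap i.
Hypothesis a_kap : forall i n, (0 < n)%N -> a i n = kap i * an n.
Hypothesis a_gt0 : forall i n, (0 < n)%N -> 0 < a i n.

(** If [an n < B] for a large [n], tightness would keep the centered walk in a fixed box with
    probability at least 1/2, while each of the finitely many points of the box has probability at
    most 1/4 divided by their number. *)
Lemma an_unbounded (B : R) : exists N : nat, forall n, (N <= n)%N -> B <= an n.
Proof.
have [del del0 [J hJ]] := tightness (ltac:(lra) : 0 < 1 / 2 :> R).
pose kmax := \sum_i kap i.
have kle i : kap i <= kmax.
  by rewrite /kmax (bigD1 i)//= lerDl sumr_ge0// => j _; exact: ltW.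
pose K := (Num.truncn (kmax * `|B| / del + 1)).+1.
pose eps : R := (4 * (size (box d K))%:R)^-1.
have sz : (0 < size (box d K))%N by rewrite size_box expn_gt0.
have eps0 : 0 < eps by rewrite invr_gt0 mulr_gt0// ltr0n.
have [n0 hn0] := Pr_walk_vanishes X_iid X_aperiodic d_gt0 eps0.
exists (maxn 1 (maxn J n0)) => n; rewrite !geq_max => /and3P[n1 Jn nn0].
rewrite leNgt; apply/negP => anB.
have an0 : 0 < an n.
  by have := a_gt0 (Ordinal d_gt0) n1; rewrite a_kap// pmulr_rgt0.
pose fl : 'rV[int]_d := \row_i Num.floor (drift P X alpha a i n).
have bI : bounded_rv (fun w => (walk X n w - fl \in box d K)%:R : R).
  apply: (bounded_rv_walk X_iid n (h := fun z => (z - fl \in box d K)%:R)).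
  by exists 1 => z; rewrite normr_nat; case: (_ \in _).
have bm : bounded_rv (fun w => Num.min (del * `|Y n w|) 2).
  apply: (bounded_rv_normalized n (h := fun z => Num.min (del * `|z|) 2)); exists 2 => z.
  rewrite ger0_norm ?ge_min ?lexx ?orbT// le_min.
  by rewrite mulr_ge0// ltW.
have inside : 1 - 1 / 2 <= Ex P (fun w => (walk X n w - fl \in box d K)%:R).
  apply: le_trans (_ : 1 - Ex P (fun w => Num.min (del * `|Y n w|) 2) <= _).
    by rewrite lerD2l lerN2; exact: hJ.
  rewrite -[X in X - _](Ex_cst P) -ExB//; last exact: bounded_rv_cst.
  apply: ler_Ex => //; first by apply: bounded_rvB => //; exact: bounded_rv_cst.
  move=> w.
  have m0 : 0 <= Num.min (del * `|Y n w|) 2 by rewrite le_min mulr_ge0// ltW.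
  have [_|/negP nin] := boolP (_ \in _); first by rewrite lerBlDr lerDl.
  rewrite subr_le0 le_min ler1n andbT leNgt; apply/negP => small.
  apply: nin; rewrite mem_box; apply/forallP => i.
  have h1 : `|Y n w 0 i| <= del^-1.
    apply: le_trans (coord_le_norm _ _) _.
    by rewrite -[leRHS]mulr1 ler_pdivlMl// ltW.
  rewrite /Y /normalized_walk mxE normrM normfV (gtr0_norm (a_gt0 i n1)) in h1.
  rewrite ler_pdivrMr ?a_gt0// a_kap// in h1.
  have h2 : del^-1 * (kap i * an n) <= kmax * `|B| / del.
    rewrite mulrC ler_pM2r ?invr_gt0//; apply: ler_pM => //; first exact: ltW.
      exact: ltW.
    by apply: le_trans (ltW anB) (ler_norm _).
  have h3 : `|(walk X n w 0 i)%:~R - (Num.floor (drift P X alpha a i n))%:~R : R| <=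
     kmax * `|B| / del + 1.
    have f1 := ge_floor (drift P X alpha a i n).
    have f2 := floorD1_gt (drift P X alpha a i n).
    rewrite intrD in f2; move: h1; rewrite !ler_norml => /andP[g1 g2].
    by apply/andP; split; lra.
  rewrite !mxE -(ler_int R) intr_norm intrD intrN.
  apply: le_trans h3 _; apply: ltW; exact: truncnS_gt.
have outside : Ex P (fun w => (walk X n w - fl \in box d K)%:R) <= 1 / 4.
  apply: le_trans (_ : Ex P (fun w => \sum_(z <- box d K) (walk X n w == z + fl)%:R) <= _).
    apply: ler_Ex => //.
      apply: bounded_rv_sum => z.
      apply: (bounded_rv_walk X_iid n (h := fun u => (u == z + fl)%:R)).
      by exists 1 => u; rewrite normr_nat; case: (_ == _).
    move=> w; have [h|_] := boolP (_ \in _); last by rewrite sumr_ge0.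
    rewrite (bigD1_seq (walk X n w - fl)) ?box_uniq//= subrK eqxx lerDl.
    by rewrite sumr_ge0.
  rewrite Ex_sum; last first.
    move=> z; apply: (bounded_rv_walk X_iid n (h := fun u => (u == z + fl)%:R)).
    by exists 1 => u; rewrite normr_nat; case: (_ == _).
  apply: le_trans (_ : \sum_(z <- box d K) eps <= _).
    by apply: ler_sum => z _; rewrite Pr_walk_Ex//; exact: hn0.
  have -> : \sum_(z <- box d K) eps = (size (box d K))%:R * eps.
    by rewrite big_const_seq count_predT iter_addr_0 -[LHS]mulr_natl.
  have s0 : (size (box d K))%:R != 0 :> R by rewrite pnatr_eq0 -lt0n.
  by rewrite le_eqVlt; apply/orP; left; apply/eqP; rewrite /eps; field.
lra.
Qed.

End CharacteristicFunctionGap.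

(** * Elementary inequalities *)

Section Elementary.
Context {R : realType}.

Lemma finite_lower_bound (f : nat -> R) (N : nat) :
  (forall j, (0 < j)%N -> 0 < f j) ->
  exists2 m : R, 0 < m & forall j, (0 < j <= N)%N -> m <= f j.
Proof.
move=> f0; elim: N => [|N [m m0 hm]].
  by exists 1 => // j /andP[j0]; rewrite leqn0 => /eqP j0'; rewrite j0' in j0.
exists (Num.min m (f N.+1)); first by rewrite lt_min m0 f0.
move=> j /andP[j0]; rewrite leq_eqVlt => /orP[/eqP ->|jN].
  by rewrite ge_min lexx orbT.
by rewrite ge_min hm// j0.
Qed.

Lemma finite_upper_bound (f : nat -> R) (N : nat) :
  exists2 M : R, 0 < M & forall j, (j <= N)%N -> f j <= M.
Proof.
exists (1 + \sum_(j < N.+1) `|f j|); first by rewrite ltr_wpDr// sumr_ge0.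
move=> j jN; apply: le_trans (ler_norm _) _.
have jN' : (j < N.+1)%N by [].
rewrite (bigD1 (Ordinal jN'))//= addrCA lerDl addr_ge0//.
by rewrite sumr_ge0.
Qed.

Lemma powR_le_expR (p c : R) : 0 < c -> 0 <= p ->
  exists2 C : R, 0 < C & forall x, 1 <= x -> x `^ p <= C * expR (c * x).
Proof.
move=> c0; rewrite le_eqVlt => /orP[/eqP <-|p0].
  exists 1 => // x x1; rewrite powRr0 mul1r -[leLHS]expR0 ler_expR.
  by rewrite mulr_ge0 ?ltW//; lra.
exists (expR (p * ln (p / c))); first exact: expR_gt0.
move=> x x1; have x0 : 0 < x by lra.
rewrite /powR gt_eqF// -expRD ler_expR.
have y0 : 0 < c * x / p by rewrite divr_gt0// mulr_gt0.
have : ln (c * x / p) <= c * x / p.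
  apply: le_trans (_ : c * x / p - 1 <= _); last by rewrite lerBlDr lerDl.
  have := expR_ge1Dx (ln (c * x / p)); rewrite lnK ?posrE//; lra.
have -> : c * x / p = x / (p / c).
  by field; rewrite ?gt_eqF//; apply/andP; split; rewrite gt_eqF.
have -> : ln (x / (p / c)) = ln x - ln (p / c).
  by rewrite (@ln_div _ x (p / c)) ?posrE// divr_gt0.
move=> h.
have : p * (ln x - ln (p / c)) <= p * (x / (p / c)) by rewrite ler_pM2l.
have -> : p * (x / (p / c)) = c * x.
  by rewrite invf_div mulrCA [p * _]mulrCA divff ?gt_eqF// mulr1 mulrC.
lra.
Qed.

Lemma inverse_square_sum (c : R) (k M : nat) : 0 < c ->
  \sum_(l < M) ((1 + c * `|k%:R - l%:R|)^-1) ^+ 2 <= 2 * (1 + c) / c.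
Proof.
move=> c0.
(* A bounded function with derivative (1 + c) / (1 + c |x|)^2. The factor 1 + c makes each increment
   over a unit interval dominate the corresponding term, and the increments telescope. *)
pose Phi (x : R) := (1 + c) * x / (1 + c * `|x|).
have den (x : R) : 0 < 1 + c * `|x|.
  by apply: ltr_pwDl => //; apply: mulr_ge0 => //; exact: ltW.
have Phi_le (x : R) : `|Phi x| <= (1 + c) / c.
  rewrite /Phi normrM normrV ?unitfE ?gt_eqF// (gtr0_norm (den x)) normrM.
  rewrite (gtr0_norm (_ : 0 < 1 + c)); last by lra.
  rewrite ler_pdivrMr// mulrAC ler_pdivlMr// -mulrA ler_wpM2l//; first by lra.
  by rewrite mulrC lerDr.
have step (l : nat) : ((1 + c * `|k%:R - l%:R|)^-1) ^+ 2 <=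
    Phi (l.+1%:R - k%:R) - Phi (l%:R - k%:R).
  have [kl|lk] := leqP k l.
    rewrite -(subnK kl) -natr1 natrD; set m := (l - k)%N.
    have m0 := ler0n R m.
    have m10 : 0 <= m%:R + 1 :> R by lra.
    have -> : k%:R - (m%:R + k%:R) = - m%:R :> R by ring.
    have -> : m%:R + k%:R + 1 - k%:R = m%:R + 1 :> R by ring.
    have -> : m%:R + k%:R - k%:R = m%:R :> R by ring.
    rewrite /Phi normrN (ger0_norm m0) (ger0_norm m10).
    have d1 : 0 < 1 + c * m%:R by rewrite -(ger0_norm m0).
    have d2 : 0 < 1 + c * (m%:R + 1) by nra.
    have -> : (1 + c) * (m%:R + 1) / (1 + c * (m%:R + 1)) -
       (1 + c) * m%:R / (1 + c * m%:R) =
       ((1 + c) * (1 + c * m%:R) / (1 + c * (m%:R + 1))) * ((1 + c * m%:R)^-1) ^+ 2.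
      by field; rewrite ?gt_eqF//; apply/andP; split; rewrite gt_eqF.
    rewrite ler_pMl ?exprn_gt0 ?invr_gt0// ler_pdivlMr// mul1r.
    by nra.
  rewrite -(subnK lk) natrD -natr1; set m := (k - l.+1)%N.
  have m0 := ler0n R m.
  have m10 : 0 <= m%:R + 1 :> R by lra.
  have -> : m%:R + (l%:R + 1) - l%:R = m%:R + 1 :> R by ring.
  have -> : l%:R + 1 - (m%:R + (l%:R + 1)) = - m%:R :> R by ring.
  have -> : l%:R - (m%:R + (l%:R + 1)) = - (m%:R + 1) :> R by ring.
  rewrite /Phi !normrN (ger0_norm m0) (ger0_norm m10).
  have d1 : 0 < 1 + c * m%:R by rewrite -(ger0_norm m0).
  have d2 : 0 < 1 + c * (m%:R + 1) by nra.
  have -> : (1 + c) * - m%:R / (1 + c * m%:R) -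
     (1 + c) * - (m%:R + 1) / (1 + c * (m%:R + 1)) =
     ((1 + c) * (1 + c * (m%:R + 1)) / (1 + c * m%:R)) *
     ((1 + c * (m%:R + 1))^-1) ^+ 2.
    by field; rewrite ?gt_eqF//; apply/andP; split; rewrite gt_eqF.
  rewrite ler_pMl ?exprn_gt0 ?invr_gt0// ler_pdivlMr// mul1r.
  by nra.
have tel : \sum_(l < M) (Phi (l.+1%:R - k%:R) - Phi (l%:R - k%:R)) =
    Phi (M%:R - k%:R) - Phi (0%:R - k%:R).
  elim: M => [|M IH]; first by rewrite big_ord0 subrr.
  by rewrite big_ord_recr /= IH; ring.
apply: (@le_trans _ _ (\sum_(l < M) (Phi (l.+1%:R - k%:R) - Phi (l%:R - k%:R)))).
  by apply: ler_sum => l _; exact: step.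
rewrite tel.
apply: le_trans (ler_norm _) _; apply: le_trans (ler_normB _ _) _.
have := Phi_le (M%:R - k%:R); have := Phi_le (0%:R - k%:R).
by rewrite -mulrA; lra.
Qed.

End Elementary.

(** * The local bound *)

Section LocalBound.
Context {R : realType} {d : nat} {disp : measure_display}
  {Om : measurableType disp}.
Variable P : probability Om R.
Variable X : nat -> Om -> 'rV[int]_d.
Hypothesis X_iid : iid P X.
Hypothesis X_aperiodic : aperiodic P (X 0%N).
Variables (alpha : 'I_d -> R) (a : 'I_d -> nat -> R).
Variable nu : probability (borel_space R d) R.
Variable g : 'rV[R]_d -> R.
Hypothesis nu_density : has_density nu g.
Hypothesis X_cvg : cvg_in_law P (normalized_walk P X alpha a) nu.
Variables (an : nat -> R) (kap : 'I_d -> R).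
Hypothesis d_gt0 : (0 < d)%N.
Hypothesis kap_gt0 : forall i, 0 < kap i.
Hypothesis a_kap : forall i n, (0 < n)%N -> a i n = kap i * an n.
Hypothesis an_gt0 : forall n, (0 < n)%N -> 0 < an n.
Variables (C1 s : R).
Hypothesis C1_ge1 : 1 <= C1.
Hypothesis s_gt0 : 0 < s.
Hypothesis an_ratio : forall k n, (0 < k)%N -> (k <= n)%N ->
  an n <= C1 * (n%:R / k%:R) `^ s * an k.

Lemma compact_annulus (r1 r2 : R) : compact [set t : 'rV[R]_d | r1 <= `|t| <= r2].
Proof.
apply: bounded_closed_compact.
  exists r2; split; first exact: num_real.
  by move=> x /ltW r2x t /= /andP[_ tr2]; exact: le_trans r2x.
have -> : [set t : 'rV[R]_d | r1 <= `|t| <= r2] =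
   (fun t : 'rV[R]_d => `|t|) @^-1` [set x : R | r1 <= x] `&`
   (fun t : 'rV[R]_d => `|t|) @^-1` [set x : R | x <= r2].
  by apply/seteqP; split => t /=; [move=> /andP[]|move=> [-> ->]].
apply: closedI; apply: closed_comp => //.
- by move=> t _; exact: norm_continuous.
- by move=> t _; exact: norm_continuous.
Qed.

(** Let j be the least index with |t| a_j >= 1. If j is large, minimality and the ratio bound keep t
    a_j in a fixed annulus, where [uniform_gap] bounds the j-th power of [cf2]; the gap 1 - [cf2] is
    then at least c/j >= c/k. If j is small, [t] stays away from 0 and aperiodicity applies. *)
Lemma cf2_gap : exists2 c : R, 0 < c & forall k (t : 'rV[R]_d), (0 < k)%N ->
  `|t| <= pi -> 1 <= `|t| * an k -> cf2 P X t <= 1 - c / k%:R.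
Proof.
pose B := C1 * 2 `^ s.
have B0 : 0 < B by rewrite mulr_gt0 ?powR_gt0//; have := C1_ge1; lra.
have [kmin kmin0 hkmin] : exists2 m : R, 0 < m & forall i, m <= kap i.
  (* Coordinate [i] is read at index [i.+1], because [finite_lower_bound] runs over positive
     indices; outside the range the value 1 keeps [f] positive. *)
  pose f (j : nat) := if insub j.-1 is Some i then kap i else 1.
  have [|m m0 hm] := @finite_lower_bound R f d.
    by move=> j _; rewrite /f; case: insub.
  exists m => // i; have := hm i.+1; rewrite /f /= valK; apply.
  exact: ltn_ord.
pose kmax := \sum_i kap i.
have kle i : kap i <= kmax.
  by rewrite /kmax (bigD1 i)//= lerDl sumr_ge0// => j _; exact: ltW.
have [J0 hJ0] : exists J : nat, forall j t, (J <= j)%N ->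
    [set t : 'rV[R]_d | kmin <= `|t| <= kmax * B] t ->
    cf2 P X (scaled_freq a t j) ^+ j <= 1 - J.+1%:R^-1.
  apply: (uniform_gap X_iid nu_density X_cvg); first exact: compact_annulus.
  move=> t /= /andP[kt _]; apply/eqP => t0; move: kt; rewrite t0 normr0; lra.
pose J := maxn 1 J0.
have [amax amax0 hamax] := finite_upper_bound an J.
have [m hm] : exists m : nat, forall t,
    [set t : 'rV[R]_d | amax^-1 <= `|t| <= pi] t -> cf2 P X t <= 1 - m.+1%:R^-1.
  apply: (compact_gap X_iid X_aperiodic); first exact: compact_annulus.
  move=> t /= /andP[kt tpi]; split.
    have : 0 < amax^-1 by rewrite invr_gt0.
    by apply: contraTN => /eqP t0; move: kt; rewrite t0 normr0 leNgt.
  by move=> i; apply: le_trans (coord_le_norm _ _) tpi.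
pose c := Num.min (J0.+1%:R^-1) (m.+1%:R^-1 : R).
have c0 : 0 < c by rewrite lt_min !invr_gt0 !ltr0n.
have cJ : c <= J0.+1%:R^-1 by rewrite ge_min lexx.
have cm : c <= m.+1%:R^-1 by rewrite ge_min lexx orbT.
exists c => // k t k0 tpi tk.
have exj : exists j, (0 < j)%N && (1 <= `|t| * an j) by exists k; rewrite k0.
case: (ex_minnP exj) => j /andP[j0 tj] minj.
have jk : (j <= k)%N by apply: minj; rewrite k0.
have k0' : (0 : R) < k%:R by rewrite ltr0n.
have j0' : (0 : R) < j%:R by rewrite ltr0n.
have ck : c / k%:R <= c / j%:R.
  by rewrite ler_pM2l// lef_pV2 ?posrE// ler_nat.
have [jJ|Jj] := leqP j J.
  apply: le_trans (hm t _) _.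
    rewrite /= tpi andbT.
    apply: le_trans (_ : (an j)^-1 <= _).
      by rewrite lef_pV2 ?posrE ?an_gt0// hamax.
    by rewrite -[leLHS]mul1r ler_pdivrMr ?an_gt0.
  rewrite lerD2l lerN2; apply: le_trans ck _.
  apply: le_trans cm; rewrite ler_pdivrMr// ler_peMr ?ler1n//; exact: ltW.
have j2 : (1 < j)%N by apply: leq_ltn_trans Jj; exact: leq_maxl.
have tj1 : `|t| * an j.-1 < 1.
  rewrite ltNge; apply/negP => h; have := minj j.-1.
  rewrite h andbT -ltnS prednK// j2 => /(_ isT).
  by rewrite leqNgt ltn_predL j0.
have ajB : an j <= B * an j.-1.
  apply: le_trans (an_ratio (_ : (0 < j.-1)%N) (leq_pred j)) _.
    by rewrite -ltnS prednK.
  apply: ler_wpM2r; first by apply: ltW; apply: an_gt0; rewrite -ltnS prednK.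
  rewrite /B ler_pM2l; last by have := C1_ge1; lra.
  apply: ge0_ler_powR; rewrite ?nnegrE ?divr_ge0//; first exact: ltW.
  have jp0 : (0 < j.-1)%N by rewrite -ltnS prednK.
  rewrite ler_pdivrMr ?ltr0n// -natrM ler_nat.
  by move: j2; clear; lia.
pose tau : 'rV[R]_d := \row_i (t 0 i * a i j).
have tauE : scaled_freq a tau j = t.
  apply/rowP => i; rewrite !mxE mulfK// gt_eqF// a_kap// mulr_gt0//.
  exact: an_gt0.
have aj0 : 0 < an j by exact: an_gt0.
have Jj' : (J0 <= j)%N.
  by apply: ltnW; apply: leq_ltn_trans Jj; exact: leq_maxr.
have := hJ0 j tau Jj'; rewrite tauE => /(_ _) h.
have {}h : cf2 P X t ^+ j <= 1 - J0.+1%:R^-1.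
  apply: h => /=; apply/andP; split.
    have : `|t| <= `|tau| / (kmin * an j).
      apply: norm_le_coord.
        by apply: divr_ge0 => //; apply: mulr_ge0; exact: ltW.
      move=> i; rewrite ler_pdivlMr ?mulr_gt0//.
      apply: le_trans (coord_le_norm tau i); rewrite mxE normrM a_kap//.
      rewrite ler_wpM2l// gtr0_norm ?mulr_gt0//.
      by rewrite ler_pM2r.
    move=> h2; have : `|t| * an j <= kmin^-1 * `|tau|.
      move: h2; rewrite -(ler_pM2r aj0) => /le_trans; apply.
      by rewrite invfM -!mulrA mulVf ?gt_eqF// mulr1 mulrC.
    by move=> h3; have := le_trans tj h3; rewrite ler_pdivlMl// mulr1.
  apply: norm_le_coord.
    apply: mulr_ge0; last exact: ltW.
    by apply: sumr_ge0 => i _; exact: ltW.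
  move=> i; rewrite mxE normrM a_kap//.
  rewrite (gtr0_norm (mulr_gt0 (kap_gt0 i) aj0)).
  rewrite mulrCA; apply: ler_pM => //; first exact: ltW.
    by apply: mulr_ge0 => //; exact: ltW.
  apply: le_trans (_ : `|t| * (B * an j.-1) <= _).
    apply: ler_pM => //; [exact: ltW|exact: coord_le_norm].
  by rewrite mulrCA ger_pMr//; exact: ltW.
(* Bernoulli's inequality extracts the gap of one step from that of its j-th power. *)
have bern (x : R) n : 0 <= x -> x <= 1 -> 1 - n%:R * (1 - x) <= x ^+ n.
  move=> x0 x1; elim: n => [|n IH]; first by rewrite mul0r subr0 expr0.
  rewrite exprS -natr1.
  have : x * (1 - n%:R * (1 - x)) <= x * x ^+ n by rewrite ler_wpM2l.
  have : 0 <= n%:R * ((1 - x) * (1 - x)).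
    by rewrite mulr_ge0// mulr_ge0// subr_ge0.
  lra.
have := bern _ j (cf2_ge0 P X t) (cf2_le1 X_iid t) => h2.
have h3 : c <= j%:R * (1 - cf2 P X t).
  apply: le_trans cJ _; move: (le_trans h2 h).
  by rewrite lerD2l lerN2.
have : c / j%:R <= 1 - cf2 P X t by rewrite ler_pdivrMr// mulrC.
lra.
Qed.

(** With k the least index such that |t| a_k >= 1, the gap c/k yields exp(-c n / (2k)), while |t|
    a_n is at most a constant times (n/k)^s; the exponential beats the power. The exponent 2d leaves
    a summable square for each coordinate. *)
Lemma cf2_decay : exists2 C : R, 0 < C & forall n (t : 'rV[R]_d), (0 < n)%N ->
  `|t| <= pi -> Num.sqrt (cf2 P X t ^+ n) <= C * ((1 + `|t| * an n)^-1) ^+ (2 * d).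
Proof.
have [c c0 hc] := cf2_gap.
have C10 : 0 < C1 by have := C1_ge1; lra.
have s0 := s_gt0.
pose B := C1 * 2 `^ s + pi * an 1.
have pi0 : (0 : R) < pi := pi_gt0 _.
have a1 : 0 < an 1 by exact: an_gt0.
have B0 : 0 < B by apply: addr_gt0; apply: mulr_gt0 => //; exact: powR_gt0.
pose D := 2 * C1 * B.
have D0 : 0 < D by rewrite !mulr_gt0.
have p0 : 0 <= s * (2 * d)%:R by rewrite mulr_ge0// ltW.
have c20 : 0 < c / 2 by rewrite divr_gt0.
have [C2 C20 hC2] := powR_le_expR c20 p0.
exists (4 ^+ d + D ^+ (2 * d) * C2).
  by apply: addr_gt0; [exact: exprn_gt0|apply: mulr_gt0 => //; exact: exprn_gt0].
move=> n t n0 tpi.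
have an0 := an_gt0 n0.
have tan0 : 0 <= `|t| * an n by rewrite mulr_ge0// ltW.
have den0 : 0 < 1 + `|t| * an n by lra.
have sq1 : Num.sqrt (cf2 P X t ^+ n) <= 1.
  rewrite -sqrtr1; apply: ler_wsqrtr; apply: exprn_ile1; first exact: cf2_ge0.
  exact: cf2_le1.
rewrite exprVn ler_pdivlMr ?exprn_gt0//.
have [tn|tn] := leP 1 (`|t| * an n); last first.
  apply: le_trans (_ : 1 * 2 ^+ (2 * d) <= _).
    apply: ler_pM => //.
      by apply: exprn_ge0; lra.
    by rewrite lerXn2r ?nnegrE//; lra.
  rewrite mul1r exprM (_ : 2 ^+ 2 = 4 :> R); last by ring.
  by rewrite lerDl mulr_ge0 ?exprn_ge0 ?ltW.
have exk : exists k, (0 < k)%N && (1 <= `|t| * an k) by exists n; rewrite n0.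
case: (ex_minnP exk) => k /andP[k0 tk] mink.
have kn : (k <= n)%N by apply: mink; rewrite n0.
have k0' : (0 : R) < k%:R by rewrite ltr0n.
have nk1 : 1 <= n%:R / k%:R :> R by rewrite ler_pdivlMr// mul1r ler_nat.
have tkB : `|t| * an k <= B.
  case: k k0 tk mink kn k0' nk1 => // k _ tk mink kn k0' nk1.
  case: k tk mink kn k0' nk1 => [|k] tk mink kn k0' nk1.
    apply: le_trans (_ : pi * an 1 <= _); first by rewrite ler_pM2r.
    by rewrite lerDr mulr_ge0 ?powR_ge0// ltW.
  have tk1 : `|t| * an k.+1 < 1.
    rewrite ltNge; apply/negP => h; have := mink k.+1; rewrite h /= => /(_ isT).
    by rewrite ltnn.
  have ak1 := an_gt0 (ltn0Sn k).
  apply: le_trans (_ : `|t| * (C1 * 2 `^ s * an k.+1) <= _).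
    rewrite ler_wpM2l//; apply: le_trans (an_ratio (ltn0Sn k) (leqnSn _)) _.
    rewrite ler_pM2r// ler_pM2l//; apply: ge0_ler_powR; rewrite ?nnegrE ?divr_ge0//.
      exact: ltW.
    by rewrite ler_pdivrMr// -natrM ler_nat; clear; lia.
  rewrite mulrCA; apply: le_trans (_ : C1 * 2 `^ s * 1 <= _).
    by rewrite ler_wpM2l ?mulr_ge0 ?powR_ge0// ltW.
  by rewrite mulr1 lerDl; apply: mulr_ge0; exact: ltW.
have r0 : 0 <= (n%:R / k%:R) `^ s by exact: powR_ge0.
have up : 1 + `|t| * an n <= D * (n%:R / k%:R) `^ s.
  have : `|t| * an n <= C1 * B * (n%:R / k%:R) `^ s.
    apply: le_trans (_ : `|t| * (C1 * (n%:R / k%:R) `^ s * an k) <= _).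
      by rewrite ler_wpM2l// an_ratio.
    rewrite mulrCA -[leRHS]mulrA [B * _]mulrC [leRHS]mulrA; apply: ler_wpM2l => //.
    by rewrite mulr_ge0// ltW.
  by rewrite /D; lra.
have root : Num.sqrt (cf2 P X t ^+ n) <= expR (- (c / 2 * (n%:R / k%:R))).
  rewrite -[leRHS](ger0_norm (expR_ge0 _)) -sqrtr_sqr; apply: ler_wsqrtr.
  rewrite -expRM_natl mulrN.
  have -> : 2%:R * (c / 2 * (n%:R / k%:R)) = n%:R * (c / k%:R).
    by field; rewrite gt_eqF.
  rewrite -mulrN expRM_natl; apply: lerXn2r; rewrite ?nnegrE ?cf2_ge0 ?expR_ge0//.
  apply: le_trans (hc k t k0 tpi tk) _; exact: expR_ge1Dx.
apply: le_trans (_ : expR (- (c / 2 * (n%:R / k%:R))) *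
    (D * (n%:R / k%:R) `^ s) ^+ (2 * d) <= _).
  apply: ler_pM => //.
    by apply: exprn_ge0; exact: ltW.
  by rewrite lerXn2r ?nnegrE//; [exact: ltW|apply: mulr_ge0 => //; exact: ltW].
rewrite exprMn -(powR_mulrn (2 * d) r0) -powRrM.
have h := hC2 _ nk1.
apply: le_trans (_ : D ^+ (2 * d) * C2 <= _); last by rewrite lerDr exprn_ge0.
rewrite mulrCA; apply: ler_wpM2l; first by apply: exprn_ge0; exact: ltW.
by rewrite expRN mulrC ler_pdivrMr ?expR_gt0.
Qed.

(** The Fejer grid has about a_n points per coordinate. The decay splits into a product over
    coordinates, whose sum over [l] is bounded uniformly in [k], so M^(-2d) times the M^d values of
    [k] leaves M^-d, of order a_n^-d. *)
Theorem local_bound : exists2 C : R, 0 < C & forall n z, (0 < n)%N ->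
  Pr P [set w | walk X n w = z] <= C / an n ^+ d.
Proof.
have [C C0 hC] := cf2_decay.
have pi0 : (0 : R) < pi := pi_gt0 _.
have [N hN] : exists N : nat, forall n, (N <= n)%N -> 1 <= an n.
  apply: (an_unbounded X_iid X_aperiodic X_cvg d_gt0 kap_gt0 a_kap _ 1).
  by move=> i n n0; rewrite a_kap// mulr_gt0// an_gt0.
have [m m0 hm] := finite_lower_bound N an_gt0.
pose amin := Num.min 1 m.
have amin0 : 0 < amin by rewrite lt_min ltr01 m0.
have hamin n : (0 < n)%N -> amin <= an n.
  move=> n0; rewrite ge_min; have [Nn|nN] := leqP N n; first by rewrite hN.
  by rewrite hm ?orbT// n0 ltnW.
(* The spacing is pi / M with M at most (1 + 1/amin) a_n, so spacing times a_n is at least [c]. *)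
pose c := pi / (1 + amin^-1).
have q0 : 0 < 1 + amin^-1 by rewrite ltr_wpDr// invr_ge0 ltW.
have c0 : 0 < c by rewrite divr_gt0.
pose S := 2 * (1 + c) / c.
have S0 : 0 < S by rewrite divr_gt0// mulr_gt0//; lra.
exists (C * S ^+ d); first by rewrite mulr_gt0// exprn_gt0.
move=> n z n0; have an0 := an_gt0 n0.
pose M := (Num.truncn (an n)).+1.
have anM : an n < M%:R by exact: truncnS_gt.
have M0 : (0 : R) < M%:R by rewrite ltr0n.
have Man : M%:R <= (1 + amin^-1) * an n.
  rewrite /M -natr1 mulrDl mul1r; apply: lerD.
    by rewrite truncn_le ltW.
  by rewrite mulrC ler_pdivlMr// mul1r hamin.
pose st : R := pi / M%:R.
have st0 : 0 < st by rewrite divr_gt0.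
apply: le_trans (fejer_bound X_iid st n z (ltn0Sn _ : (0 < M)%N)) _.
apply: le_trans (_ : (M%:R ^- d) ^+ 2 *
   (\sum_(k : {ffun 'I_d -> 'I_M}) C * S ^+ d) <= _); last first.
  rewrite sumr_const card_ffun !card_ord -[C * S ^+ d *+ _]mulr_natl natrX.
  rewrite expr2 -mulrA mulKf ?gt_eqF ?exprn_gt0//.
  rewrite mulrC; apply: ler_wpM2l; first by rewrite mulr_ge0 ?exprn_ge0// ltW.
  by rewrite lef_pV2 ?posrE ?exprn_gt0// lerXn2r ?nnegrE// ltW.
apply: ler_wpM2l; first exact: sqr_ge0.
apply: ler_sum => k _.
apply: le_trans (_ : \sum_(l : {ffun 'I_d -> 'I_M}) C *
   \prod_i ((1 + c * `|(k i)%:R - (l i)%:R|)^-1) ^+ 2 <= _).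
  apply: ler_sum => l _.
  set t := grid st k - grid st l.
  have tE i : t 0 i = st * ((k i)%:R - (l i)%:R) by rewrite !mxE mulrBr.
  have tpi : `|t| <= pi.
    apply: norm_le_coord; first exact: ltW.
    move=> i; rewrite tE normrM (gtr0_norm st0) /st mulrAC ler_pdivrMr//.
    rewrite ler_pM2l// ler_norml.
    have := ltn_ord (k i); have := ltn_ord (l i).
    rewrite -!(ltr_nat R) => /ltW h1 /ltW h2.
    have := ler0n R (k i); have := ler0n R (l i); lra.
  apply: le_trans (hC n t n0 tpi) _; apply: ler_wpM2l; first exact: ltW.
  rewrite exprM -[d in _ ^+ d]card_ord -prodr_const.
  apply: ler_prod => i _; apply/andP; split; first exact: sqr_ge0.
  have x0 : 0 <= c * `|(k i)%:R - (l i)%:R| by rewrite mulr_ge0// ltW.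
  have x1 : c * `|(k i)%:R - (l i)%:R| <= `|t| * an n.
    apply: le_trans (_ : `|t 0 i| * an n <= _); last first.
      by rewrite ler_pM2r// coord_le_norm.
    rewrite tE normrM (gtr0_norm st0) [leRHS]mulrAC; apply: ler_wpM2r => //.
    rewrite /c /st -[leRHS]mulrA ler_pM2l// [leRHS]mulrC.
    rewrite -[leRHS]invf_div lef_pV2 ?posrE//; last by rewrite divr_gt0.
    by rewrite ler_pdivrMr.
  rewrite lerXn2r ?nnegrE ?invr_ge0//; [lra|lra|].
  by rewrite lef_pV2 ?posrE; lra.
rewrite -mulr_sumr; apply: ler_wpM2l; first exact: ltW.
rewrite -(bigA_distr_bigA (fun (i : 'I_d) (j : 'I_M) =>
  ((1 + c * `|(k i)%:R - j%:R|)^-1) ^+ 2)).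
apply: le_trans (_ : \prod_(i < d) S <= _).
  apply: ler_prod => i _; apply/andP; split.
    by apply: sumr_ge0 => j _; exact: sqr_ge0.
  exact: inverse_square_sum.
by rewrite prodr_const card_ord.
Qed.

End LocalBound.

(** * Small jumps *)

Section LatticeNorm.
Context {R : realType} {d : nat}.
Implicit Types x y z : 'rV[int]_d.

Lemma l1normE x : l1norm R x = (\sum_i absz (x 0%R i))%N%:R.
Proof.
rewrite /l1norm [RHS]pmulrn; congr (_%:~R).
by rewrite (big_morph Posz PoszD (erefl _)); apply: eq_bigr => i _; rewrite abszE.
Qed.

Lemma l1norm_sum x : l1norm R x = \sum_i `|(x 0 i)%:~R|.
Proof. by rewrite /l1norm rmorph_sum; apply: eq_bigr => i _; rewrite -intr_norm. Qed.

Lemma l1norm_ge0 x : 0 <= l1norm R x.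
Proof. by rewrite l1normE. Qed.

Lemma l1norm0 : l1norm R (0 : 'rV[int]_d) = 0.
Proof. by rewrite l1norm_sum big1// => i _; rewrite mxE normr0. Qed.

Lemma coord_le_l1norm x i : `|(x 0 i)%:~R| <= l1norm R x.
Proof. by rewrite l1norm_sum (bigD1 i)//= lerDl sumr_ge0. Qed.

Lemma ler_l1normD x y : l1norm R (x + y) <= l1norm R x + l1norm R y.
Proof.
rewrite !l1norm_sum -big_split; apply: ler_sum => i _.
by rewrite mxE intrD ler_normD.
Qed.

Lemma l1norm_large_coord x : (0 < d)%N ->
  exists i, l1norm R x <= d%:R * `|(x 0 i)%:~R|.
Proof.
move=> d0; apply: contrapT => /forallNP h.
have : \sum_(i < d) d%:R * `|(x 0 i)%:~R| < \sum_(i < d) l1norm R x.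
  apply: ltr_sum => [|i _]; first by apply/hasP; exists (Ordinal d0); rewrite ?mem_index_enum.
  by rewrite ltNge; apply/negP; exact: h.
by rewrite -mulr_sumr -l1norm_sum sumr_const card_ord mulr_natl ltxx.
Qed.

Lemma l1norm_box (N : nat) x : l1norm R x < N.+1%:R -> x \in box d N.
Proof.
move=> xN; rewrite mem_box; apply/forallP => i.
have := le_lt_trans (coord_le_l1norm x i) xN.
by rewrite -intr_norm -abszE -[_%:~R]pmulrn ltr_nat ltnS lez_nat.
Qed.

Lemma ball_sum_le (s : seq 'rV[int]_d) (y B : R) (F : 'rV[int]_d -> R) :
  uniq s -> 1 <= y -> 0 <= B -> (forall z, l1norm R z <= y -> F z <= B) ->
  (forall z, y < l1norm R z -> F z <= 0) ->
  \sum_(z <- s) F z <= (3 * y) ^+ d * B.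
Proof.
move=> us y1 B0 FB F0.
pose N := Num.truncn y.
have yN : y < N.+1%:R by exact: truncnS_gt.
have Ny : N%:R <= y by rewrite truncn_le; lra.
apply: (@le_trans _ _ (\sum_(z <- [seq z <- s | z \in box d N]) B)).
  rewrite big_filter [leRHS]big_mkcond; apply: ler_sum => z _.
  have [zy|yz] := leP (l1norm R z) y.
    by rewrite l1norm_box ?FB//; exact: le_lt_trans yN.
  by case: ifP => _; [exact: le_trans (F0 z yz) B0|exact: F0].
rewrite big_const_seq count_predT iter_addr_0 -[leLHS]mulr_natl; apply: ler_wpM2r => //.
apply: (@le_trans _ _ (size (box d N))%:R).
  rewrite ler_nat; apply: uniq_leq_size; first exact: filter_uniq.
  by move=> z; rewrite mem_filter => /andP[].
rewrite size_box natrX lerXn2r ?nnegrE//; first lra.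
by rewrite -natr1 -muln2 natrM; lra.
Qed.

End LatticeNorm.

Section PathWeights.
Context {R : realType} {d : nat}.
Implicit Types (s : seq 'rV[int]_d) (f g h : 'rV[int]_d -> R).

Lemma ler_path_sum_weight s f g n h : (forall z, 0 <= f z <= g z) ->
  (forall u, 0 <= h u) -> path_sum s f n h <= path_sum s g n h.
Proof.
move=> fg; elim: n h => [|n IH] h h0 //=.
apply: ler_sum => z _; have /andP[f0 fgz] := fg z.
apply: ler_pM => //; first by apply: path_sum_ge0 => // u; have /andP[] := fg u.
exact: IH.
Qed.

Lemma path_sum_truncated_eq0 s f n h (y : R) : 0 <= y ->
  (forall u, l1norm R u <= n%:R * y -> h u = 0) ->
  path_sum s (fun z => f z * (l1norm R z <= y)%R%:R) n h = 0.
Proof.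
move=> y0; elim: n h => [|n IH] h h0 /=.
  by apply: h0; rewrite l1norm0 mul0r.
apply: big1 => z _; have [zy|_] := leP (l1norm R z) y; last by rewrite mulr0 mul0r.
rewrite IH ?mulr0// => u un; apply: h0; apply: le_trans (ler_l1normD _ _) _.
by rewrite -natr1 mulrDl mul1r addrC; exact: lerD.
Qed.

End PathWeights.

Section ExponentialBounds.
Context {R : realType}.

(** Squaring e^(v/2) <= 1 / (1 - v/2) reduces the claim to a polynomial inequality, whose difference
    factors with nonnegative factors for v <= 1. *)
Lemma expR_le_quadratic (v : R) : v <= 1 -> expR v <= 1 + v + 2 * v ^+ 2.
Proof.
move=> v1; set e := expR (v / 2); set W := 1 + v + 2 * v ^+ 2.
have e0 : 0 < e by exact: expR_gt0.
have eE : expR v = e ^+ 2 by rewrite -expRM_natl; congr expR; field.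
have q0 : 0 < 1 - v / 2 by lra.
have eq1 : e * (1 - v / 2) <= 1.
  rewrite -[leRHS](expRxMexpNx_1 (v / 2)) ler_pM2l//; exact: expR_ge1Dx.
have W0 : 0 <= W by rewrite /W; nra.
have Wq : 1 <= W * (1 - v / 2) ^+ 2.
  rewrite -subr_ge0.
  have -> : W * (1 - v / 2) ^+ 2 - 1 = v ^+ 2 * ((1 - v) * (5 - 2 * v) / 4).
    by rewrite /W; field.
  apply: mulr_ge0; first exact: sqr_ge0.
  by apply: divr_ge0 => //; apply: mulr_ge0; lra.
rewrite eE; apply: (@le_trans _ _ (e ^+ 2 * (W * (1 - v / 2) ^+ 2))).
  by rewrite ler_peMr// exprn_ge0// ltW.
rewrite mulrCA -exprMn ler_piMr//; apply: exprn_ile1 => //.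
by rewrite mulr_ge0// ltW.
Qed.

Lemma expR_le_bennett (v M : R) : 0 <= M -> v <= M ->
  expR v <= 1 + v + 2 * (v ^+ 2 * expR M).
Proof.
move=> M0 vM; have eM : 1 <= expR M by rewrite -expR0 ler_expR.
have v2 := sqr_ge0 v.
have [v1|v1] := leP v 1.
  apply: le_trans (expR_le_quadratic v1) _; rewrite lerD2l.
  by rewrite ler_pM2l// ler_peMr.
have evM : expR v <= expR M by rewrite ler_expR.
have : 1 * expR M <= v ^+ 2 * expR M.
  by apply: ler_wpM2r; [exact: expR_ge0|rewrite expr_ge1// ltW//; lra].
lra.
Qed.

Lemma mul_expRN_le1 (x : R) : 0 <= x -> x * expR (- (2 * x)) <= 1.
Proof.
move=> x0; rewrite expRN ler_pdivrMr ?expR_gt0// mul1r.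
by apply: le_trans (expR_ge1Dx _); lra.
Qed.

Lemma sqr_mul_expRN_le4 (x : R) : 0 <= x -> x ^+ 2 * expR (- x) <= 4.
Proof.
move=> x0; rewrite expRN ler_pdivrMr ?expR_gt0//.
rewrite (_ : x = 2%:R * (x / 2)); last by field.
rewrite expRM_natl exprMn; apply: ler_pM; rewrite ?sqr_ge0//; first by lra.
apply: lerXn2r; rewrite ?nnegrE ?expR_ge0//; first by lra.
by apply: le_trans (expR_ge1Dx _); lra.
Qed.

End ExponentialBounds.

Section SmallJumps.
Context {R : realType} {d : nat} {disp : measure_display}
  {Om : measurableType disp}.
Variable P : probability Om R.
Variable X : nat -> Om -> 'rV[int]_d.
Hypothesis X_iid : iid P X.

Let p (z : 'rV[int]_d) : R := Pr P [set w | X 0%N w = z].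
Let f (y : R) (z : 'rV[int]_d) : R := p z * (l1norm R z <= y)%R%:R.

Let mX j : discrete_rv (X j). Proof. by have [mX _ _] := X_iid; exact: mX. Qed.

Let f_ge0 y z : 0 <= f y z.
Proof. by apply: mulr_ge0 => //; exact: pmf_ge0. Qed.

Let f_le y z : f y z <= p z.
Proof. by apply: ler_piMr; [exact: pmf_ge0|rewrite lern1 leq_b1]. Qed.

(* The remainder accounts for the steps with a coordinate beyond the level u,
   which may be lower than the truncation level y of the norm. *)
Lemma small_jump_mgf (N : nat) (i : 'I_d) (eps y s u : R) (rem : 'rV[int]_d -> R) :
  `|eps| = 1 -> 0 <= s -> 0 <= u -> (forall z, 0 <= rem z) ->
  (forall z, l1norm R z <= y -> u < `|(z 0 i)%:~R| ->
     expR (s * (eps * (z 0 i)%:~R)) <= 1 + rem z) ->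
  \sum_(z <- box d N) f y z * expR (s * (eps * (z 0 i)%:~R)) <=
  expR (s * (eps * trunc_mean P (Defs.coord (X 0%N) i) u) +
        (2 * (s ^+ 2 * expR (s * u) * trunc_abs_moment P (X 0%N) i 2 u) +
         \sum_(z <- box d N) f y z * rem z)).
Proof.
move=> eps1 s0 u0 rem0 hrem.
pose h1 (x : R) : R := if `|x| <= u then x else 0.
pose h2 (x : R) : R := if `|x| <= u then `|x| ^+ 2 else 0.
have b1 : bounded_rv (fun w => h1 (Defs.coord (X 0%N) i w)).
  apply: bounded_rv_coord => //; exists u => x; rewrite /h1.
  by case: (leP `|x| u) => //; rewrite normr0.
have b2 : bounded_rv (fun w => h2 (Defs.coord (X 0%N) i w)).
  apply: bounded_rv_coord => //; exists (u ^+ 2) => x; rewrite /h2.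
  case: (leP `|x| u) => h; last by rewrite normr0 sqr_ge0.
  by rewrite normrX normr_id lerXn2r ?nnegrE.
pose c := 2 * (s ^+ 2 * expR (s * u)).
pose g (x : R) : R := 1 + (s * eps * h1 x + c * h2 x).
have c0 : 0 <= c by rewrite !mulr_ge0 ?expR_ge0// sqr_ge0.
have gle (x : R) : `|x| <= u -> expR (s * (eps * x)) <= g x.
  move=> xu; rewrite /g /h1 /h2 xu.
  have vM : s * (eps * x) <= s * u.
    apply: ler_wpM2l => //; apply: le_trans (ler_norm _) _.
    by rewrite normrM eps1 mul1r.
  apply: le_trans (expR_le_bennett (mulr_ge0 s0 u0) vM) _.
  have -> : (s * (eps * x)) ^+ 2 = s ^+ 2 * (`|eps| ^+ 2 * `|x| ^+ 2).
    by rewrite !real_normK ?num_real//; ring.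
  by rewrite eps1 expr1n mul1r /c; rewrite le_eqVlt; apply/orP; left; apply/eqP; ring.
have g1 (x : R) : u < `|x| -> g x = 1.
  by rewrite ltNge => /negbTE ux; rewrite /g /h1 /h2 ux !mulr0 !addr0.
have g0 (x : R) : 0 <= g x.
  have [xu|xu] := leP `|x| u; last by rewrite g1.
  by apply: le_trans (gle x xu); exact: expR_ge0.
apply: (@le_trans _ _ (\sum_(z <- box d N) p z * g (z 0 i)%:~R +
   \sum_(z <- box d N) f y z * rem z)).
  rewrite -big_split; apply: ler_sum => z _ /=.
  have [zy|zy] := leP (l1norm R z) y; last first.
    have zy' : (l1norm R z <= y) = false by rewrite leNgt zy.
    rewrite /f zy' mulr0 !mul0r addr0.
    by apply: mulr_ge0 => //; exact: pmf_ge0.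
  rewrite /f zy mulr1 -mulrDr; apply: ler_wpM2l; first exact: pmf_ge0.
  have [zu|zu] := leP `|(z 0 i)%:~R : R| u.
    by apply: le_trans (gle _ zu) _; rewrite lerDl.
  by rewrite g1//; exact: hrem.
have bg : exists M, forall z : 'rV[int]_d, `|g (z 0 i)%:~R| <= M.
  exists (1 + (s * u + c * u ^+ 2)) => z; set x : R := _%:~R.
  have [xu|xu] := leP `|x| u.
    rewrite /g /h1 /h2 xu; apply: le_trans (ler_normD _ _) _.
    rewrite normr1 lerD2l; apply: le_trans (ler_normD _ _) _; apply: lerD.
      rewrite !normrM eps1 mulr1 ger0_norm//; exact: ler_wpM2l.
    rewrite normrM (ger0_norm c0) ger0_norm ?exprn_ge0//; apply: ler_wpM2l => //.
    by rewrite lerXn2r ?nnegrE.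
  rewrite g1// normr1 lerDl addr_ge0// mulr_ge0//.
  exact: sqr_ge0.
have h := sum_pmf_le X_iid (box_uniq N) (fun z => g0 (z 0 i)%:~R) bg.
have eE : Ex P (fun w => g (X 0%N w 0 i)%:~R) =
    1 + (s * eps * trunc_mean P (Defs.coord (X 0%N) i) u +
         c * trunc_abs_moment P (X 0%N) i 2 u).
  rewrite /g ExD ?Ex_cst//; [|exact: bounded_rv_cst|].
    rewrite ExD ?ExZ//; first last.
    - exact: bounded_rvZ.
    - exact: bounded_rvZ.
    by rewrite /trunc_mean -Ex_expectation.
  by apply: bounded_rvD; exact: bounded_rvZ.
have Z : 0 <= \sum_(z <- box d N) f y z * rem z.
  by apply: sumr_ge0 => z _; apply: mulr_ge0.
apply: le_trans (lerD h (lexx _)) _; rewrite eE.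
apply: le_trans (expR_ge1Dx _); rewrite /c; rewrite le_eqVlt; apply/orP; left; apply/eqP; ring.
Qed.

(** [T] measures how far [n] times the truncated mean is from the centering, and [W] is the excess
    of the log-moment of one step beyond its mean. Each half pays at most the [T] and [W] of the
    whole path and gains half of the tilted distance. *)
Lemma small_jump_split (N n : nat) (i : 'I_d) (eps y s mu W T rho beta Q : R)
    (w : 'rV[int]_d) :
  `|eps| = 1 -> (0 < n)%N -> 0 <= s -> 0 <= W -> 0 <= Q ->
  (forall m v, (m <= n)%N -> (n <= m.*2.+1)%N -> Pr P [set o | walk X m o = v] <= Q) ->
  \sum_(z <- box d N) f y z * expR (s * (eps * (z 0 i)%:~R)) <=
    expR (s * (eps * mu) + W) ->
  `|n%:R * mu - beta| <= T -> rho <= eps * ((w 0 i)%:~R - beta) ->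
  path_sum (box d N) (f y) n (fun u => (u == w)%:R) <=
    2 * Q * expR (- (s * rho / 2) + s * T + n%:R * W).
Proof.
move=> eps1 n0 s0 W0 Q0 hQ hZ hT hrho.
have n0' : (0 : R) < n%:R by rewrite ltr0n.
(* A half of length [k] is charged its share k/n of the centering. As the shares add up to [beta],
   one of the halves has to exceed its share by rho/2. *)
pose A k (u : 'rV[int]_d) := rho / 2 + k%:R / n%:R * (eps * beta) <= eps * (u 0 i)%:~R.
have chern k : (k <= n)%N -> path_sum (box d N) (f y) k (fun u => (A k u)%:R) <=
    expR (- (s * rho / 2) + s * T + n%:R * W).
  move=> kn.
  have kn1 : k%:R / n%:R <= 1 :> R by rewrite ler_pdivrMr// mul1r ler_nat.
  have kn0 : 0 <= k%:R / n%:R :> R by rewrite divr_ge0.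
  apply: (@le_trans _ _ (expR (- (s * (rho / 2 + k%:R / n%:R * (eps * beta)))) *
      (\sum_(z <- box d N) f y z * expR (s * (eps * (z 0 i)%:~R))) ^+ k)).
    apply: (@path_sum_chernoff R _ (box d N) (f y) (f_ge0 y) k
      (fun u : 'rV[int]_d => s * (eps * (u 0 i)%:~R)) (A k)).
    - by rewrite mxE !mulr0.
    - by move=> u v; rewrite mxE intrD; ring.
    - by move=> u Au; rewrite ler_wpM2l.
  apply: (@le_trans _ _ (expR (- (s * (rho / 2 + k%:R / n%:R * (eps * beta)))) *
      expR (s * (eps * mu) + W) ^+ k)).
    apply: ler_wpM2l; first exact: expR_ge0.
    apply: lerXn2r; rewrite ?nnegrE ?expR_ge0//.
    by apply: sumr_ge0 => z _; apply: mulr_ge0 => //; exact: expR_ge0.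
  rewrite -expRM_natl -expRD ler_expR.
  have -> : - (s * (rho / 2 + k%:R / n%:R * (eps * beta))) +
      k%:R * (s * (eps * mu) + W) =
      - (s * rho / 2) + s * (k%:R / n%:R * (eps * (n%:R * mu - beta))) + k%:R * W.
    by field; rewrite gt_eqF.
  apply: lerD; last by apply: ler_wpM2r => //; rewrite ler_nat.
  rewrite lerD2l; apply: ler_wpM2l => //; apply: le_trans (ler_norm _) _.
  rewrite normrM ger0_norm// normrM eps1 mul1r.
  by apply: le_trans hT; apply: ler_piMl.
have nE : (n./2 + (n - n./2))%N = n by clear; lia.
have walk_le k v : (k <= n)%N -> (n <= k.*2.+1)%N ->
    path_sum (box d N) (f y) k (fun u => (u == v)%:R) <= Q.
  move=> kn nk; apply: le_trans (hQ k v kn nk).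
  apply: le_trans (path_sum_le_Pr X_iid _ _ (box_uniq N)).
  by apply: ler_path_sum_weight => // z; rewrite f_ge0 f_le.
rewrite -[in leLHS]nE.
apply: le_trans (path_sum_split (f_ge0 y) (A := A n./2) (B := A (n - n./2)%N)
  (Qm := Q) (Qn := Q) _ _ _) _.
- move=> u v uv; apply: contraT; rewrite negb_or -!ltNge.
  move=> /andP[hu hv].
  have wE : (w 0 i)%:~R = (u 0 i)%:~R + (v 0 i)%:~R :> R by rewrite -uv mxE intrD.
  have sE : n./2%:R / n%:R + (n - n./2)%:R / n%:R = 1 :> R.
    by rewrite -mulrDl -natrD nE divff// gt_eqF.
  have : n./2%:R / n%:R * (eps * beta) + (n - n./2)%:R / n%:R * (eps * beta) = eps * beta.
    by rewrite -mulrDl sE mul1r.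
  move: hrho; rewrite wE; lra.
- move=> v; apply: walk_le; clear; lia.
- move=> v; apply: walk_le; clear; lia.
have le1 : (n./2 <= n)%N by clear; lia.
rewrite -mulrDr [2 * Q]mulrC -[leRHS]mulrA; apply: ler_wpM2l => //.
rewrite [leRHS]mulr_natl [leRHS]mulr2n; apply: lerD; apply: chern => //.
exact: leq_subr.
Qed.

End SmallJumps.

(** Lets all coordinates share their constants, once a property is phrased so as to hold for all
    large values of one parameter. *)
Lemma uniform_threshold {R : realType} {d : nat} (Q : 'I_d -> R -> Prop) :
  (forall i, exists M0 : R, forall M : R, M0 <= M -> Q i M) ->
  exists M0 : R, forall M : R, M0 <= M -> forall i, Q i M.
Proof.
move=> /choice[m hm]; exists (\sum_i `|m i|) => M hM i; apply: hm.
apply: le_trans (ler_norm _) _; apply: le_trans hM.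
by rewrite (bigD1 i)//= lerDl sumr_ge0.
Qed.

(** * Consequences of the pointwise bound on a step *)

Section LocalTails.
Context {R : realType} {d : nat} {disp : measure_display}
  {Om : measurableType disp}.
Variable P : probability Om R.
Variable X : nat -> Om -> 'rV[int]_d.
Hypothesis X_iid : iid P X.
Variables (phi : R -> R) (gamma : R).
Hypothesis gamma_gt0 : 0 < gamma.
Hypothesis phi_sv : pos_slowly_varying phi.
Let p (z : 'rV[int]_d) : R := Pr P [set w | X 0%N w = z].
Definition local_rate (r : R) : R := phi r * r `^ (- (d%:R + gamma)).
Let psi := local_rate.
Hypothesis X_local : forall z : 'rV[int]_d, z != 0 -> p z <= psi (l1norm R z).

Let mX j : discrete_rv (X j). Proof. by have [mX _ _] := X_iid; exact: mX. Qed.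

Let p_le1 z : p z <= 1.
Proof.
have := sum_pmf_le1 (s := [:: z]) X_iid isT.
by rewrite big_cons big_nil addr0.
Qed.

Lemma local_rate_gt0 r : 0 < r -> 0 < psi r.
Proof. by move=> r0; rewrite mulr_gt0 ?powR_gt0//; case: phi_sv => _; exact. Qed.

Lemma local_rate_potter : exists x0 C : R, [/\ 0 < x0, 1 <= C &
  forall x y : R, x0 <= x -> x <= y -> psi y <= C * psi x /\
    psi x <= C * (y / x) `^ (2 * (d%:R + gamma)) * psi y].
Proof.
have g0 := gamma_gt0.
have d0 : 0 < d%:R + gamma by rewrite ltr_wpDl.
have [x0 [C [x00 C0 h]]] := potter_regular (d%:R + gamma) phi_sv.1 d0.
exists x0, (1 + C); split=> //; first by lra.
move=> x y x0x xy; have [Vx h1 h2] := h x y x0x xy.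
have x_gt0 : 0 < x by lra.
have y_gt0 : 0 < y by lra.
have Vy := local_rate_gt0 y_gt0.
move: h1; rewrite subrr powRr0 mulr1 => h1; split.
  by apply: le_trans h1 _; rewrite ler_wpM2r ?lerDr// ltW.
apply: le_trans h2 _.
rewrite (_ : 2 * (d%:R + gamma) = (d%:R + gamma) + (d%:R + gamma)); last by ring.
apply: ler_wpM2r; first exact: ltW.
by apply: ler_wpM2r; [exact: powR_ge0|rewrite lerDr].
Qed.

Lemma local_tail_sup (K : R) : 1 <= K -> exists r0 C : R, [/\ 0 < r0, 0 < C &
  forall (r : R) (z : 'rV[int]_d), r0 <= r -> r / K <= l1norm R z ->
    p z <= C * psi r].
Proof.
move=> K1; have K0 : 0 < K by lra.
have [x0 [C [x00 C1 h]]] := local_rate_potter.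
have C0 : 0 < C by lra.
pose C' := C * (C * K `^ (2 * (d%:R + gamma))).
exists (K * x0), C'; split; rewrite ?mulr_gt0 ?powR_gt0//.
move=> r z r0 rz.
have r_gt0 : 0 < r by apply: lt_le_trans r0; rewrite mulr_gt0.
have x0r : x0 <= r / K by rewrite ler_pdivlMr// mulrC.
have rKr : r / K <= r by rewrite ler_pdivrMr// ler_peMr// ltW.
have z0 : z != 0.
  by apply: contraTneq rz => ->; rewrite l1norm0 -ltNge; lra.
apply: le_trans (X_local z0) _.
have [h1 _] := h _ _ x0r rz; have [_ h2] := h _ _ x0r rKr.
apply: le_trans h1 _; rewrite /C' -mulrA; apply: ler_wpM2l; first exact: ltW.
by move: h2; rewrite (_ : r / (r / K) = K)// invf_div mulrC divfK ?gt_eqF.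
Qed.

(** For this [k], x^k psi(x) has index at least 1 and is increasing up to a constant. The sum is
    thus at most the number of lattice points of norm up to [y] times the value at [y]. *)
Lemma truncated_moment_sum (k : nat) : d%:R + gamma + 1 <= k%:R ->
  exists y0 C : R, [/\ 1 <= y0, 0 < C & forall (y : R) N, y0 <= y ->
  \sum_(z <- box d N) p z * (l1norm R z <= y)%R%:R * l1norm R z ^+ k <=
  C * (y ^+ k * (y ^+ d * psi y))].
Proof.
move=> kd; have g0 := gamma_gt0.
have k0 : (0 < k)%N.
  by rewrite -(ltr_nat R); apply: lt_le_trans kd; have := ler0n R d; lra.
have [x0 [C [x00 C0 h]]] :=
  potter_regular (d%:R + gamma - k%:R) phi_sv.1 (ltr01 : 0 < (1 : R)).
pose V (x : R) := x ^+ k * psi x.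
have VE (x : R) : 0 < x -> phi x * x `^ (- (d%:R + gamma - k%:R)) = V x.
  move=> x_gt0; rewrite /V /psi /local_rate opprB powRD; last first.
    by apply/implyP => _; rewrite gt_eqF.
  by rewrite powR_mulrn ?(ltW x_gt0)//; ring.
have V0 (x : R) : 0 < x -> 0 < V x.
  by move=> x_gt0; rewrite mulr_gt0 ?exprn_gt0//; exact: local_rate_gt0.
have Vle (x y : R) : x0 <= x -> x <= y -> V x <= C * V y.
  move=> x0x xy; have x_gt0 : 0 < x by lra.
  have y_gt0 : 0 < y by lra.
  have [_ _] := h x y x0x xy; rewrite !VE// => /le_trans; apply.
  apply: ler_wpM2r; first exact/ltW/V0.
  rewrite -[leRHS]mulr1 ler_pM2l// -[leRHS](powRr0 (y / x)).
  by apply: ler_powR; [rewrite ler_pdivlMr// mul1r|lra].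
(* Potter's bounds start at [x0]; a point of smaller norm contributes at most x0^k, which is
   compared with [V x0] and then with [V y]. *)
pose C' := C * (1 + x0 ^+ k / V x0).
have q0 : 0 <= x0 ^+ k / V x0.
  by rewrite divr_ge0 ?exprn_ge0// ltW// V0.
have C'0 : 0 < C' by rewrite mulr_gt0//; lra.
exists (1 + x0), (3 ^+ d * C'); split; [lra|by apply: mulr_gt0 => //; exact: exprn_gt0|].
move=> y N y0.
have y_gt0 : 0 < y by lra.
have y1 : 1 <= y by lra.
have VC : C * V y <= C' * V y.
  apply: ler_wpM2r; first exact/ltW/V0.
  by rewrite /C' ler_peMr ?(ltW C0)//; lra.
rewrite [leRHS](_ : _ = (3 * y) ^+ d * (C' * V y)); last first.
  by rewrite exprMn /V; ring.
apply: ball_sum_le => //.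
- exact: box_uniq.
- by rewrite mulr_ge0 ?ltW// V0.
- move=> z zy; rewrite zy mulr1.
  have [->|z0] := eqVneq z 0.
    by rewrite l1norm0 expr0n eqn0Ngt k0 mulr0 mulr_ge0 ?ltW// V0.
  have [x0z|zx0] := leP x0 (l1norm R z).
    apply: le_trans (_ : V (l1norm R z) <= _); last by apply: le_trans (Vle _ _ x0z zy) VC.
    rewrite /V mulrC; apply: ler_wpM2l; first by rewrite exprn_ge0 ?l1norm_ge0.
    exact: X_local.
  apply: le_trans (_ : x0 ^+ k <= _).
    rewrite -[leRHS]mul1r; apply: ler_pM => //; rewrite ?pmf_ge0 ?exprn_ge0 ?l1norm_ge0//.
    by apply: lerXn2r; rewrite ?nnegrE ?l1norm_ge0// ltW.
  have h1 : V x0 <= C * V y by apply: Vle; lra.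
  apply: le_trans (_ : (x0 ^+ k / V x0) * (C * V y) <= _).
    by rewrite -[leLHS](divfK (lt0r_neq0 (V0 _ x00))); apply: ler_wpM2l.
  rewrite mulrA; apply: ler_wpM2r; first exact/ltW/V0.
  by rewrite /C' mulrC ler_pM2l//; lra.
- by move=> z; rewrite ltNge => /negbTE ->; rewrite mulr0 mul0r.
Qed.

Section HeavyTails.
Hypothesis d_gt0 : (0 < d)%N.
Hypothesis tail_decay : forall i, exists s C1 x1 : R, [/\ 0 < s, 0 <= C1, 0 < x1 &
  forall lam y : R, 1 <= lam -> x1 <= y ->
  abs_tail P (X 0%N) i (lam * y) <= C1 * lam `^ (- s) * abs_tail P (X 0%N) i y].

Lemma abs_tail_local : exists y0 C : R, [/\ 0 < y0, 0 < C &
  forall (y : R) i, y0 <= y -> abs_tail P (X 0%N) i y <= C * (y ^+ d * psi y)].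
Proof.
have dR : (0 : R) < d%:R by rewrite ltr0n.
pose G i := abs_tail P (X 0%N) i.
have [M0 hM0] : exists M0 : R, forall M, M0 <= M -> forall i, forall y : R, M <= y ->
    d%:R * G i (M * y) <= G i y / 2.
  apply: uniform_threshold => i.
  have [s [C1 [x1 [s0 C10 x10 hG]]]] := tail_decay i.
  have [B B1 hB] := scale_exists (d%:R * C1) s0.
  exists (B + x1) => M hM y My.
  have M1 : 1 <= M by lra.
  have x1y : x1 <= y by lra.
  apply: le_trans (ler_wpM2l (ltW dR) (hG M y M1 x1y)) _.
  rewrite mulrA [leRHS]mulrC; apply: ler_wpM2r; first exact: abs_tail_ge0.
  rewrite mulrA; apply: le_trans (_ : d%:R * C1 * B `^ (- s) <= _).
    apply: ler_wpM2l; first by rewrite mulr_ge0// ltW.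
    rewrite !powRN lef_pV2 ?posrE ?powR_gt0//; [|lra|lra].
    by apply: ge0_ler_powR; rewrite ?nnegrE//; lra.
  by apply: le_trans hB _; rewrite div1r.
pose M := 1 + `|M0|.
have M1 : 1 <= M by rewrite /M lerDl.
have M0M : M0 <= M by apply: le_trans (ler_norm _) _; rewrite /M lerDr.
have [r0 [C [r00 C0 hC]]] := local_tail_sup (lexx (1 : R)).
exists (M + r0), (2 * d%:R * ((3 * M) ^+ d * C)); split.
- by lra.
- by rewrite !mulr_gt0// exprn_gt0//; lra.
move=> y i hy.
have y0 : 0 < y by lra.
have My : M <= y by lra.
have r0y : r0 <= y by lra.
have psi0 := local_rate_gt0 y0.
pose T := (3 * (M * y)) ^+ d * (C * psi y).
pose H u := \sum_j G j u.
have GH j : G j y <= T + H (M * y).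
  pose N := Num.truncn (M * y).
  have My0 : 0 <= M * y by rewrite mulr_ge0; lra.
  have NM : N%:R <= M * y by rewrite truncn_le.
  have MN : M * y < N.+1%:R by exact: truncnS_gt.
  pose g (z : 'rV[int]_d) : R := (y <= `|(z 0 j)%:~R|)%R%:R.
  have bg : exists B, forall z, `|g z| <= B.
    by exists 1 => z; rewrite /g normr_nat lern1 leq_b1.
  have b1 : bounded_rv (fun w => (X 0%N w \in box d N)%:R * g (X 0%N w)).
    apply: (discrete_rv_bounded (h := fun z => (z \in box d N)%:R * g z)) => //.
    exists 1 => z; rewrite normrM /g !normr_nat.
    by apply: mulr_ile1; rewrite ?ler0n// lern1 leq_b1.
  have b2 k : bounded_rv (fun w => (M * y <= `|Defs.coord (X 0%N) k w|)%R%:R : R).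
    apply: (@bounded_rv_coord R d disp Om (X 0%N) _ (mX 0%N) (fun x : R => (M * y <= `|x|)%R%:R)) => //.
    by exists 1 => x; rewrite normr_nat lern1 leq_b1.
  rewrite /G abs_tail_Ex//.
  apply: le_trans (_ : Ex P (fun w => (X 0%N w \in box d N)%:R * g (X 0%N w) +
      \sum_k (M * y <= `|Defs.coord (X 0%N) k w|)%R%:R) <= _).
    apply: ler_Ex.
    - apply: (@bounded_rv_coord R d disp Om (X 0%N) _ (mX 0%N) (fun x : R => (y <= `|x|)%R%:R)) => //.
      by exists 1 => x; rewrite normr_nat lern1 leq_b1.
    - by apply: bounded_rvD => //; exact: bounded_rv_sum.
    move=> w; rewrite /g /Defs.coord.
    have [_|wN] := boolP (X 0%N w \in box d N).
      by rewrite mul1r lerDl sumr_ge0.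
    rewrite mul0r add0r.
    move: wN; rewrite mem_box negb_forall => /existsP[k]; rewrite -ltNge => hk.
    apply: le_trans (_ : 1 <= _); first by rewrite lern1 leq_b1.
    have hk' : M * y <= `|(X 0%N w 0 k)%:~R|.
      apply/ltW; apply: lt_le_trans MN _.
      by rewrite -intr_norm -[N.+1%:R]/(N.+1%:Z%:~R) ler_int.
    by rewrite (bigD1 k)//= hk' lerDl sumr_ge0.
  rewrite ExD//; last exact: bounded_rv_sum.
  apply: lerD; last first.
    by rewrite Ex_sum//; apply: ler_sum => k _; rewrite /G abs_tail_Ex.
  rewrite -(sum_pmf X_iid (box_uniq N) bg).
  apply: le_trans (_ : \sum_(z <- box d N) C * psi y <= _).
    apply: ler_sum => z _; rewrite /g.
    have [yz|_] := leP y `|(z 0 j)%:~R : R|; last by rewrite mulr0 mulr_ge0// ltW.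
    rewrite mulr1; apply: hC => //; rewrite divr1.
    by apply: le_trans yz _; exact: coord_le_l1norm.
  rewrite big_const_seq count_predT iter_addr_0 -[leLHS]mulr_natl.
  apply: ler_wpM2r; first by rewrite mulr_ge0// ltW.
  rewrite size_box natrX lerXn2r ?nnegrE//; first lra.
  have : 1 <= M * y by rewrite -[1]mulr1; apply: ler_pM; lra.
  by rewrite -natr1 -muln2 natrM; lra.
have dH : d%:R * H (M * y) <= H y / 2.
  rewrite /H mulr_sumr mulr_suml; apply: ler_sum => j _; exact: hM0.
have Hy : H y <= d%:R * T + d%:R * H (M * y).
  rewrite -mulrDr; apply: le_trans (_ : \sum_(j < d) (T + H (M * y)) <= _).
    by apply: ler_sum => j _; exact: GH.
  by rewrite sumr_const card_ord mulr_natl.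
have GHi : G i y <= H y.
  rewrite /H (bigD1 i)//= lerDl sumr_ge0// => j _; exact: abs_tail_ge0.
have -> : 2 * d%:R * ((3 * M) ^+ d * C) * (y ^+ d * psi y) = 2 * (d%:R * T).
  by rewrite /T (mulrA 3) !exprMn; ring.
by move: GHi; rewrite /G; lra.
Qed.

End HeavyTails.

End LocalTails.

(** * Tilting bounds for paths with small steps *)

Section SmallJumpBounds.
Context {R : realType} {d : nat} {disp : measure_display}
  {Om : measurableType disp}.
Variable P : probability Om R.
Variable X : nat -> Om -> 'rV[int]_d.
Hypothesis X_iid : iid P X.
Hypothesis d_gt0 : (0 < d)%N.
Variables (al : R) (L : 'I_d -> R -> R) (pr qr : 'I_d -> R) (a : 'I_d -> nat -> R).
Hypothesis al02 : 0 < al <= 2.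
Hypothesis tails : forall i,
  regular_tails P (Defs.coord (X 0%N) i) al (L i) (pr i) (qr i).
Hypothesis scal : forall i, scaling P (Defs.coord (X 0%N) i) al (L i) (a i).
Hypothesis a_unbounded : forall i (M : R), exists N : nat,
  forall n, (N <= n)%N -> M <= a i n.
Variables (b : nat -> R) (kap : 'I_d -> R).
Hypothesis kap_gt0 : forall i, 0 < kap i.
Hypothesis a_kap : forall i n, (0 < n)%N -> a i n = kap i * b n.
Hypothesis b_gt0 : forall n, (0 < n)%N -> 0 < b n.
Variable CQ : R.
Hypothesis CQ_gt0 : 0 < CQ.
Hypothesis half_bound : forall n m v, (0 < n)%N -> (m <= n)%N ->
  (n <= m.*2.+1)%N -> Pr P [set o | walk X m o = v] <= CQ / b n ^+ d.

Let p (z : 'rV[int]_d) : R := Pr P [set w | X 0%N w = z].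
Let f (y : R) (z : 'rV[int]_d) : R := p z * (l1norm R z <= y)%R%:R.
Let drf (i : 'I_d) n := centering P (Defs.coord (X 0%N) i) al (a i) n.

Let mX j : discrete_rv (X j). Proof. by have [mX _ _] := X_iid; exact: mX. Qed.

Let kmax : R := 1 + \sum_i kap i.

Let kap_le i : kap i <= kmax.
Proof.
have k0 := kap_gt0; rewrite /kmax (bigD1 i)//= addrCA lerDl addr_ge0//.
by apply: sumr_ge0 => j _; exact: ltW.
Qed.

Let kmax1 : 1 <= kmax.
Proof. by rewrite /kmax lerDl sumr_ge0// => j _; exact: ltW. Qed.

Lemma powR_neg_le (t s s' : R) : 1 <= t -> s <= s' -> t `^ (- s') <= t `^ (- s).
Proof. by move=> t1 ss; rewrite ler_powR// lerN2. Qed.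

(** A single [M] acts as threshold in [n], as constant and as inverse of the exponent: the estimate
    is then monotone in [M], and [uniform_threshold] applies. *)
Lemma uniform_truncated_estimates : exists2 M : R, 1 <= M &
  forall i (n : nat) (y : R), M <= n%:R -> a i n <= y ->
  n%:R * trunc_abs_moment P (X 0%N) i 2 y <= M * (y ^+ 2 * (y / a i n) `^ (- M^-1)) /\
  `|n%:R * trunc_mean P (Defs.coord (X 0%N) i) y - drf i n| <=
    M * (y * (y / a i n) `^ (- M^-1)).
Proof.
have [M0 hM0] : exists M0 : R, forall M, M0 <= M -> forall i (n : nat) (y : R),
    1 <= M -> M <= n%:R -> a i n <= y ->
  n%:R * trunc_abs_moment P (X 0%N) i 2 y <= M * (y ^+ 2 * (y / a i n) `^ (- M^-1)) /\
  `|n%:R * trunc_mean P (Defs.coord (X 0%N) i) y - drf i n| <=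
    M * (y * (y / a i n) `^ (- M^-1)).
  apply: uniform_threshold => i.
  have [e [C1 [n0 [e0 C10 h]]]] := truncated_estimates (mX 0%N) al02 (tails i)
    (scal i) (a_unbounded i).
  exists (e^-1 + C1 + n0%:R) => M hM n y M1 Mn ay.
  have ei0 : 0 < e^-1 by rewrite invr_gt0.
  have n00 := ler0n R n0.
  have nn0 : (n0 <= n)%N by rewrite -(ler_nat R); lra.
  have [a0 /(_ y ay)[h1 h2]] := h n nn0.
  have y0 : 0 < y by lra.
  have t1 : 1 <= y / a i n by rewrite ler_pdivlMr// mul1r.
  have Me : M^-1 <= e by rewrite -[leRHS]invrK lef_pV2 ?posrE//; lra.
  have pw := powR_neg_le t1 Me.
  have CM : C1 <= M by lra.
  split.
    apply: le_trans h1 _; apply: ler_pM => //.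
      by rewrite mulr_ge0 ?powR_ge0// sqr_ge0.
    by apply: ler_wpM2l => //; exact: sqr_ge0.
  apply: le_trans h2 _; apply: ler_pM => //.
    by rewrite mulr_ge0 ?powR_ge0// ltW.
  by apply: ler_wpM2l => //; exact: ltW.
exists (1 + `|M0|); first by rewrite lerDl.
move=> i n y Mn ay; apply: hM0 => //; last by rewrite lerDl.
by apply: le_trans (ler_norm _) _; rewrite lerDr.
Qed.

Lemma uniform_gaussian_regime : al = 2 -> exists2 M : R, 1 <= M &
  forall i (n : nat) (u : R), M <= n%:R -> 0 < u ->
  n%:R * (`|trunc_mean P (Defs.coord (X 0%N) i) u -
            mean P (Defs.coord (X 0%N) i)| / u +
          trunc_abs_moment P (X 0%N) i 2 u / u ^+ 2) <=
  M * ((a i n / u) ^+ 2 + 1).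
Proof.
move=> al2.
have [M0 hM0] : exists M0 : R, forall M, M0 <= M -> forall i (n : nat) (u : R),
    M <= n%:R -> 0 < u ->
  n%:R * (`|trunc_mean P (Defs.coord (X 0%N) i) u -
            mean P (Defs.coord (X 0%N) i)| / u +
          trunc_abs_moment P (X 0%N) i 2 u / u ^+ 2) <=
  M * ((a i n / u) ^+ 2 + 1).
  apply: uniform_threshold => i.
  have [C1 [n0 [C10 h]]] := gaussian_regime (mX 0%N) al02 (tails i)
    (scal i) (a_unbounded i) al2.
  exists (C1 + n0%:R) => M hM n u Mn u0.
  have n00 := ler0n R n0.
  have nn0 : (n0 <= n)%N by rewrite -(ler_nat R); lra.
  apply: le_trans (h n nn0 u u0) _; apply: ler_wpM2r; last by lra.
  by rewrite addr_ge0// sqr_ge0.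
exists (1 + `|M0|); first by rewrite lerDl.
move=> i n u Mn u0; apply: hM0 => //.
by apply: le_trans (ler_norm _) _; rewrite lerDr.
Qed.

(** Some coordinate of [x] carries at least |x|/d. The error 1, left by the rounding of the
    centering, is at most |x|/(2d), so half of it survives; [eps] is its sign. *)
Lemma large_coordinate (x w : 'rV[int]_d) (D : 'I_d -> R) :
  2 * d%:R <= l1norm R x ->
  (forall i, `|(w 0 i)%:~R - (x 0 i)%:~R - D i| <= 1) ->
  exists i eps, `|eps| = 1 /\
    l1norm R x / (2 * d%:R) <= eps * ((w 0 i)%:~R - D i).
Proof.
move=> xd wD; have dR : (0 : R) < d%:R by rewrite ltr0n d_gt0.
have [i hi] := l1norm_large_coord (R := R) x d_gt0.
pose v : R := (x 0 i)%:~R.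
pose eps : R := if 0 <= v then 1 else -1.
have eps1 : `|eps| = 1 by rewrite /eps; case: ifP => _; rewrite ?normrN normr1.
have epsv : eps * v = `|v|.
  rewrite /eps; case: (leP 0 v) => v0; first by rewrite mul1r ger0_norm.
  by rewrite mulN1r ltr0_norm.
exists i, eps; split=> //.
have -> : eps * ((w 0 i)%:~R - D i) = `|v| + eps * ((w 0 i)%:~R - v - D i).
  by rewrite -epsv; ring.
have : - 1 <= eps * ((w 0 i)%:~R - v - D i).
  rewrite lerNl; apply: le_trans (ler_norm _) _.
  by rewrite normrN normrM eps1 mul1r.
have : 2 * (l1norm R x / (2 * d%:R)) <= `|v|.
  rewrite (_ : 2 * _ = l1norm R x / d%:R); last by field; rewrite gt_eqF.
  by rewrite ler_pdivrMr// mulrC.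
have : 1 <= l1norm R x / (2 * d%:R).
  by rewrite ler_pdivlMr ?mul1r// mulr_gt0.
lra.
Qed.

(** [c] is fixed before [K], so the exponent c K can later be made as large as required by
    truncating at a smaller fraction of |x|. *)
Lemma small_jump_polynomial : exists M c : R, [/\ 1 <= M, 0 < c &
  forall K : R, 1 <= K -> exists C Lam : R, [/\ 0 < C, 0 < Lam &
  forall (n N : nat) (x w : 'rV[int]_d), M <= n%:R ->
    2 * d%:R <= l1norm R x -> Lam * b n <= l1norm R x ->
    (forall i, `|(w 0 i)%:~R - (x 0 i)%:~R - drf i n| <= 1) ->
    path_sum (box d N) (f (l1norm R x / K)) n (fun u => (u == w)%:R) <=
      C / b n ^+ d * (l1norm R x / b n) `^ (- (c * K))]].
Proof.
have dR : (0 : R) < d%:R by rewrite ltr0n d_gt0.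
have [M M1 hM] := uniform_truncated_estimates.
have M0 : 0 < M by lra.
(* With s = l / y, r = K y and rho = r / (2d), the gain s rho / 2 is K l / (4d), that is c K ln t,
   since ln t = 2 M l. *)
pose c := (8 * M * d%:R)^-1.
have c0 : 0 < c by rewrite invr_gt0 !mulr_gt0.
exists M, c; split=> // K K1; have K0 : 0 < K by lra.
have km1 := kmax1.
(* From |x| >= Lam a_n on, the truncation level |x|/K is above [a i n] for every coordinate. *)
pose Lam := K * kmax.
have Lam0 : 0 < Lam by rewrite mulr_gt0//; lra.
exists (2 * CQ * expR (9 * M) * Lam `^ (c * K)), Lam; split=> //.
  by rewrite !mulr_gt0 ?expR_gt0 ?powR_gt0.
move=> n N x w Mn xd Lamx wD; set r := l1norm R x.
have n0 : (0 < n)%N by rewrite -(ltr_nat R); lra.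
have b0 := b_gt0 n0.
have [i [eps [eps1 hrho]]] := large_coordinate xd wD.
pose y := r / K.
have r0 : 0 < r by apply: lt_le_trans xd; rewrite mulr_gt0.
have y0 : 0 < y by rewrite divr_gt0.
have k0 := kap_gt0 i.
have a0 : 0 < a i n by rewrite a_kap// mulr_gt0.
pose t := y / a i n.
have ay : a i n <= y.
  rewrite /y ler_pdivlMr// a_kap//; apply: le_trans Lamx.
  rewrite /Lam mulrC mulrA; apply: ler_wpM2r; first exact: ltW.
  by apply: ler_wpM2l; [exact: ltW|exact: kap_le].
have t1 : 1 <= t by rewrite ler_pdivlMr// mul1r.
have t0 : 0 < t by lra.
have [hm hT] := hM i n y Mn ay.
(* Then t^(-1/M) = e^(-2l), which compensates the factor e^l of the tilt: l e^(-2l) and l^2 e^l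
   e^(-2l) are bounded. *)
pose l := ln t / (2 * M).
have l0 : 0 <= l by rewrite divr_ge0 ?ln_ge0//; lra.
have tE q : t `^ q = expR (2 * M * l * q).
  by rewrite /powR gt_eqF// /l mulrC; congr expR; field; rewrite gt_eqF.
pose s := l / y.
have s0 : 0 <= s by rewrite divr_ge0// ltW.
have sy : s * y = l by rewrite /s divfK// gt_eqF.
have : \sum_(z <- box d N) f y z * expR (s * (eps * (z 0 i)%:~R)) <=
  expR (s * (eps * trunc_mean P (Defs.coord (X 0%N) i) y) +
   2 * (s ^+ 2 * expR l * trunc_abs_moment P (X 0%N) i 2 y)).
  have := @small_jump_mgf R d disp Om P X X_iid N i eps y s y (fun=> 0) eps1 s0
    (ltW y0) (fun=> lexx 0).
  rewrite sy [X in expR (_ + (_ + X))]big1 ?addr0; last by move=> z _; rewrite mulr0.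
  apply=> z zy yz; suff : false by [].
  by move: (lt_le_trans yz (coord_le_l1norm z i)); rewrite ltNge zy.
set mu := trunc_mean P _ y; set tm2 := trunc_abs_moment P _ i 2 y.
set W := 2 * _ => mgf.
have W0 : 0 <= W.
  apply: mulr_ge0 => //; apply: mulr_ge0; last exact: trunc_abs_moment_ge0.
  by rewrite mulr_ge0 ?expR_ge0// sqr_ge0.
have Q0 : 0 <= CQ / b n ^+ d by rewrite divr_ge0 ?exprn_ge0// ltW.
apply: le_trans (small_jump_split X_iid eps1 n0 s0 W0 Q0 _ mgf hT hrho) _.
  by move=> m v mn nm; exact: half_bound.
have pw : t `^ (- M^-1) = expR (- (2 * l)).
  by rewrite tE; congr expR; field; rewrite gt_eqF.
have le1 := mul_expRN_le1 l0.
have le2 := sqr_mul_expRN_le4 l0.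
have exp_le : - (s * (r / (2 * d%:R)) / 2) + s * (M * (y * t `^ (- M^-1))) + n%:R * W <=
    9 * M - c * K * (2 * M * l).
  have -> : s * (r / (2 * d%:R)) / 2 = c * K * (2 * M * l).
    rewrite (_ : r = K * y); last by rewrite /y mulrC divfK// gt_eqF.
    rewrite mulrA mulrCA -mulrA -sy; rewrite /c; field.
    by rewrite !gt_eqF.
  have : s * (M * (y * t `^ (- M^-1))) <= M.
    rewrite (_ : s * _ = M * (s * y * t `^ (- M^-1))); last by ring.
    by rewrite sy pw; apply: ler_piMr => //; exact: ltW.
  have : n%:R * W <= 8 * M.
    have -> : n%:R * W = 2 * s ^+ 2 * expR l * (n%:R * tm2) by rewrite /W; ring.
    apply: le_trans (_ : 2 * s ^+ 2 * expR l * (M * (y ^+ 2 * t `^ (- M^-1))) <= _).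
      apply: ler_wpM2l => //; apply: mulr_ge0; last exact: expR_ge0.
      by rewrite mulr_ge0// sqr_ge0.
    have -> : 2 * s ^+ 2 * expR l * (M * (y ^+ 2 * t `^ (- M^-1))) =
        2 * M * (l ^+ 2 * expR (- l)).
      have -> : expR (- l) = expR l * expR (- (2 * l)).
        by rewrite -expRD; congr expR; ring.
      have -> : l ^+ 2 = s ^+ 2 * y ^+ 2 by rewrite -exprMn sy.
      by rewrite pw; ring.
    by rewrite (_ : 8 * M = 2 * M * 4); [rewrite ler_wpM2l// mulr_ge0// ltW|ring].
  lra.
have bound : expR (9 * M - c * K * (2 * M * l)) <=
    expR (9 * M) * (Lam `^ (c * K) * (r / b n) `^ (- (c * K))).
  rewrite expRD ler_pM2l ?expR_gt0//.
  have -> : expR (- (c * K * (2 * M * l))) = t `^ (- (c * K)).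
    by rewrite tE; congr expR; ring.
  have cK : 0 <= c * K by rewrite mulr_ge0// ltW.
  have rb0 : 0 < r / b n by rewrite divr_gt0.
  rewrite (_ : r / b n = t * (K * kap i)); last first.
    by rewrite /t /y a_kap//; field; rewrite !gt_eqF.
  have Kk : 0 < K * kap i by rewrite mulr_gt0.
  rewrite (powRM _ (ltW t0) (ltW Kk)) mulrCA ler_peMr ?powR_ge0//.
  rewrite powRN ler_pdivlMr ?powR_gt0// mul1r; apply: ge0_ler_powR => //.
  - by rewrite nnegrE ltW.
  - by rewrite nnegrE ltW.
  by apply: ler_wpM2l; [exact: ltW|exact: kap_le].
apply: (@le_trans _ _ (2 * (CQ / b n ^+ d) * (expR (9 * M) *
   (Lam `^ (c * K) * (r / b n) `^ (- (c * K)))))).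
  apply: ler_wpM2l; first by rewrite mulr_ge0.
  by apply: le_trans bound; rewrite ler_expR.
by rewrite le_eqVlt; apply/orP; left; apply/eqP; ring.
Qed.

Variables (phi : R -> R) (gamma : R).
Hypothesis gamma_gt0 : 0 < gamma.
Hypothesis phi_sv : pos_slowly_varying phi.
Let psi := @local_rate R d phi gamma.
Hypothesis X_local : forall z : 'rV[int]_d, z != 0 -> p z <= psi (l1norm R z).

Local Ltac drop_local := clear - X_iid d_gt0 al02 tails scal a_unbounded kap_gt0 a_kap b_gt0 CQ_gt0 half_bound
  gamma_gt0 phi_sv X_local kap_le kmax1 mX drf f psi.

Lemma small_jump_gaussian : al = 2 -> exists2 M : R, 1 <= M &
  forall K : R, 1 <= K -> exists C c r0 : R, [/\ 0 < C, 0 < c &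
  forall (n N : nat) (x w : 'rV[int]_d), M <= n%:R -> r0 <= l1norm R x ->
    (forall i, `|(w 0 i)%:~R - (x 0 i)%:~R - drf i n| <= 1) ->
    let r := l1norm R x in let del := n%:R * (r ^+ d * psi r) in del < 1 ->
    path_sum (box d N) (f (r / K)) n (fun u => (u == w)%:R) <=
      C / b n ^+ d * (expR (- (c * (r / b n) ^+ 2)) + del `^ (K / (16 * d%:R)))].
Proof.
move=> al2; have dR : (0 : R) < d%:R by rewrite ltr0n d_gt0.
have [M M1 hM] := uniform_gaussian_regime al2.
have M0 : 0 < M by lra.
exists M => // K K1; have K0 : 0 < K by lra.
have km1 := kmax1; have km0 : 0 < kmax by lra.
(* The order of the moment that controls the steps beyond level 1/s; it is large enough for norms
   close to [y] to dominate. *)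
have [k kd] : exists k : nat, d%:R + gamma + 1 <= k%:R.
  by exists (Num.truncn (d%:R + gamma + 1)).+1; apply/ltW; exact: truncnS_gt.
have k0 : (0 < k)%N.
  by have g0 := gamma_gt0; rewrite -(ltr_nat R); apply: lt_le_trans kd; lra.
have [y1 [C2 [y11 C20 hmom]]] := truncated_moment_sum X_iid gamma_gt0 phi_sv X_local kd.
have [x0 [C3 [x00 C31 hpot]]] := @local_rate_potter R d phi gamma gamma_gt0 phi_sv.
have C30 : 0 < C3 by lra.
pose E := 2 * expR 1 : R.
have E1 : 1 <= E.
  have : 1 <= expR 1 :> R by rewrite -expR0 ler_expR.
  by rewrite /E; lra.
have E0 : 0 < E by lra.
pose A := E * M * kmax ^+ 2.
have A0 : 0 < A by rewrite !mulr_gt0// exprn_gt0.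
(* The gain is s r / (4d), and s <= eta r / a_n^2 makes the quadratic term at most half of it. *)
pose eta := (8 * d%:R * A)^-1.
have eta0 : 0 < eta by rewrite invr_gt0 !mulr_gt0.
pose C3' := C3 * K `^ (2 * (d%:R + gamma)).
have C3'0 : 0 < C3' by rewrite mulr_gt0// powR_gt0.
pose B := E * M + C2 * C3' * k`!%:R.
pose c := eta / (8 * d%:R).
have c0 : 0 < c by rewrite divr_gt0// mulr_gt0.
exists (2 * CQ * expR B), c, (2 * d%:R + K * (y1 + x0)); split=> //.
  by rewrite !mulr_gt0// expR_gt0.
move=> n N x w Mn r0x wD r del del1.
have n0 : (0 < n)%N by rewrite -(ltr_nat R); lra.
have nR : (0 : R) < n%:R by rewrite ltr0n.
have b0 := b_gt0 n0.
have Kyx : 0 < K * (y1 + x0) by apply: mulr_gt0 => //; move: y11 x00; drop_local; lra.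
have xd : 2 * d%:R <= l1norm R x by move: r0x Kyx; drop_local; lra.
have [i [eps [eps1 hrho]]] := large_coordinate xd wD.
have r_gt0 : 0 < r by apply: lt_le_trans xd; rewrite mulr_gt0.
pose y := r / K.
have y0 : 0 < y by rewrite divr_gt0.
have yr : y <= r by rewrite ler_pdivrMr// ler_peMr// ltW.
have yx : y1 + x0 <= y.
  by rewrite ler_pdivlMr// mulrC; apply: le_trans r0x; rewrite lerDr mulr_ge0// ltW.
have psir := @local_rate_gt0 R d phi gamma phi_sv r r_gt0.
have psiy := @local_rate_gt0 R d phi gamma phi_sv y y0.
have psiyr : psi y <= C3' * psi r.
  have [|_] := hpot y r _ yr; first by move: yx y11; drop_local; lra.
  by rewrite (_ : r / y = K)// /y invf_div mulrC divfK ?gt_eqF.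
have rpsi0 : 0 < r ^+ d * psi r by apply: mulr_gt0 => //; exact: exprn_gt0.
have ypsi0 : 0 < y ^+ d * psi y by apply: mulr_gt0 => //; exact: exprn_gt0.
have del0 : 0 < del by exact: mulr_gt0.
(* Thus del = e^(-2h), and a tilt with s y <= h gives a step of norm at most [y] a weight of at most
   e^h. *)
pose h := - ln del / 2.
have h0 : 0 < h by rewrite divr_gt0// oppr_gt0 ln_lt0// del0.
have delE q : del `^ q = expR (- (2 * h * q)).
  by rewrite /powR gt_eqF// /h; congr expR; field.
pose s1 := eta * r / b n ^+ 2.
pose s2 := h / y.
pose s := Num.min s1 s2.
have s10 : 0 < s1 by rewrite divr_gt0 ?mulr_gt0// exprn_gt0.
have s20 : 0 < s2 by rewrite divr_gt0.
have s0 : 0 < s by rewrite lt_min s10 s20.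
have ss1 : s <= s1 by rewrite ge_min lexx.
have ss2 : s <= s2 by rewrite ge_min lexx orbT.
have syh : s * y <= h by rewrite -ler_pdivlMr.
have sV0 : 0 < s^-1 by rewrite invr_gt0.
pose rem (z : 'rV[int]_d) := (s * l1norm R z) ^+ k * expR h.
have sl0 z : 0 <= s * l1norm R z by rewrite mulr_ge0 ?l1norm_ge0// ltW.
have rem0 z : 0 <= rem z by rewrite mulr_ge0 ?expR_ge0// exprn_ge0.
(* The quadratic expansion stops at level 1/s. Beyond it s |z| > 1, so the factor (s |z|)^k in [rem]
   is at least 1 and turns the remainder into a moment of order [k]. *)
have mgf := @small_jump_mgf R d disp Om P X X_iid N i eps y s s^-1 rem eps1
  (ltW s0) (ltW sV0) rem0.
have {mgf} : \sum_(z <- box d N) f y z * expR (s * (eps * (z 0 i)%:~R)) <=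
  expR (s * (eps * trunc_mean P (Defs.coord (X 0%N) i) s^-1) +
   (2 * (s ^+ 2 * expR 1 * trunc_abs_moment P (X 0%N) i 2 s^-1) +
    \sum_(z <- box d N) f y z * rem z)).
  move: mgf; rewrite (divff (lt0r_neq0 s0)); apply=> z zy.
  rewrite -[X in X < _]mul1r ltr_pdivrMr// mulrC => zs.
  have zl : s * `|(z 0 i)%:~R| <= s * l1norm R z by rewrite ler_pM2l// coord_le_l1norm.
  apply: (@le_trans _ _ (1 * expR h)).
    rewrite mul1r ler_expR; apply: le_trans syh; rewrite ler_pM2l//.
    apply: le_trans (ler_norm _) _; rewrite normrM eps1 mul1r.
    by apply: le_trans zy; exact: coord_le_l1norm.
  rewrite -[leLHS]add0r; apply: lerD => //; rewrite ler_pM2r ?expR_gt0//.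
  by rewrite exprn_ege1// (le_trans (ltW zs)).
set mu := trunc_mean P _ _; set tm2 := trunc_abs_moment P _ i 2 _.
set Sg := \sum_(z <- box d N) f y z * rem z; set W := 2 * _ + Sg => mgf.
have Sg0 : 0 <= Sg.
  by apply: sumr_ge0 => z _; rewrite mulr_ge0// mulr_ge0// pmf_ge0.
have tm20 : 0 <= tm2 by exact: trunc_abs_moment_ge0.
have W0 : 0 <= W.
  apply: addr_ge0 => //; apply: mulr_ge0 => //; apply: mulr_ge0 => //.
  by rewrite mulr_ge0 ?expR_ge0// sqr_ge0.
have Q0 : 0 <= CQ / b n ^+ d by rewrite divr_ge0 ?exprn_ge0// ltW.
pose T := n%:R * `|mu - mean P (Defs.coord (X 0%N) i)|.
have hT : `|n%:R * mu - drf i n| <= T.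
  have l21 : ((2 : R) < 1) = false by apply/negbTE; rewrite -leNgt ler1n.
  have e21 : ((2 : R) == 1) = false by rewrite gt_eqF// ltr1n.
  by rewrite /drf /centering al2 l21 e21 -mulrBr normrM ger0_norm.
apply: le_trans (small_jump_split X_iid eps1 n0 (ltW s0) W0 Q0 _ mgf hT hrho) _.
  by move=> m v mn nm; exact: half_bound.
(* The remainder costs a constant: h^k e^h <= k! e^(2h), while n y^d psi(y) is at most a multiple of
   del = e^(-2h). *)
have nSg : n%:R * Sg <= C2 * C3' * k`!%:R.
  have -> : Sg = s ^+ k * expR h *
      \sum_(z <- box d N) f y z * l1norm R z ^+ k.
    rewrite mulr_sumr; apply: eq_bigr => z _; rewrite /rem exprMn; ring.
  have y1y : y1 <= y by move: yx x00; drop_local; lra.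
  have c1 : 0 <= n%:R * (s ^+ k * expR h).
    by rewrite !mulr_ge0 ?expR_ge0// exprn_ge0// ltW.
  rewrite mulrA; apply: le_trans (ler_wpM2l c1 (hmom y N y1y)) _.
  rewrite [leLHS](_ : _ = C2 * ((s * y) ^+ k * expR h) * (n%:R * (y ^+ d * psi y))); last first.
    by rewrite (exprMn k s y) /psi; ring.
  have step1 : n%:R * (y ^+ d * psi y) <= C3' * expR (- (2 * h)).
    rewrite -[2 * h]mulr1 -delE powRr1 ?(ltW del0)// /del.
    rewrite [leRHS]mulrCA ler_pM2l// [leRHS]mulrCA; apply: ler_pM => //.
    - by rewrite exprn_ge0// ltW.
    - exact: ltW.
    by apply: lerXn2r => //; rewrite nnegrE ltW.
  have step2 : (s * y) ^+ k * expR h <= k`!%:R * expR (2 * h).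
    rewrite expRM_natl expr2 mulrA; apply: ler_wpM2r; first exact: expR_ge0.
    apply: (@le_trans _ _ (h ^+ k)).
      by apply: lerXn2r; rewrite ?nnegrE//; [apply: mulr_ge0; exact: ltW|exact: ltW].
    have := expR_ge1Dxn k.-1 (ltW h0); rewrite prednK// => hx.
    rewrite -ler_pdivrMl ?ltr0n ?fact_gt0// mulrC.
    by apply: le_trans hx; rewrite lerDr.
  apply: (@le_trans _ _ (C2 * (k`!%:R * expR (2 * h)) * (C3' * expR (- (2 * h))))).
    apply: ler_pM => //.
      apply: mulr_ge0; first exact: ltW.
      apply: mulr_ge0; last exact: expR_ge0.
      by apply: exprn_ge0; apply: mulr_ge0; exact: ltW.
    - by apply: mulr_ge0 => //; exact: ltW.
    by rewrite ler_pM2l.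
  have e1 := expRxMexpNx_1 (2 * h).
  rewrite [leLHS](_ : _ = C2 * C3' * k`!%:R * (expR (2 * h) * expR (- (2 * h)))); last by ring.
  by rewrite e1 mulr1.
have main : s * T + n%:R * (2 * (s ^+ 2 * expR 1 * tm2)) <=
    E * (M * ((a i n * s) ^+ 2 + 1)).
  have := hM i n s^-1 Mn sV0; rewrite exprVn !invrK -/mu -/tm2 => hmM.
  apply: le_trans (ler_wpM2l (ltW E0) hmM).
  rewrite mulrDr mulrDr; apply: lerD.
    rewrite -[leLHS]mul1r; apply: ler_pM => //.
      by rewrite !mulr_ge0// ltW.
    by rewrite /T le_eqVlt; apply/orP; left; apply/eqP; ring.
  by rewrite le_eqVlt; apply/orP; left; apply/eqP; rewrite /E; ring.
have quad : E * (M * (a i n * s) ^+ 2) <= s * r / (8 * d%:R).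
  apply: (@le_trans _ _ (A * (s * (s * b n ^+ 2)))).
    rewrite /A (a_kap i n0) [leLHS](_ : _ = E * M * kap i ^+ 2 * (s * (s * b n ^+ 2))); last by ring.
    apply: ler_wpM2r; first by rewrite !mulr_ge0 ?sqr_ge0// ltW.
    rewrite ler_pM2l ?mulr_gt0//; apply: lerXn2r; rewrite ?nnegrE ?kap_le//.
      exact: ltW (kap_gt0 i).
    exact: ltW.
  have : s * b n ^+ 2 <= eta * r by rewrite -ler_pdivlMr ?exprn_gt0.
  move=> hs; apply: (@le_trans _ _ (A * (s * (eta * r)))).
    by rewrite ler_pM2l// ler_pM2l.
  rewrite le_eqVlt; apply/orP; left; apply/eqP; rewrite /eta; field.
  by rewrite !gt_eqF.
have exp_le : - (s * (r / (2 * d%:R)) / 2) + s * T + n%:R * W <=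
    B - s * r / (8 * d%:R).
  have -> : s * (r / (2 * d%:R)) / 2 = 2 * (s * r / (8 * d%:R)).
    by field; rewrite gt_eqF.
  rewrite /W /B (mulrDr n%:R).
  have mainE : E * (M * ((a i n * s) ^+ 2 + 1)) = E * (M * (a i n * s) ^+ 2) + E * M.
    by ring.
  by move: main quad nSg; rewrite mainE; drop_local; lra.
have bound : expR (B - s * r / (8 * d%:R)) <=
    expR B * (expR (- (c * (r / b n) ^+ 2)) + del `^ (K / (16 * d%:R))).
  rewrite expRD ler_pM2l ?expR_gt0//.
  (* For s = s1 the exponent s r / (8d) is c (r / a_n)^2; for s = s2 it is h K / (8d), which gives
     the power of [del]. *)
  have [s12|s21] := leP s1 s2.
    have -> : s = s1 by rewrite /s; apply/min_idPl.
    apply: (@le_trans _ _ (expR (- (c * (r / b n) ^+ 2)))); last first.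
      by rewrite lerDl powR_ge0.
    rewrite le_eqVlt; apply/orP; left; apply/eqP; congr (expR (- _)).
    by rewrite /s1 /c; field; rewrite !gt_eqF.
  have -> : s = s2 by rewrite /s; apply/min_idPr; exact: ltW.
  apply: (@le_trans _ _ (del `^ (K / (16 * d%:R)))); last first.
    by rewrite lerDr expR_ge0.
  rewrite delE le_eqVlt; apply/orP; left; apply/eqP; congr (expR (- _)).
  by rewrite /s2 /y; field; rewrite !gt_eqF.
apply: (@le_trans _ _ (2 * (CQ / b n ^+ d) * (expR B *
   (expR (- (c * (r / b n) ^+ 2)) + del `^ (K / (16 * d%:R)))))).
  apply: ler_wpM2l; first by rewrite mulr_ge0.
  by apply: le_trans bound; rewrite ler_expR.
by rewrite le_eqVlt; apply/orP; left; apply/eqP; ring.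
Qed.

End SmallJumpBounds.

(** * Local large deviations *)

Section LocalLargeDeviations.
Context {R : realType} {d : nat} {disp : measure_display}
  {Om : measurableType disp}.
Variable P : probability Om R.
Variable X : nat -> Om -> 'rV[int]_d.
Hypothesis X_iid : iid P X.
Hypothesis d_gt0 : (0 < d)%N.
Variables (al : R) (L : 'I_d -> R -> R) (pr qr : 'I_d -> R) (a : 'I_d -> nat -> R).
Hypothesis al02 : 0 < al <= 2.
Hypothesis tails : forall i,
  regular_tails P (Defs.coord (X 0%N) i) al (L i) (pr i) (qr i).
Hypothesis scal : forall i, scaling P (Defs.coord (X 0%N) i) al (L i) (a i).
Hypothesis a_unbounded : forall i (M : R), exists N : nat,
  forall n, (N <= n)%N -> M <= a i n.
Variables (b : nat -> R) (kap : 'I_d -> R).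
Hypothesis kap_gt0 : forall i, 0 < kap i.
Hypothesis a_kap : forall i n, (0 < n)%N -> a i n = kap i * b n.
Hypothesis b_gt0 : forall n, (0 < n)%N -> 0 < b n.
Variable CQ : R.
Hypothesis CQ_gt0 : 0 < CQ.
Hypothesis half_bound : forall n m v, (0 < n)%N -> (m <= n)%N ->
  (n <= m.*2.+1)%N -> Pr P [set o | walk X m o = v] <= CQ / b n ^+ d.
Variables (phi : R -> R) (gamma : R).
Hypothesis gamma_gt0 : 0 < gamma.
Hypothesis phi_sv : pos_slowly_varying phi.
Let p (z : 'rV[int]_d) : R := Pr P [set w | X 0%N w = z].
Let psi := @local_rate R d phi gamma.
Hypothesis X_local : forall z : 'rV[int]_d, z != 0 -> p z <= psi (l1norm R z).

Let f (y : R) (z : 'rV[int]_d) : R := p z * (l1norm R z <= y)%R%:R.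
Let drf (i : 'I_d) n := centering P (Defs.coord (X 0%N) i) al (a i) n.

Let mX j : discrete_rv (X j). Proof. by have [mX _ _] := X_iid; exact: mX. Qed.

Let psi_gt0 (r : R) : 0 < r -> 0 < psi r. Proof. exact: local_rate_gt0. Qed.

Let f_bounds y z : 0 <= f y z <= p z.
Proof.
rewrite mulr_ge0 ?pmf_ge0//=; apply: ler_piMr; first exact: pmf_ge0.
by rewrite lern1 leq_b1.
Qed.

Local Ltac drop_local := clear - X_iid d_gt0 al02 tails scal a_unbounded kap_gt0 a_kap b_gt0 CQ_gt0 half_bound
  gamma_gt0 phi_sv X_local mX psi_gt0 f_bounds drf.

Lemma truncated_le_local_bound (N n : nat) (y : R) w : (0 < n)%N ->
  path_sum (box d N) (f y) n (fun u => (u == w)%:R) <= CQ / b n ^+ d.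
Proof.
move=> n0; have nn : (n <= n.*2.+1)%N by clear; lia.
apply: le_trans (half_bound w n0 (leqnn n) nn).
apply: le_trans (path_sum_le_Pr X_iid n w (box_uniq N)).
exact: ler_path_sum_weight.
Qed.

(** In one coordinate the tail is at least 1/n times a power of a_n / r, by regular variation, and
    at most of order r^d psi(r), by the pointwise bound. The two together keep n r^d psi(r) above a
    power of a_n / r. *)
Lemma local_tail_control : al < 2 -> exists M C Q r0 : R,
  [/\ 1 <= M, 0 < C, 0 <= Q & forall (n : nat) (r : R), M <= n%:R -> r0 <= r ->
    b n <= r -> 1 <= C * (r / b n) `^ Q * (n%:R * (r ^+ d * psi r))].
Proof.
move=> al2.
have decay i : exists s C1 x1 : R, [/\ 0 < s, 0 <= C1, 0 < x1 &
    forall lam y : R, 1 <= lam -> x1 <= y ->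
    abs_tail P (X 0%N) i (lam * y) <= C1 * lam `^ (- s) * abs_tail P (X 0%N) i y].
  have [s [Q [C1 [x1 [n0 [s0 C10 x10 h _]]]]]] := tail_regularity (mX 0%N) al02
    (tails i) (scal i) (a_unbounded i) al2.
  by exists s, C1, x1.
have [y0 [C2 [y00 C20 hG]]] :=
  abs_tail_local X_iid gamma_gt0 phi_sv X_local d_gt0 decay.
have [x0 [C3 [x00 C31 hpot]]] := @local_rate_potter R d phi gamma gamma_gt0 phi_sv.
have C30 : 0 < C3 by lra.
pose i := Ordinal d_gt0.
have [s [Q [C1 [x1 [n0 [s0 C10 x10 _ h]]]]]] := tail_regularity (mX 0%N) al02
    (tails i) (scal i) (a_unbounded i) al2.
have k0 := kap_gt0 i.
(* The level k r is above [r], where psi is compared, and above [a i n = kap i * b n], where the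
   lower bound on the tail starts. *)
pose k := 1 + kap i.
have k1 : 1 <= k by rewrite /k; lra.
have kk0 : 0 < k by lra.
pose Q' := `|Q|.
pose C := (1 + C1) * (k / kap i) `^ Q' * (C2 * (k ^+ d * C3)).
exists (1 + n0%:R), C, Q', (x0 + y0); split => //.
- by rewrite lerDl.
- rewrite !mulr_gt0 ?exprn_gt0 ?powR_gt0 ?divr_gt0//; lra.
- exact: normr_ge0.
move=> n r Mn hr br.
have nn0 : (n0 <= n)%N by rewrite -(ler_nat R); lra.
have n1 : (0 < n)%N by rewrite -(ltr_nat R); have := ler0n R n0; lra.
have b0 := b_gt0 n1.
have r0 : 0 < r by lra.
have x0r : x0 <= r by move: hr y00; drop_local; lra.
have y0r : y0 <= r by move: hr x00; drop_local; lra.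
have kr : r <= k * r by rewrite ler_peMl// ltW.
have akr : a i n <= k * r.
  rewrite a_kap//; apply: ler_pM => //; [exact: ltW|exact: ltW|by rewrite /k; lra].
have y0kr := le_trans y0r kr.
have [psi_le _] := hpot r (k * r) x0r kr.
have Gle : abs_tail P (X 0%N) i (k * r) <= C2 * (k ^+ d * C3) * (r ^+ d * psi r).
  apply: le_trans (hG (k * r) i y0kr) _.
  rewrite [leRHS](_ : _ = C2 * ((k * r) ^+ d * (C3 * psi r))).
    by rewrite ler_pM2l// ler_pM2l ?exprn_gt0// mulr_gt0.
  by rewrite (exprMn d k r); ring.
have t1 : 1 <= k * r / a i n.
  by rewrite ler_pdivlMr ?mul1r// a_kap// mulr_gt0.
have tE : k * r / a i n = k / kap i * (r / b n).
  by rewrite a_kap//; field; rewrite !gt_eqF.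
apply: le_trans (h n nn0 (k * r) akr) _.
have -> : C * (r / b n) `^ Q' * (n%:R * (r ^+ d * psi r)) =
   (1 + C1) * (k / kap i * (r / b n)) `^ Q' *
   (n%:R * (C2 * (k ^+ d * C3) * (r ^+ d * psi r))).
  have k_ge0 : 0 <= k / kap i by rewrite divr_ge0// ltW.
  have rb_ge0 : 0 <= r / b n by rewrite divr_ge0// ltW.
  by rewrite (powRM Q' k_ge0 rb_ge0) /C; ring.
rewrite -tE; apply: ler_pM.
- by rewrite mulr_ge0// powR_ge0.
- by rewrite mulr_ge0//; exact: abs_tail_ge0.
- apply: ler_pM => //; first exact: powR_ge0.
    by rewrite lerDr.
  by apply: ler_powR => //; exact: ler_norm.
- exact: ler_wpM2l.
Qed.

Lemma truncated_heavy : al < 2 -> exists M : R, 1 <= M /\ exists K C r0 : R,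
  [/\ 4 * M <= K, 1 <= K, 0 < C & forall (n N : nat) (x w : 'rV[int]_d),
    M <= n%:R -> r0 <= l1norm R x -> b n <= l1norm R x ->
    (forall i, `|(w 0 i)%:~R - (x 0 i)%:~R - drf i n| <= 1) ->
    path_sum (box d N) (f (l1norm R x / K)) n (fun u => (u == w)%:R) <=
      C * (n%:R * psi (l1norm R x))].
Proof.
move=> al2.
have [M1 [c [M11 c0 hpoly]]] := small_jump_polynomial X_iid d_gt0 al02 tails scal
  a_unbounded kap_gt0 a_kap b_gt0 CQ_gt0 half_bound.
have [M2 [Ct [Q [r1 [M21 Ct0 Q0 htail]]]]] := local_tail_control al2.
exists (M1 + M2); split; first by lra.
have dR : (0 : R) <= d%:R by [].
have q0 : 0 <= (d%:R + Q) / c by rewrite divr_ge0 ?addr_ge0// ltW.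
(* The first summand serves the walks with fewer than [M] steps; the second gives c K >= d + Q. *)
pose K := 4 * (M1 + M2) + (d%:R + Q) / c.
have K1 : 1 <= K by rewrite /K; lra.
have [C [Lam [C0 Lam0 hsmall]]] := hpoly K K1.
pose U := (1 + Lam) `^ (d%:R + Q).
have U0 : 0 < U by rewrite powR_gt0//; lra.
exists K, ((C + CQ * U) * Ct), (2 * d%:R + `|r1| + 1); split => //.
- by rewrite /K lerDl.
- by rewrite mulr_gt0// addr_gt0// mulr_gt0.
move=> n N x w Mn hr br wD; set r := l1norm R x in hr br *.
have r1r : r1 <= r by have := ler_norm r1; lra.
have r0 : 0 < r by have := normr_ge0 r1; lra.
have n0 : (0 < n)%N by rewrite -(ltr_nat R); lra.
have b0 := b_gt0 n0; have ps := psi_gt0 r0.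
pose t := r / b n.
have t0 : 0 < t by rewrite divr_gt0.
have t1 : 1 <= t by rewrite ler_pdivlMr// mul1r.
pose Y := n%:R * psi r.
have Y0 : 0 <= Y by apply: mulr_ge0 => //; exact: ltW.
(* One writes a_n^-d = t^d r^-d, and the tail control bounds r^-d by Ct t^Q times the jump term
   [Y]. *)
have bd : (b n ^+ d)^-1 <= Ct * t `^ (d%:R + Q) * Y.
  have M2n : M2 <= n%:R by move: Mn M11; drop_local; lra.
  have := htail n r M2n r1r br; rewrite -/t => ht.
  have bE : (b n ^+ d)^-1 = t ^+ d / r ^+ d.
    by rewrite /t expr_div_n mulrAC divff ?mul1r// gt_eqF// exprn_gt0.
  rewrite bE -[leLHS]mulr1.
  have c1 : 0 <= t ^+ d / r ^+ d.
    by apply: divr_ge0; apply: exprn_ge0; exact: ltW.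
  apply: le_trans (ler_wpM2l c1 ht) _.
  rewrite le_eqVlt; apply/orP; left; apply/eqP; rewrite /Y powRD; last first.
    by rewrite (gt_eqF t0) implybT.
  rewrite powR_mulrn ?(ltW t0)//; field.
  by rewrite expf_neq0// gt_eqF.
(* Below Lam a_n the ratio [t] is bounded, and the local bound alone suffices. *)
have [rL|Lr] := leP (Lam * b n) r; last first.
  apply: le_trans (truncated_le_local_bound _ _ _ n0) _.
  apply: le_trans (_ : CQ * (Ct * U * Y) <= _).
    apply: ler_wpM2l; first exact: ltW.
    apply: le_trans bd _; apply: ler_wpM2r => //; rewrite ler_pM2l//.
    apply: ge0_ler_powR; rewrite ?addr_ge0// ?nnegrE ?(ltW t0)//; first by lra.
    by rewrite /t ler_pdivrMr//; apply: le_trans (ltW Lr) _; rewrite ler_pM2r//; move: Lam0; drop_local; lra.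
  rewrite (_ : CQ * _ = CQ * U * Ct * Y); last by ring.
  apply: ler_wpM2r => //; rewrite ler_pM2r// lerDr; exact: ltW.
have nM : M1 <= n%:R by move: Mn M21; drop_local; lra.
apply: le_trans (hsmall n N x w nM _ rL wD) _; first by move: hr (normr_ge0 r1); drop_local; lra.
rewrite -/t -mulrA; apply: le_trans (_ : C * (Ct * Y) <= _).
  apply: ler_wpM2l; first exact: ltW.
  apply: (@le_trans _ _ (Ct * t `^ (d%:R + Q) * Y * t `^ (- (d%:R + Q)))).
    apply: ler_pM => //.
    - by rewrite invr_ge0 exprn_ge0// ltW.
    - exact: powR_ge0.
    apply: powR_neg_le => //; rewrite /K mulrDr [c * (_ / c)]mulrC divfK ?gt_eqF//.
    by rewrite lerDr mulr_ge0//; move: c0 M11 M21; drop_local; lra.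
  rewrite powRN (_ : _ * _ = Ct * Y * (t `^ (d%:R + Q) / t `^ (d%:R + Q))); last by ring.
  by rewrite divff ?mulr1// gt_eqF// powR_gt0.
by rewrite mulrA; apply: ler_wpM2r => //; rewrite ler_pM2r// lerDl mulr_ge0// ltW.
Qed.

Lemma truncated_gaussian : al = 2 -> exists M : R, 1 <= M /\ exists K C c r0 : R,
  [/\ 4 * M <= K, 1 <= K, 0 < C, 0 < c & forall (n N : nat) (x w : 'rV[int]_d),
    M <= n%:R -> r0 <= l1norm R x -> b n <= l1norm R x ->
    (forall i, `|(w 0 i)%:~R - (x 0 i)%:~R - drf i n| <= 1) ->
    path_sum (box d N) (f (l1norm R x / K)) n (fun u => (u == w)%:R) <=
      C * (n%:R * psi (l1norm R x)) +
      C / b n ^+ d * expR (- (c * (l1norm R x / b n) ^+ 2))].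
Proof.
move=> al2.
have [M1 [c [M11 c0 hpoly]]] := small_jump_polynomial X_iid d_gt0 al02 tails scal
  a_unbounded kap_gt0 a_kap b_gt0 CQ_gt0 half_bound.
have [M2 M21 hgauss] := small_jump_gaussian X_iid d_gt0 al02 tails scal
  a_unbounded kap_gt0 a_kap b_gt0 CQ_gt0 half_bound gamma_gt0 phi_sv X_local al2.
exists (M1 + M2); split; first by lra.
have dR : (0 : R) < d%:R by rewrite ltr0n.
have q0 : 0 <= (d%:R + 1) / c by rewrite divr_ge0 ?addr_ge0// ltW.
have d2 : 0 <= 16 * d%:R * (d%:R + 1) :> R by rewrite !mulr_ge0 ?addr_ge0.
(* The three summands serve the walks with fewer than [M] steps, c K >= d + 1 in the polynomial
   bound, and K / (16 d) >= d + 1 for the power of [del]. *)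
pose K := 4 * (M1 + M2) + (d%:R + 1) / c + 16 * d%:R * (d%:R + 1).
have K1 : 1 <= K by rewrite /K; lra.
have [C [Lam [C0 Lam0 hsmall]]] := hpoly K K1.
have [Cg [cg [rg [Cg0 cg0 hg]]]] := hgauss K K1.
pose U := expR (cg * Lam ^+ 2).
have U0 : 0 < U by exact: expR_gt0.
have CU0 : 0 < CQ * U by rewrite mulr_gt0.
pose C' := C + Cg + CQ * U.
have C'0 : 0 < C' by rewrite /C'; lra.
exists K, C', cg, (2 * d%:R + `|rg| + 1); split => //.
  by rewrite /K; lra.
move=> n N x w Mn hr br wD; set r := l1norm R x in hr br *.
have nrg := normr_ge0 rg.
have rgr : rg <= r by move: (ler_norm rg) hr (ler0n R d); drop_local; lra.
have r0 : 0 < r by move: hr nrg (ler0n R d); drop_local; lra.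
have n0 : (0 < n)%N by rewrite -(ltr_nat R); move: Mn M11 M21; drop_local; lra.
have b0 := b_gt0 n0; have ps := psi_gt0 r0.
pose t := r / b n.
have t0 : 0 < t by rewrite divr_gt0.
have t1 : 1 <= t by rewrite ler_pdivlMr// mul1r.
pose Y := n%:R * psi r.
have Y0 : 0 <= Y by apply: mulr_ge0 => //; exact: ltW.
have rd0 : 0 < r ^+ d by exact: exprn_gt0.
have td0 : 0 < t ^+ d by exact: exprn_gt0.
have bd0 : 0 < (b n ^+ d)^-1 by rewrite invr_gt0 exprn_gt0.
have bE : (b n ^+ d)^-1 = t ^+ d / r ^+ d.
  by rewrite /t expr_div_n mulrAC divff ?mul1r// gt_eqF.
have e0 : 0 < expR (- (cg * t ^+ 2)) by exact: expR_gt0.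
have G0 : 0 <= (b n ^+ d)^-1 * expR (- (cg * t ^+ 2)) by rewrite mulr_ge0// ltW.
have jump_part (z : R) : z <= (C + Cg) * Y ->
    z <= C' * Y + C' / b n ^+ d * expR (- (cg * t ^+ 2)).
  move=> /le_trans; apply; rewrite -[leLHS]addr0 -mulrA; apply: lerD.
    by apply: ler_wpM2r => //; move: CU0; rewrite /C'; drop_local; lra.
  by apply: mulr_ge0 => //; exact: ltW.
have [rL|Lr] := leP (Lam * b n) r; last first.
  apply: le_trans (truncated_le_local_bound _ _ _ n0) _.
  rewrite -[leLHS]add0r; apply: lerD; first by apply: mulr_ge0 => //; exact: ltW.
  rewrite mulrAC ler_pM2r// (le_trans (_ : _ <= CQ * U * expR (- (cg * t ^+ 2))))//.
    rewrite -mulrA -[leLHS]mulr1 ler_pM2l// -expRD -[leLHS]expR0 ler_expR.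
    rewrite -mulrBr mulr_ge0 ?(ltW cg0)// subr_ge0.
    apply: lerXn2r; rewrite ?nnegrE ?(ltW t0) ?(ltW Lam0)//.
    by rewrite /t ler_pdivrMr// ltW.
  by rewrite ler_pM2r//; move: C0 Cg0; rewrite /C'; drop_local; lra.
pose del := n%:R * (r ^+ d * psi r).
have nR : (0 : R) < n%:R by rewrite ltr0n.
have del0 : 0 < del by rewrite mulr_gt0// mulr_gt0.
have delY : del / r ^+ d = Y.
  by rewrite /del /Y; field; rewrite gt_eqF.
have nM1 : M1 <= n%:R by move: Mn M21; drop_local; lra.
have nM2 : M2 <= n%:R by move: Mn M11; drop_local; lra.
(* For del >= 1/t the polynomial bound suffices: a_n^-d t^-(d+1) = r^-d / t <= r^-d del, which is
   the jump term. *)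
have [td|td] := leP t^-1 del.
  apply: jump_part; apply: le_trans (hsmall n N x w nM1 _ rL wD) _; first by move: hr nrg; drop_local; lra.
  rewrite -/r -/t; apply: (@le_trans _ _ (C * Y)); last first.
    by apply: ler_wpM2r => //; move: Cg0; drop_local; lra.
  rewrite -mulrA ler_pM2l//; apply: (@le_trans _ _ ((b n ^+ d)^-1 * t `^ (- (d%:R + 1)))).
    rewrite ler_pM2l//; apply: powR_neg_le => //.
    rewrite /K !mulrDr [c * (_ / c)]mulrC divfK ?gt_eqF//.
    have x1 : 0 <= c * (4 * (M1 + M2)) by rewrite mulr_ge0//; [exact: ltW|move: M11 M21; drop_local; lra].
    have x2 : 0 <= c * (16 * d%:R * (d%:R + 1)) by rewrite mulr_ge0// ltW.
    by move: x1 x2; rewrite !mulrDr; drop_local; lra.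
  rewrite -delY bE powRN powRD; last by rewrite (gt_eqF t0) implybT.
  rewrite powRr1 ?(ltW t0)// powR_mulrn ?(ltW t0)// invfM.
  rewrite (_ : _ * _ = t^-1 / r ^+ d); last by field; rewrite !gt_eqF.
  by apply: ler_wpM2r => //; rewrite invr_ge0 ltW.
have tV1 : t^-1 <= 1 by rewrite invf_le1.
have del1 : del < 1 by move: td tV1; drop_local; lra.
apply: le_trans (hg n N x w nM2 rgr wD del1) _.
rewrite -/r -/t -/del mulrDr addrC; apply: lerD; last first.
  rewrite -mulrA -[leRHS]mulrA; apply: ler_wpM2r => //; move: C0 CU0; rewrite /C'; drop_local; lra.
rewrite -mulrA; apply: ler_pM => //.
- exact: ltW.
- by rewrite mulr_ge0 ?powR_ge0// ltW.
- by move: C0 CU0; rewrite /C'; drop_local; lra.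
(* Here t del < 1, and a_n^-d del^(d+1) = r^-d del (t del)^d is at most the jump term. *)
apply: (@le_trans _ _ ((b n ^+ d)^-1 * (del * del ^+ d))).
  rewrite ler_pM2l//.
  have -> : del * del ^+ d = del `^ (d%:R + 1).
    rewrite powRD; last by rewrite (gt_eqF del0) implybT.
    by rewrite powRr1 ?(ltW del0)// powR_mulrn ?(ltW del0)// mulrC.
  apply: ger_powR; first by rewrite del0 ltW.
  rewrite ler_pdivlMr; last by rewrite mulr_gt0.
  by move: M11 M21 q0; rewrite /K; drop_local; lra.
rewrite -/Y -delY bE [leLHS](_ : _ = del / r ^+ d * (t * del) ^+ d); last first.
  by rewrite (exprMn d t del); ring.
apply: ler_piMr.
  by rewrite divr_ge0// ltW.
apply: exprn_ile1; first by rewrite mulr_ge0// ltW.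
by rewrite -ler_pdivlMl// mulr1 ltW.
Qed.

Lemma truncated_bound : exists M : R, 1 <= M /\ exists K C c r0 : R,
  [/\ 4 * M <= K, 1 <= K, 0 < C, 0 < c & forall (n N : nat) (x w : 'rV[int]_d),
    M <= n%:R -> r0 <= l1norm R x -> b n <= l1norm R x ->
    (forall i, `|(w 0 i)%:~R - (x 0 i)%:~R - drf i n| <= 1) ->
    path_sum (box d N) (f (l1norm R x / K)) n (fun u => (u == w)%:R) <=
      C * (n%:R * psi (l1norm R x)) +
      (if al == 2 then C / b n ^+ d * expR (- (c * (l1norm R x / b n) ^+ 2)) else 0)].
Proof.
have [al2|al2] := eqVneq al 2; first exact: truncated_gaussian.
have [|M [M1 [K [C [r0 [MK K1 C0 h]]]]]] := truncated_heavy.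
  by rewrite lt_neqAle al2; case/andP: al02.
exists M; split => //; exists K, C, 1, r0; split => // n N x w *.
by rewrite addr0; exact: h.
Qed.

Lemma Pr_walk_le1 n w : Pr P [set o | walk X n o = w] <= 1.
Proof.
apply: (Pr_walk_le X_iid) => N; apply: path_sum_le_cst => //.
- by move=> z; exact: pmf_ge0.
- exact: (sum_pmf_le1 X_iid (box_uniq N)).
- by move=> u; rewrite lern1 leq_b1.
Qed.

(* As K >= 4 M, fewer than M steps of norm at most |x|/K stay within |x|/4. *)
Lemma truncated_short_walk (M : R) : exists r0 : R,
  forall (K : R) (n N : nat) (x w : 'rV[int]_d), 4 * M <= K -> 1 <= K ->
    n%:R <= M -> r0 <= l1norm R x ->
    (forall i, `|(w 0 i)%:~R - (x 0 i)%:~R - drf i n| <= 1) ->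
    path_sum (box d N) (f (l1norm R x / K)) n (fun u => (u == w)%:R) = 0.
Proof.
have [B B0 hB] := finite_upper_bound (fun n => \sum_i (1 + `|drf i n|)) (Num.truncn M).
exists (2 * B + 1) => K n N x w MK K1 nM hr wD; set r := l1norm R x in hr *.
have K0 : 0 < K by lra.
have nB : \sum_i (1 + `|drf i n|) <= B.
  by apply: hB; rewrite truncn_ge_nat// (le_trans _ nM).
apply: path_sum_truncated_eq0; first by rewrite divr_ge0 ?l1norm_ge0// ltW.
move=> u un; rewrite (_ : (u == w) = false)//; apply/negbTE/eqP => uw.
have nr : n%:R * (r / K) <= r / 4.
  rewrite mulrA ler_pdivrMr// [leRHS]mulrAC [n%:R * r]mulrC -mulrA.
  apply: ler_wpM2l; first exact: l1norm_ge0.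
  rewrite ler_pdivlMr//; apply: le_trans MK.
  by rewrite mulrC ler_pM2l.
have xw : r <= l1norm R w + B.
  have -> : r = l1norm R (w + (x - w)) by rewrite addrC subrK.
  apply: le_trans (ler_l1normD _ _) _; rewrite lerD2l; apply: le_trans nB.
  rewrite l1norm_sum; apply: ler_sum => i _.
  have h := wD i; rewrite !mxE rmorphB /=.
  set u1 : R := (x 0 i)%:~R; set v1 : R := (w 0 i)%:~R.
  rewrite (_ : u1 - v1 = - (v1 - u1 - drf i n) - drf i n); last by ring.
  by apply: le_trans (ler_normB _ _) _; rewrite normrN lerD2r.
move: un; rewrite uw; lra.
Qed.

(** The target [w] enters only through its distance to [x] plus the centering, which leaves the
    rounding of the centering open. *)
Theorem local_large_deviation : exists c C : R, [/\ 0 < c, 0 < C &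
  forall (n : nat) (x w : 'rV[int]_d), (0 < n)%N -> b n <= l1norm R x ->
    (forall i, `|(w 0 i)%:~R - (x 0 i)%:~R - drf i n| <= 1) ->
    Pr P [set o | walk X n o = w] <= C * (n%:R * psi (l1norm R x)) +
      (if al == 2 then C / b n ^+ d * expR (- (c * (l1norm R x / b n) ^+ 2)) else 0)].
Proof.
have [M [M1 [K [C [c [r1 [MK K1 C0 c0 hS]]]]]]] := truncated_bound.
have [r2 [Cb [r20 Cb0 hb]]] := local_tail_sup gamma_gt0 phi_sv X_local K1.
have [r3 hshort] := truncated_short_walk M.
pose R0 := 1 + `|r1| + r2 + `|r3|.
(* For norms up to [R0] the bound 1 on probabilities suffices: the norm is a positive integer, psi
   takes finitely many positive values there, and its minimum enters [C3]. *)
have [m m0 hm] : exists2 m : R, 0 < m &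
    forall k, (0 < k <= Num.truncn R0)%N -> m <= psi k%:R.
  by apply: finite_lower_bound => k k0; apply: psi_gt0; rewrite ltr0n.
pose C3 := C + Cb + m^-1.
have mV0 : 0 < m^-1 by rewrite invr_gt0.
have C30 : 0 < C3 by rewrite /C3; lra.
exists c, C3; split => // n x w n0 br wD.
have b0 := b_gt0 n0; set r := l1norm R x in br *.
have r0 : 0 < r by lra.
have nR : 1 <= n%:R :> R by rewrite ler1n.
have ps := psi_gt0 r0.
have Y0 : 0 <= n%:R * psi r by apply: mulr_ge0 => //; exact: ltW.
have bd0 : 0 < (b n ^+ d)^-1 by rewrite invr_gt0 exprn_gt0.
have gauss_le (C' : R) : C' <= C3 ->
    (if al == 2 then C' / b n ^+ d * expR (- (c * (r / b n) ^+ 2)) else 0) <=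
    (if al == 2 then C3 / b n ^+ d * expR (- (c * (r / b n) ^+ 2)) else 0).
  move=> CC; case: ifP => // _; apply: ler_wpM2r; first exact: expR_ge0.
  by rewrite ler_pM2r.
have gauss_ge0 : 0 <=
    (if al == 2 then C3 / b n ^+ d * expR (- (c * (r / b n) ^+ 2)) else 0).
  case: ifP => // _; apply: mulr_ge0; last exact: expR_ge0.
  by apply: mulr_ge0; exact: ltW.
have [rR|Rr] := leP r R0.
  have mpsi : m <= psi r.
    have rE : r = (\sum_i absz (x 0%R i))%N%:R by exact: l1normE.
    rewrite rE; apply: hm; rewrite -(ltr_nat R) -rE r0 /=.
    by rewrite truncn_ge_nat -?rE// (le_trans _ rR)// ltW.
  apply: le_trans (Pr_walk_le1 n w) _; rewrite -[leLHS]addr0; apply: lerD => //.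
  apply: (@le_trans _ _ (m^-1 * (n%:R * psi r))); last first.
    by apply: ler_wpM2r => //; rewrite /C3; lra.
  rewrite -[leLHS](mulVf (lt0r_neq0 m0)) ler_pM2l//.
  by rewrite -[leLHS]mul1r; apply: ler_pM => //; exact: ltW.
have nr1 := normr_ge0 r1; have nr3 := normr_ge0 r3.
have lr1 := ler_norm r1; have lr3 := ler_norm r3.
have r1r : r1 <= r by move: Rr lr1 nr3 r20; rewrite /R0; drop_local; lra.
have r2r : r2 <= r by move: Rr nr1 nr3; rewrite /R0; drop_local; lra.
have r3r : r3 <= r by move: Rr lr3 nr1 r20; rewrite /R0; drop_local; lra.
apply: (Pr_walk_le X_iid) => N.
have big := path_sum_big_jump (fun z => pmf_ge0 P X z) n
  (P := fun z => l1norm R z <= r / K) (B := Cb * psi r) w (box_uniq N)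
  (sum_pmf_le1 X_iid (box_uniq N)).
apply: le_trans (big _ _) _.
- by apply: mulr_ge0; exact: ltW.
- by move=> z; rewrite -ltNge => zr; apply: hb => //; exact: ltW.
have [Mn|nM] := leP M n%:R.
  apply: le_trans (lerD (hS n N x w Mn r1r br wD) (lexx _)) _.
  rewrite addrAC; apply: lerD; last by apply: gauss_le; move: Cb0 mV0; rewrite /C3; drop_local; lra.
  rewrite [n%:R * (Cb * _)]mulrCA -mulrDl; apply: ler_wpM2r => //.
  by move: mV0; rewrite /C3; drop_local; lra.
rewrite (hshort K n N x w MK K1 (ltW nM) r3r wD) add0r -[leLHS]addr0.
apply: lerD => //; rewrite mulrCA; apply: ler_wpM2r => //.
by move: C0 mV0; rewrite /C3; drop_local; lra.
Qed.

End LocalLargeDeviations.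

(** The finitely many initial indices are compared through their upper bound [U] and lower bound
    [m]; a long interval starting among them passes through [N]. *)
Lemma ratio_from_start {R : realType} (b : nat -> R) (s C : R) (n0 : nat) :
  (forall n, (0 < n)%N -> 0 < b n) -> 0 <= s -> 0 < C ->
  (forall k n, (n0 <= k)%N -> (k <= n)%N -> b n <= C * (n%:R / k%:R) `^ s * b k) ->
  exists2 C' : R, 1 <= C' & forall k n, (0 < k)%N -> (k <= n)%N ->
    b n <= C' * (n%:R / k%:R) `^ s * b k.
Proof.
move=> b0 s0 C0 h; pose N := n0.+1.
have [U U0 hU] := finite_upper_bound b N.
have [m m0 hm] := finite_lower_bound N b0.
have Um : 0 < U / m by rewrite divr_gt0.
exists ((1 + C) * (1 + U / m)).
  by rewrite -[leLHS]mul1r; apply: ler_pM => //; lra.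
have pw1 k n : (0 < k)%N -> (k <= n)%N -> 1 <= (n%:R / k%:R) `^ s :> R.
  move=> k0 kn; apply: powR_ge1 => //.
  by rewrite ler_pdivlMr ?ltr0n// mul1r ler_nat.
have short k : (0 < k <= N)%N -> U <= U / m * b k.
  by move=> kN; rewrite mulrAC ler_pdivlMr// ler_pM2l// hm.
move=> k n k0 kn; have bk := b0 k k0.
have pk := pw1 k n k0 kn.
have [Nk|kN] := leqP N k.
  apply: le_trans (h k n (ltnW Nk) kn) _.
  rewrite -mulrA -[leRHS]mulrA; apply: ler_wpM2r.
    by apply: mulr_ge0; [exact: powR_ge0|exact: ltW].
  by rewrite mulrDr mulr1; have : 0 < (1 + C) * (U / m); [rewrite mulr_gt0//; lra|lra].
have kN' : (0 < k <= N)%N by rewrite k0 ltnW.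
have [nN|Nn] := leqP n N.
  apply: le_trans (hU n nN) _; apply: le_trans (short k kN') _.
  apply: ler_wpM2r; first exact: ltW.
  rewrite -[leLHS]mulr1; apply: ler_pM => //; first exact: ltW.
  by rewrite mulrDl mul1r; have : 0 < C * (1 + U / m); [rewrite mulr_gt0//; lra|lra].
apply: le_trans (h N n (leqnSn n0) (ltnW Nn)) _.
apply: (@le_trans _ _ (C * (n%:R / k%:R) `^ s * (U / m * b k))).
  apply: ler_pM.
  - by apply: mulr_ge0; [exact: ltW|exact: powR_ge0].
  - by apply: ltW; exact: b0.
  - rewrite ler_pM2l//; apply: ge0_ler_powR => //; rewrite ?nnegrE ?divr_ge0//.
    rewrite ler_pM2l ?ltr0n; last exact: leq_trans kn.
    by rewrite lef_pV2 ?posrE ?ltr0n// ler_nat ltnW.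
  - by apply: le_trans (short k kN'); exact: hU.
rewrite mulrA; apply: ler_wpM2r; first exact: ltW.
rewrite mulrAC; apply: ler_wpM2r; first exact: powR_ge0.
by apply: ler_pM; [exact: ltW|exact: ltW|lra|lra].
Qed.

Theorem theorem2p4 (R : realType) (d : nat) (disp : measure_display)
    (Om : measurableType disp) (P : probability Om R)
    (X : nat -> Om -> 'rV[int]_d)
    (alpha : 'I_d -> R) (L : 'I_d -> R -> R) (p q : 'I_d -> R)
    (a : 'I_d -> nat -> R) (phi_ : 'I_d -> R -> R) (gamma_ : 'I_d -> R)
    (nu : probability (borel_space R d) R) (g : 'rV[R]_d -> R)
    (d_gt0 : (0 < d)%N)
    (X_attracted : attracted_walk P X alpha a L p q phi_ gamma_ nu g)
    (al : R) (an : nat -> R) (X_balanced : balanced alpha a al an)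
    (gamma : R) (gamma_gt0 : 0 < gamma)
    (phi : R -> R) (phi_sv : pos_slowly_varying phi)
    (X_local : forall x : 'rV[int]_d, x != 0 ->
      Pr P [set w | X 0%N w = x] <=
        phi (l1norm R x) * l1norm R x `^ (- (d%:R + gamma))) :
  exists c3 C3 : R, [/\ 0 < c3, 0 < C3 &
    forall (n : nat) (x : 'rV[int]_d), (0 < n)%N -> an n <= l1norm R x ->
      Pr P [set w | centered_walk P X alpha a n w = x] <=
        C3 * n%:R * phi (l1norm R x) * l1norm R x `^ (- (d%:R + gamma)) +
        (if al == 2
         then C3 / an n ^+ d * expR (- c3 * (l1norm R x / an n) ^+ 2)
         else 0)].
Proof.
case: X_attracted => X_iid X_aper al02 tails scal _ dens X_cvg _.
case: X_balanced => alE balE.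
have /choice[kap hkap] : forall i, exists kappa : R, 0 < kappa /\
    forall n, (0 < n)%N -> a i n = kappa * an n.
  by move=> i; have [k k0 hk] := balE i; exists k.
have kap_gt0 i : 0 < kap i by have [] := hkap i.
have a_kap i n : (0 < n)%N -> a i n = kap i * an n by have [_] := hkap i; exact.
have a_gt0 i n : (0 < n)%N -> 0 < a i n by have [h _] := scal i; exact: h.
pose i0 := Ordinal d_gt0.
have b_gt0 n : (0 < n)%N -> 0 < an n.
  by move=> n0; have := a_gt0 i0 n n0; rewrite a_kap// pmulr_rgt0.
have al02' : 0 < al <= 2 by rewrite -(alE i0).
have tails' i : regular_tails P (Defs.coord (X 0%N) i) al (L i) (p i) (q i).
  by rewrite -(alE i).
have scal' i : scaling P (Defs.coord (X 0%N) i) al (L i) (a i).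
  by rewrite -(alE i).
have mX : discrete_rv (X 0%N) by have [mX _ _] := X_iid; exact: mX.
have a_unbounded i (M : R) : exists N : nat, forall n, (N <= n)%N -> M <= a i n.
  have [N hN] := an_unbounded X_iid X_aper X_cvg d_gt0 kap_gt0 a_kap a_gt0 (M / kap i).
  exists N.+1 => n Nn; rewrite a_kap; last exact: leq_trans Nn.
  by rewrite mulrC -ler_pdivrMr//; apply: hN; exact: ltnW.
have [s [C1 [s0 C10 [n0 ratio]]]] :=
  scale_ratio al02' (tails' i0) (scal' i0) (a_unbounded i0).
(* The shift to [n0.+1] keeps [k] positive, where [a i0] is a multiple of [an]. *)
have [|C2 C21 an_ratio] := ratio_from_start (n0 := n0.+1) b_gt0 (ltW s0) C10.
  move=> k n nk kn; have := ratio k n (ltnW nk) kn.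
  have k0 : (0 < k)%N by exact: leq_trans nk.
  have n1 : (0 < n)%N by exact: leq_trans kn.
  by rewrite !a_kap// mulrCA ler_pM2l.
have [C C0 lb] := local_bound X_iid X_aper dens X_cvg d_gt0 kap_gt0 a_kap b_gt0
  C21 s0 an_ratio.
pose D := C2 * 3 `^ s.
have D0 : 0 < D by rewrite mulr_gt0 ?powR_gt0//; lra.
(* [D] compares a_n with a_m for n <= 2m + 1 <= 3m. The second summand covers m = 0, the empty half
   of a walk of one step, where the probability is only bounded by 1. *)
pose CQ := C * D ^+ d + an 1 ^+ d.
have CQ0 : 0 < CQ by rewrite addr_gt0 ?mulr_gt0 ?exprn_gt0// b_gt0.
have half n m v : (0 < n)%N -> (m <= n)%N -> (n <= m.*2.+1)%N ->
    Pr P [set o | walk X m o = v] <= CQ / an n ^+ d.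
  move=> n_gt0 mn nm; have bn := b_gt0 n n_gt0.
  have bnd : 0 < an n ^+ d by exact: exprn_gt0.
  have [m0|m_gt0] := posnP m.
    have n1 : n = 1 by move: nm n_gt0; rewrite m0; clear; lia.
    apply: le_trans (Pr_walk_le1 X_iid m v) _.
    rewrite ler_pdivlMr// mul1r /CQ n1 lerDr; apply: mulr_ge0; first exact: ltW.
    by apply: exprn_ge0; exact: ltW.
  have bm := b_gt0 m m_gt0.
  apply: le_trans (lb m v m_gt0) _.
  rewrite ler_pdivrMr ?exprn_gt0// mulrAC ler_pdivlMr//.
  have nD : an n <= D * an m.
    apply: le_trans (an_ratio m n m_gt0 mn) _; apply: ler_wpM2r; first exact: ltW.
    rewrite /D ler_pM2l; last by lra.
    apply: ge0_ler_powR; rewrite ?nnegrE ?divr_ge0//; first exact: ltW.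
    rewrite ler_pdivrMr ?ltr0n// -natrM ler_nat.
    by move: m_gt0 nm; clear; lia.
  apply: (@le_trans _ _ (C * (D * an m) ^+ d)).
    rewrite ler_pM2l//; apply: lerXn2r; rewrite ?nnegrE ?(ltW bn)//.
    by apply: mulr_ge0; exact: ltW.
  rewrite exprMn mulrA; apply: ler_wpM2r; first by rewrite exprn_ge0// ltW.
  by rewrite /CQ lerDl exprn_ge0// ltW// b_gt0.
have [c [C3 [c0 C30 H]]] := local_large_deviation X_iid d_gt0 al02' tails' scal'
  a_unbounded kap_gt0 a_kap b_gt0 CQ0 half gamma_gt0 phi_sv X_local.
exists c, C3; split => // n x n_gt0 anx.
pose w := x + \row_i Num.floor (drift P X alpha a i n).
have -> : [set o | centered_walk P X alpha a n o = x] = [set o | walk X n o = w].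
  apply/seteqP; split => o; rewrite /= /centered_walk /w.
    by move=> <-; rewrite subrK.
  by move=> ->; rewrite addrK.
apply: le_trans (H n x w n_gt0 anx _) _.
  move=> i; rewrite /w !mxE intrD /drift alE.
  set D' := centering _ _ _ _ _.
  have := floor_le D'; have := floorD1_gt D'; rewrite intrD => h1 h2.
  by rewrite ler_norml; apply/andP; split; lra.
by rewrite -!mulrA -mulNr.
Qed.
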